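(* Let $n$ be a positive integer and let $(\zeta_1,\zeta_2)\in\partial A_n\times\partial A_n$. Then $$\sum_{\eta\in\mathcal W_n^*(\zeta_1,\zeta_2)}\hat p_n(\eta)=\frac14\,Q_{01}(A_n)\,\exp\{2\,m(\mathcal J_{A_n})\}\;\Phi_n(\zeta_1,\zeta_2).$$
   Context: Identify $\mathbb Z^2=\mathbb Z+i\mathbb Z\subset\mathbb C$. For each positive integer $n$ let $A_n=\{j+ik\in\mathbb Z+i\mathbb Z: -n<j<n+1,\ -n<k<n\}$ and $\partial A_n=\{z\in\mathbb Z^2:\mathrm{dist}(z,A_n)=1\}$. Paths and loop-erased measure. A nearest neighbor path is a finite sequence $\omega=[\omega_0,\ldots,\omega_k]$ of points of $\mathbb Z^2$ with $|\omega_j-\omega_{j-1}|=1$ for $1\le j\le k$. Write $|\omega|=k$ and $p(\omega)=4^{-|\omega|}$. For $\zeta_1,\zeta_2\in\partial A_n$ let $\mathcal K_n(\zeta_1,\zeta_2)$ be the set of nearest neighbor paths $\omega=[\omega_0,\ldots,\omega_k]$ with $\omega_0=\zeta_1$, $\omega_k=\zeta_2$ and $\{\omega_1,\ldots,\omega_{k-1}\}\subset A_n$. Let $\mathcal W_n^*(\zeta_1,\zeta_2)$ be the set of self-avoiding paths (all vertices distinct) $\eta\in\mathcal K_n(\zeta_1,\zeta_2)$ that contain the directed edge $[0,1]$ or the directed edge $[1,0]$. The chronological loop-erasure $L(\omega)$ of $\omega=[\omega_0,\ldots,\omega_k]$ is: $s_0=\max\{j:\omega_j=\omega_0\}$ and,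 as long as $s_i<k$, $s_{i+1}=\max\{j:\omega_j=\omega_{s_i+1}\}$; if $s_r=k$, then $L(\omega)=[\omega_{s_0},\ldots,\omega_{s_r}]$. For $\eta\in\mathcal W_n^*(\zeta_1,\zeta_2)$ put $$\hat p_n(\eta)=\sum_{\omega\in\mathcal K_n(\zeta_1,\zeta_2),\ L(\omega)=\eta}p(\omega).$$ The quantity $\Phi_n$. Let $S$ be a simple random walk on $\mathbb Z^2$ starting at the origin and $T=T_n=\min\{j\ge1:S_j\in[0,\infty)\cup\partial A_n\}$. For $\zeta\in\partial A_n$ set $R_n(\zeta)=I(\zeta)\,\mathbb P\{S_T=\zeta\}$, where $I(\zeta)=-1$ if $\mathrm{Re}(\zeta)>0$ and $\mathrm{Im}(\zeta)<0$, and $I(\zeta)=1$ otherwise. For $\zeta\in\partial A_n$ let $\zeta^*=1-\overline{\zeta}\in\partial A_n$ (with $\overline{\zeta}$ the complex conjugate) be the reflection of $\zeta$ about the line $\{\mathrm{Re}(z)=1/2\}$. Define $$\Phi_n(\zeta_1,\zeta_2)=\left|R_n(\zeta_1)\,R_n(\zeta_2^* )-R_n(\zeta_1^* )\,R_n(\zeta_2)\right|.$$ Loop measure. A rooted loop is a nearest neighbor path $l=[l_0,l_1,\ldots,l_{2k}]$ with $l_0=l_{2k}$. An unrooted loop $\bar l$ is an equivalence class of rooted loops with $k>0$ under $[l_0,l_1,\ldots,l_{2k}]\sim[l_j,l_{j+1},\ldots,l_{2k},l_1,\ldots,l_j]$ for all $j$ (orientation is retained). The random walk loop measure is $m(\bar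 l)=4^{-|\bar l|}\,d(\bar l)/|\bar l|$, where $|\bar l|=2k$ is the number of steps and $d(\bar l)$ is the number of distinct rooted loops in the class $\bar l$; $m$ of a set of unrooted loops is the sum of $m(\bar l)$ over the set. Write $\bar l\subset A$ if all vertices of $\bar l$ lie in $A$, and $\bar l\cap V$ for the set of vertices in $V$ visited by $\bar l$. For a loop $l$, let $J(l)$ be the number of times $l$ crosses, in either direction, an edge between $-ki$ and $-ki+1$ with $k$ a positive integer; this depends only on the unrooted loop. Let $\mathcal J_A$ be the set of unrooted loops $\bar l\subset A$ such that $J(\bar l)$ is odd. Finally, $$Q_{01}(A_n)=\exp\left\{\sum_{\bar l\subset A_n,\ \bar l\cap\{0,1\}\ne\emptyset}m(\bar l)\,(-1)^{J(\bar l)}\right\}.$$ *)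

(* Defs.v *)
From HB Require Import structures.
From mathcomp Require Import all_boot all_order all_algebra.
From mathcomp Require Import finmap.
From mathcomp Require Import all_classical all_reals all_analysis.

Set Implicit Arguments.
Unset Strict Implicit.
Unset Printing Implicit Defensive.
Import Order.TTheory GRing.Theory Num.Theory.

Local Open Scope classical_set_scope.
Local Open Scope ring_scope.

(* j + ik in Z + iZ is encoded as (j, k).  Only the additive structure of
   [int * int] agrees with that of the complex numbers: its ring unit is
   (1, 1), so the complex number 1 is [site1] and never [1]. *)
Definition site := (int * int)%type.
Definition origin : site := (0, 0).
Definition site1 : site := (1, 0).

Definition sqnorm (z : site) : int := z.1 ^+ 2 + z.2 ^+ 2.

Definition adjacent : rel site := fun z w => sqnorm (w - z) == 1.

Definition box (n : nat) : set site :=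
  [set z | (- n%:Z < z.1 < n%:Z + 1) && (- n%:Z < z.2 < n%:Z)].

(* Euclidean distance in the plane *)
Definition dist (R : realType) (z : site) (A : set site) : R :=
  inf [set Num.sqrt ((sqnorm (z - a))%:~R : R) | a in A].

Definition boundary (R : realType) (n : nat) : set site :=
  [set z | dist R z (box n) = 1].

(* z |-> 1 - conj z *)
Definition reflection (z : site) : site := (1 - z.1, z.2).

(** Paths: [w_0, ..., w_k] is a sequence of size k + 1. *)

Definition nnpath (w : seq site) : bool :=
  if w is x :: s then path adjacent x s else false.

Definition nsteps (w : seq site) : nat := (size w).-1.

Definition weight (R : realType) (w : seq site) : R := 4 ^- nsteps w.

Definition Kpaths (n : nat) (z1 z2 : site) : set (seq site) :=
  [set w | [/\ nnpath w, w`_0 = z1, w`_(nsteps w) = z2 &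
    forall j, (0 < j < nsteps w)%N -> box n w`_j]].

Definition Wstar (n : nat) (z1 z2 : site) : set (seq site) :=
  [set eta | [/\ Kpaths n z1 z2 eta, uniq eta &
    infix [:: origin; site1] eta || infix [:: site1; origin] eta]].

Definition last_visit (w : seq site) (z : site) : nat :=
  \max_(j < size w | w`_j == z) j.

(* The sequence s_i, s_(i+1), ... of loop-erasure times, starting from
   s = s_i.  As these times strictly increase and are at most [nsteps w],
   [size w] recursive calls suffice. *)
Fixpoint erasure_times (fuel : nat) (w : seq site) (s : nat) : seq nat :=
  if fuel is fuel'.+1 then
    s :: (if (s < nsteps w)%N
          then erasure_times fuel' w (last_visit w w`_s.+1) else [::])
  else [::].

Definition loop_erasure (w : seq site) : seq site :=
  [seq w`_s | s <- erasure_times (size w) w (last_visit w w`_0)].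

Definition phat (R : realType) (n : nat) (z1 z2 : site) (eta : seq site)
    : \bar R :=
  \esum_(w in [set w | Kpaths n z1 z2 w /\ loop_erasure w = eta])
    (weight R w)%:E.

(** Simple random walk *)

Definition increment (Omega : Type) (S : nat -> Omega -> site) (j : nat)
    (x : Omega) : site := S j.+1 x - S j x.

(* The lattice carries its discrete sigma-algebra. *)
Definition independent_increments d (Omega : measurableType d) (R : realType)
    (P : probability Omega R) (S : nat -> Omega -> site) : Prop :=
  forall (J : seq nat) (B : nat -> set site), uniq J ->
    P (\bigcap_(j in [set` J]) (increment S j @^-1` B j)) =
    (\prod_(j <- J) P (increment S j @^-1` B j))%E.

Definition simple_random_walk d (Omega : measurableType d) (R : realType)
    (P : probability Omega R) (S : nat -> Omega -> site) : Prop :=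
  [/\ forall x, S 0%N x = origin,
      forall j (B : set site), measurable (S j @^-1` B),
      forall j (e : site), sqnorm e = 1 ->
        P (increment S j @^-1` [set e]) = (4^-1)%:E &
      independent_increments P S].

(* [0, +oo[ together with the boundary of A_n *)
Definition target (R : realType) (n : nat) : set site :=
  [set z | z.2 = 0 /\ 0 <= z.1] `|` boundary R n.

(* k = T_n(x); no such k exists when T_n(x) is infinite. *)
Definition is_hitting_time (R : realType) (n : nat) (Omega : Type)
    (S : nat -> Omega -> site) (x : Omega) (k : nat) : Prop :=
  [/\ (1 <= k)%N, target R n (S k x) &
      forall j, (1 <= j < k)%N -> ~ target R n (S j x)].

Definition hits_at (R : realType) (n : nat) (Omega : Type)
    (S : nat -> Omega -> site) (z : site) : set Omega :=
  [set x | exists2 k, is_hitting_time R n S x k & S k x = z].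

Definition sign_I (R : realType) (z : site) : R :=
  if (0 < z.1) && (z.2 < 0) then -1 else 1.

Definition Rn d (Omega : measurableType d) (R : realType)
    (P : probability Omega R) (S : nat -> Omega -> site) (n : nat)
    (z : site) : R :=
  sign_I R z * fine (P (hits_at R n S z)).

Definition Phi d (Omega : measurableType d) (R : realType)
    (P : probability Omega R) (S : nat -> Omega -> site) (n : nat)
    (z1 z2 : site) : R :=
  `| Rn P S n z1 * Rn P S n (reflection z2)
     - Rn P S n (reflection z1) * Rn P S n z2 |.

(** Loop measure *)

Definition rooted_loop (l : seq site) : Prop :=
  nnpath l /\ l`_0 = l`_(nsteps l).

(* [l_j, ..., l_2k, l_1, ..., l_j] *)
Definition reroot (j : nat) (l : seq site) : seq site :=
  drop j l ++ take j (behead l).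

Definition loop_class (l : seq site) : set (seq site) :=
  [set reroot j l | j in [set j | (j <= nsteps l)%N]].

Definition uloop := set (seq site).

Definition unrooted_loop : set uloop :=
  [set L | exists l, [/\ rooted_loop l, (0 < nsteps l)%N & L = loop_class l]].

(* an arbitrary rooted representative *)
Definition representative (L : uloop) : seq site := xget [::] L.

Definition loop_length (L : uloop) : nat := nsteps (representative L).

Definition loop_vertices (L : uloop) : set site :=
  [set z | exists2 l, L l & z \in l].

Definition loop_measure (R : realType) (L : uloop) : R :=
  4 ^- loop_length L * #|` fset_set L |%:R / (loop_length L)%:R.

(* the edge joining z and w is {-ki, -ki + 1} for some integer k > 0 *)
Definition crossing (z w : site) : Prop :=
  exists2 k : nat, (0 < k)%N &
    (z = (0, - k%:Z) /\ w = (1, - k%:Z)) \/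
    (z = (1, - k%:Z) /\ w = (0, - k%:Z)).

Definition crossings (l : seq site) : nat :=
  (\sum_(j < nsteps l) `[< crossing (l`_j)%R (l`_j.+1)%R >])%N.

Definition Jcount (L : uloop) : nat := crossings (representative L).

Definition loops_in (A : set site) : set uloop :=
  [set L | unrooted_loop L /\ loop_vertices L `<=` A].

Definition odd_loops (A : set site) : set uloop :=
  [set L | loops_in A L /\ odd (Jcount L)].

Definition loop_mass (R : realType) (D : set uloop) : \bar R :=
  \esum_(L in D) (loop_measure R L)%:E.

(* [esum] is meant for nonnegative families only; for a summable real family,
   this is the value of its unconditional sum. *)
Definition signed_sum (R : realType) (T : choiceType) (D : set T) (f : T -> R)
    : \bar R :=
  (\esum_(x in D) (Num.max (f x) 0)%:E - \esum_(x in D) (Num.max (- f x) 0)%:E)%E.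

Definition Q01 (R : realType) (A : set site) : \bar R :=
  expeR (signed_sum
    [set L | loops_in A L /\ loop_vertices L `&` [set origin; site1] !=set0]
    (fun L => loop_measure R L * (-1) ^+ Jcount L)).

(* Main.v *)
Require Import Defs.
From mathcomp Require Import all_boot all_order all_algebra.
From mathcomp Require Import finmap.
From mathcomp Require Import all_classical all_reals all_analysis.
From mathcomp Require Import zify ring lra.


(** Let [p] be the step weights of the simple random walk and [q] the same
    weights with a minus sign on the edges that cross the zipper, the half-line
    going down from the middle of the edge [{0, 1}].  For a finite set [B] of
    sites, [G_B] is the Green's function, [K_B(s, b)] the excursion kernel (the
    weight of the walks from [s] to [b] through [B]) and [L_B] the loop sum of
    [B], each of them for either family of weights.

    Loop erasure.  Cutting a walk at its last visit to each vertex of its loop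
    erasure [eta] shows that the walks with erasure [eta] have total weight
    [p(eta)] times a product of diagonal Green's functions, one for each vertex
    and each in the set from which the previous vertices have been removed
    ([esum_loop_erasure]).  As [G_B(v, v) = exp(L_B - L_(B - v))]
    ([expR_loop_sum]), this product is [exp(L_A - L_(A - eta))].

    Topology.  If [eta] starts on the boundary and visits the origin, then a loop
    disjoint from [eta] crosses the zipper an even number of times: a loop that
    crosses it an odd number of times winds around the origin.  Hence [p] and [q]
    have the same loop sum on [A - eta] ([loop_sum_zipped]), while on [A] the two
    loop sums differ by twice the mass of the odd loops ([loop_mass_odd]).
    Moreover the sign of [q(eta)] is a function of the two endpoints and of the
    direction in which [eta] uses the edge [{0, 1}], and it changes with that
    direction ([path_crossing_parity], [crossing_parityN]).  So, up to a global
    sign and the factor [exp(2 m(J_A))], the left-hand side is the sum over all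
    self-avoiding [eta] of [q(eta) exp(L_A - L_(A - eta))] counted [+1] or [-1]
    according to the direction of the edge ([phat_weight_zipped]).

    Fomin's identity.  This signed sum is a two-by-two determinant of excursion
    kernels ([sum_saw_path_sum], [fomin_edge]).  Removing the points [0] and [1]
    from [A] factors out of it the product of Green's functions that is
    [Q01(A)] ([excursion_det], [Q01_erasure_weight]).

    Reflection.  In the box without [0] and [1], the [q]-weighted walks from [0]
    that touch the half-line [2, 3, ...] cancel, since those arriving from above
    and from below have opposite signs ([excursion_slit_point]).  The others live
    in a slit box, where the sign of a walk is determined by its endpoint, so the
    kernel at [0] is [R_n] ([Rn_excursion]).  The reflection that exchanges [0]
    and [1] preserves [q] and gives the kernel at [1] ([excursion_site1]). *)

Set Implicit Arguments.
Unset Strict Implicit.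
Unset Printing Implicit Defensive.
Import Order.TTheory GRing.Theory Num.Theory numFieldNormedType.Exports.

Local Open Scope ring_scope.
Local Open Scope classical_set_scope.

Local Notation adjacent := Defs.adjacent.

(** * Green's functions of a finite set *)

Section Green.
Variables (R : realType) (T : choiceType).
Implicit Types (Q : T -> T -> R) (B : {fset T}) (x y z v s b : T).

Fixpoint walk_weight Q B (k : nat) x y : R :=
  if k is k'.+1 then \sum_(z <- B) Q x z * walk_weight Q B k' z y
  else (x == y)%:R.

Definition green Q B x y : R := limn (series (fun k => walk_weight Q B k x y)).

(** Geometric decay of the walk weights, certified by a weight function [phi]
    that [|Q|] decreases by a fixed factor. *)
Definition contracting Q B : Prop :=
  exists (phi : T -> R) (lam : R), [/\ 0 <= lam, lam < 1,
    forall x, x \in B -> 0 < phi x &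
    forall x, x \in B -> \sum_(z <- B) `|Q x z| * phi z <= lam * phi x].

Lemma contracting_le Q Q' B B' : (B' `<=` B)%fset ->
  (forall x y, `|Q' x y| <= `|Q x y|) -> contracting Q B -> contracting Q' B'.
Proof.
move=> sB leQ [phi [lam [l0 l1 p0 H]]]; exists phi, lam; split=> // [x /(fsubsetP sB)/p0//|].
move=> x xB'; have xB := fsubsetP sB _ xB'.
apply: le_trans (H x xB); rewrite [leRHS](big_fsetID _ (mem B'))/=.
have -> : [fset x in B | x \in B']%fset = B'.
  apply/fsetP => y; rewrite !inE /=; case: (boolP (y \in B')) => yB'; rewrite ?andbF// andbT.
  exact: (fsubsetP sB).
rewrite -[leLHS]addr0 lerD//.
  rewrite big_seq [leRHS]big_seq; apply: ler_sum => z zB'.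
  by rewrite ler_wpM2r// ltW// p0// (fsubsetP sB).
rewrite big_seq sumr_ge0// => z; rewrite !inE => /andP[/p0 ? _].
by rewrite mulr_ge0// ltW.
Qed.

Lemma contracting_sub Q B B' : (B' `<=` B)%fset ->
  contracting Q B -> contracting Q B'.
Proof. by move=> sB; apply: contracting_le. Qed.

Lemma walk_weight_bound Q B : contracting Q B -> exists C lam : R,
  [/\ 0 <= C, 0 < lam, lam < 1 &
   forall k x y, x \in B -> y \in B -> `|walk_weight Q B k x y| <= C * lam ^+ k].
Proof.
move=> [phi [lam0 [l0 l1 p0 H]]].
pose lam := Num.max lam0 2^-1.
have {}l1 : lam < 1 by rewrite /lam gt_max l1 invf_lt1// ltr1n.
have {}l0 : 0 < lam by rewrite /lam lt_max invr_gt0 ltr0n orbT.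
have {}H x : x \in B -> \sum_(z <- B) `|Q x z| * phi z <= lam * phi x.
  move=> xB; apply: le_trans (H x xB) _; apply: ler_wpM2r; first exact/ltW/p0.
  by rewrite /lam le_max lexx.
have key k x y : x \in B -> y \in B -> `|walk_weight Q B k x y| <= phi x / phi y * lam ^+ k.
  move=> + yB; elim: k x => [|k IH] x xB /=.
    rewrite expr0 mulr1; case: eqP => [->|_]; first by rewrite normr1 divff// gt_eqF// p0.
    by rewrite normr0 divr_ge0// ltW// p0.
  apply: le_trans (ler_norm_sum _ _ _) _.
  apply: le_trans (_ : \sum_(z <- B) `|Q x z| * phi z * (lam ^+ k / phi y) <= _).
    rewrite big_seq [leRHS]big_seq; apply: ler_sum => z zB.
    rewrite normrM -mulrA ler_wpM2l//; apply: le_trans (IH z zB) _.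
    by rewrite le_eqVlt; apply/orP; left; apply/eqP; ring.
  rewrite -mulr_suml; apply: le_trans (ler_wpM2r _ (H x xB)) _.
    by rewrite divr_ge0 ?exprn_ge0// ltW// p0.
  by rewrite exprS le_eqVlt; apply/orP; left; apply/eqP; ring.
exists (\sum_(x <- B) \sum_(y <- B) phi x / phi y), lam; split=> //.
  rewrite big_seq sumr_ge0// => x xB; rewrite big_seq sumr_ge0// => y yB.
  by rewrite divr_ge0// ltW// p0.
move=> k x y xB yB; apply: le_trans (key k x y xB yB) _.
apply: ler_wpM2r; first exact/exprn_ge0/ltW.
rewrite (big_fsetD1 x)//= (big_fsetD1 y)//= -addrA lerDl addr_ge0//.
  rewrite big_seq sumr_ge0// => z; rewrite !inE => /andP[_ zB].
  by rewrite divr_ge0// ltW// p0.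
rewrite big_seq sumr_ge0// => z; rewrite !inE => /andP[_ zB].
rewrite big_seq sumr_ge0// => w wB.
by rewrite divr_ge0// ltW// p0.
Qed.

Lemma cvg_sum_seq (I : choiceType) (r : seq I) (u : I -> nat -> R) (l : I -> R) :
  (forall i, i \in r -> u i k @[k --> \oo] --> l i) ->
  \sum_(i <- r) u i k @[k --> \oo] --> \sum_(i <- r) l i.
Proof.
elim: r => [|i r IH] H.
  by under eq_fun do rewrite big_nil; rewrite big_nil; apply: cvg_cst.
under eq_fun do rewrite big_cons; rewrite big_cons.
apply: cvgD; first by apply: H; rewrite inE eqxx.
by apply: IH => j jr; apply: H; rewrite inE jr orbT.
Qed.

Lemma green_cvg Q B x y : contracting Q B -> x \in B -> y \in B ->
  series (fun k => walk_weight Q B k x y) n @[n --> \oo] --> green Q B x y.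
Proof.
move=> /walk_weight_bound[C [lam [C0 l0 l1 H]]] xB yB.
apply: normed_cvg; apply: (@series_le_cvg _ _ (geometric C lam)) => //= [n|n|].
- by rewrite mulr_ge0// exprn_ge0// ltW.
- exact: H.
- by apply: is_cvg_geometric_series; rewrite ger0_norm// ltW.
Qed.

Lemma green_first_step Q B x y : contracting Q B -> x \in B -> y \in B ->
  green Q B x y = (x == y)%:R + \sum_(z <- B) Q x z * green Q B z y.
Proof.
move=> cQ xB yB; rewrite {1}/green; apply: cvg_lim => //; rewrite -cvg_shiftS.
have -> : [sequence series (fun k => walk_weight Q B k x y) n.+1]_n =
  (fun n => (x == y)%:R + \sum_(z <- B) Q x z * series (fun k => walk_weight Q B k z y) n).
  apply/funext => n; rewrite /series /= big_nat_recl//=; congr (_ + _).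
  rewrite exchange_big/=; apply: eq_bigr => z _; by rewrite mulr_sumr.
apply: cvgD; first exact: cvg_cst.
apply: cvg_sum_seq => z zB; apply: cvgM; first exact: cvg_cst.
exact: green_cvg.
Qed.

Lemma walk_weightSr Q B k x y : x \in B -> y \in B ->
  walk_weight Q B k.+1 x y = \sum_(z <- B) walk_weight Q B k x z * Q z y.
Proof.
move=> + yB; elim: k x => [|k IH] x xB.
  rewrite /= (big_fsetD1 y)//= eqxx mulr1 big1_seq ?addr0; last first.
    by move=> z /= ; rewrite !inE => /andP[/negPf-> _]; rewrite mulr0.
  rewrite [RHS](big_fsetD1 x)//= eqxx mul1r big1_seq ?addr0//.
  by move=> z /= ; rewrite !inE => /andP[/negPf zx _]; rewrite eq_sym zx mul0r.
rewrite [LHS]/= big_seq (eq_bigr (fun z => \sum_(w <- B) Q x z * (walk_weight Q B k z w * Q w y))).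
  rewrite -big_seq exchange_big/=; apply: eq_bigr => w _.
  by rewrite mulr_suml; apply: eq_bigr => z _; rewrite mulrA.
by move=> z zB; rewrite -/(walk_weight Q B k.+1 z y) IH// mulr_sumr.
Qed.

Lemma green_last_step Q B x y : contracting Q B -> x \in B -> y \in B ->
  green Q B x y = (x == y)%:R + \sum_(z <- B) green Q B x z * Q z y.
Proof.
move=> cQ xB yB; rewrite {1}/green; apply: cvg_lim => //; rewrite -cvg_shiftS.
have -> : [sequence series (fun k => walk_weight Q B k x y) n.+1]_n =
  (fun n => (x == y)%:R + \sum_(z <- B) series (fun k => walk_weight Q B k x z) n * Q z y).
  apply/funext => n; rewrite /series [LHS]/= big_nat_recl//; congr (_ + _).
  under eq_bigr do rewrite walk_weightSr//.
  rewrite exchange_big/=; apply: eq_bigr => z _; by rewrite mulr_suml.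
apply: cvgD; first exact: cvg_cst.
apply: cvg_sum_seq => z zB; apply: cvgM; last exact: cvg_cst.
exact: green_cvg.
Qed.

(** The Green's function inverts [1 - Q] on [B]. *)
Lemma green_solve Q B (u f : T -> R) : contracting Q B ->
  (forall x, x \in B -> u x = f x + \sum_(z <- B) Q x z * u z) ->
  forall x, x \in B -> u x = \sum_(y <- B) green Q B x y * f y.
Proof.
move=> cQ uf x xB.
have -> : \sum_(y <- B) green Q B x y * f y =
   \sum_(y <- B) green Q B x y * u y - \sum_(y <- B) \sum_(z <- B) green Q B x y * Q y z * u z.
  rewrite -sumrB big_seq [RHS]big_seq; apply: eq_bigr => y yB.
  rewrite {1}(uf y yB) mulrDr mulr_sumr.
  by under [X in _ = _ + X - _]eq_bigr do rewrite mulrA; rewrite addrK.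
rewrite exchange_big/= -sumrB (big_fsetD1 x)//= [X in _ + X]big1_seq ?addr0.
  by rewrite -mulr_suml {1}(green_last_step cQ xB xB) eqxx mulrDl mul1r addrK.
move=> z /=; rewrite !inE => /andP[zx zB].
by rewrite -mulr_suml (green_last_step cQ xB zB) eq_sym (negPf zx) add0r subrr.
Qed.

Lemma green_unique Q B (u : T -> R) : contracting Q B ->
  (forall x, x \in B -> u x = \sum_(z <- B) Q x z * u z) ->
  forall x, x \in B -> u x = 0.
Proof.
move=> cQ H x xB; rewrite (green_solve (f := fun=> 0) cQ)//.
  by rewrite big1// => y _; rewrite mulr0.
by move=> y yB; rewrite add0r H.
Qed.

(** The excursion kernel: total weight of the walks from [s] to [b] whose
    intermediate points lie in [B]. *)
Definition excursion Q B s b : R :=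
  Q s b + \sum_(y <- B) Q s y * \sum_(z <- B) green Q B y z * Q z b.

Lemma excursion_green Q B x b : contracting Q B -> x \in B ->
  excursion Q B x b = \sum_(z <- B) green Q B x z * Q z b.
Proof.
move=> cQ xB; rewrite /excursion.
transitivity (\sum_(z <- B) (x == z)%:R * Q z b +
              \sum_(z <- B) (\sum_(y <- B) Q x y * green Q B y z) * Q z b).
  congr (_ + _).
    rewrite (big_fsetD1 x)//= eqxx mul1r big1_seq ?addr0// => z /=.
    by rewrite !inE eq_sym => /andP[/negPf-> _]; rewrite mul0r.
  under eq_bigr do rewrite mulr_sumr.
  rewrite exchange_big/=; apply: eq_bigr => z _.
  by rewrite mulr_suml; apply: eq_bigr => y _; rewrite mulrA.
rewrite -big_split/= big_seq [RHS]big_seq; apply: eq_bigr => z zB.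
by rewrite -mulrDl -green_first_step.
Qed.

Lemma excursion_step Q B s b : contracting Q B ->
  excursion Q B s b = Q s b + \sum_(y <- B) Q s y * excursion Q B y b.
Proof.
move=> cQ; congr (_ + _); rewrite big_seq [RHS]big_seq; apply: eq_bigr => y yB.
by rewrite -excursion_green.
Qed.

(** Decomposition of an excursion at its first visit to [v]. *)
Lemma excursionD1 Q B v s b : contracting Q B -> v \in B ->
  excursion Q B s b = excursion Q (B `\ v)%fset s b
    + excursion Q (B `\ v)%fset s v * excursion Q B v b.
Proof.
move=> cQ vB; have cQ' := contracting_sub (fsubD1set B v) cQ.
set B' := (B `\ v)%fset in cQ' *.
have inB x : x \in B' -> excursion Q B x b =
    excursion Q B' x b + excursion Q B' x v * excursion Q B v b.
  move=> xB'; apply/eqP; rewrite -subr_eq0; apply/eqP.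
  apply: (green_unique (u := fun x => excursion Q B x b -
    (excursion Q B' x b + excursion Q B' x v * excursion Q B v b)) cQ') xB' => y yB'.
  rewrite (excursion_step y b cQ) (excursion_step y b cQ') (excursion_step y v cQ').
  rewrite (big_fsetD1 v)//= -/B'.
  rewrite [RHS](eq_bigr (fun z => Q y z * excursion Q B z b - (Q y z * excursion Q B' z b
    + Q y z * excursion Q B' z v * excursion Q B v b))); last by move=> *; ring.
  rewrite sumrB big_split/= -mulr_suml; ring.
rewrite (excursion_step s b cQ) (excursion_step s b cQ') (excursion_step s v cQ').
rewrite (big_fsetD1 v)//= -/B'.
rewrite (eq_big_seq (fun y => Q s y * excursion Q B' y b
    + Q s y * excursion Q B' y v * excursion Q B v b)).
  by rewrite big_split/= -mulr_suml; ring.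
by move=> y yB'; rewrite inB//; ring.
Qed.

Lemma green_col Q B x v : contracting Q B -> v \in B -> x \in (B `\ v)%fset ->
  green Q B x v = excursion Q (B `\ v)%fset x v * green Q B v v.
Proof.
move=> cQ vB xB'; have cQ' := contracting_sub (fsubD1set B v) cQ.
set B' := (B `\ v)%fset in cQ' xB' *.
apply/eqP; rewrite -subr_eq0; apply/eqP.
apply: (green_unique (u := fun x => green Q B x v -
  excursion Q B' x v * green Q B v v) cQ') xB' => y yB'.
move: (yB'); rewrite !inE => /andP[yv yB].
rewrite (green_first_step cQ yB vB) (excursion_step y v cQ') (negPf yv).
rewrite (big_fsetD1 v)//= -/B'.
rewrite [RHS](eq_bigr (fun z => Q y z * green Q B z v
  - Q y z * excursion Q B' z v * green Q B v v)); last by move=> *; ring.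
by rewrite sumrB -mulr_suml; ring.
Qed.

(** The loops at [v] are the sequences of excursions from [v] to [v], so that
    [G(v, v)] sums a geometric series. *)
Lemma green_diag Q B v : contracting Q B -> v \in B ->
  green Q B v v * (1 - excursion Q (B `\ v)%fset v v) = 1.
Proof.
move=> cQ vB; have cQ' := contracting_sub (fsubD1set B v) cQ.
set B' := (B `\ v)%fset in cQ' *.
rewrite (excursion_step v v cQ').
have := green_first_step cQ vB vB; rewrite eqxx (big_fsetD1 v)//= -/B'.
rewrite (eq_big_seq (fun y => Q v y * excursion Q B' y v * green Q B v v)).
  rewrite -mulr_suml => H; rewrite mulrBr mulr1 {1}H; ring.
by move=> y yB'; rewrite (green_col cQ vB yB'); ring.
Qed.

(** A walk from [v] is a loop at [v] followed by an excursion that does not come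
    back to [v]. *)
Lemma excursion_green_diag Q B v b : contracting Q B -> v \in B ->
  excursion Q B v b = green Q B v v * excursion Q (B `\ v)%fset v b.
Proof.
move=> cQ vB.
have := green_diag cQ vB; have := excursionD1 v b cQ vB.
set g := green _ _ _ _; set k := excursion _ _ v v; set K := excursion Q B v b.
set K' := excursion _ _ v b => hK hg.
have : K * (1 - k) = K' by rewrite mulrBr mulr1 {1}hK; ring.
by move=> <-; rewrite mulrCA hg mulr1.
Qed.

(** The walks counted by [G_B] and not by [G_(B - v)] are those through [v].  As a
    function of [x], the right-hand side vanishes at [v], so that it solves the
    equation of the Green's function in [B] without [v]. *)
Lemma greenD1 Q B v x y : contracting Q B -> v \in B ->
  x \in (B `\ v)%fset -> y \in (B `\ v)%fset ->
  green Q B v v * green Q (B `\ v)%fset x y =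
  green Q B v v * green Q B x y - green Q B x v * green Q B v y.
Proof.
move=> cQ vB xB' yB'; have cQ' := contracting_sub (fsubD1set B v) cQ.
set B' := (B `\ v)%fset in cQ' xB' yB' *.
move: (yB'); rewrite !inE => /andP[yv yB].
pose u x := green Q B v v * green Q B x y - green Q B x v * green Q B v y.
rewrite -/(u x) (green_solve (u := u) (f := fun z => green Q B v v * (z == y)%:R) cQ')//.
  rewrite (big_fsetD1 y)//= eqxx mulr1 big1_seq ?addr0 1?mulrC// => z /=.
  by rewrite !inE => /andP[/negPf-> _]; rewrite !mulr0.
move=> z zB'; move: (zB'); rewrite !inE => /andP[zv zB].
rewrite /u (green_first_step cQ zB yB) (green_first_step cQ zB vB) (negPf zv).
rewrite !(big_fsetD1 v vB)/= -/B'.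
rewrite [in RHS](eq_bigr (fun i => green Q B v v * (Q z i * green Q B i y)
  - Q z i * green Q B i v * green Q B v y)); last by move=> *; ring.
by rewrite sumrB -mulr_suml -mulr_sumr; ring.
Qed.

(** First step into [B `\ v]: the escape identity used to peel off the first
    vertex of a loop erasure. *)
Lemma green_row Q B v y : contracting Q B -> v \in B -> y \in (B `\ v)%fset ->
  green Q B v y = green Q B v v *
    \sum_(z <- (B `\ v)%fset) Q v z * green Q (B `\ v)%fset z y.
Proof.
move=> cQ vB yB'; move: (yB'); rewrite !inE => /andP[yv yB].
rewrite mulr_sumr (eq_big_seq (fun z => green Q B v v * (Q v z * green Q B z y)
   - (Q v z * green Q B z v) * green Q B v y)); last first.
  move=> z zB'; rewrite mulrCA greenD1//; ring.
rewrite sumrB -mulr_suml -mulr_sumr.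
have := green_first_step cQ vB vB; have := green_first_step cQ vB yB.
rewrite eqxx eq_sym (negPf yv) !(big_fsetD1 v vB)/= add0r.
set a := green Q B v y; set g := green Q B v v; set q := Q v v.
set S := \sum_(_ <- _) _; set S' := \sum_(_ <- _) _ => h1 h2.
have -> : S = a - q * a by rewrite {1}h1; ring.
have -> : S' = g - 1 - q * g by rewrite {1}h2; ring.
ring.
Qed.

Lemma walk_weight_sym Q B k x y : (forall x y, Q x y = Q y x) ->
  x \in B -> y \in B -> walk_weight Q B k x y = walk_weight Q B k y x.
Proof.
move=> sQ; elim: k x y => [|k IH] x y xB yB; first by rewrite /= eq_sym.
rewrite walk_weightSr//= big_seq [RHS]big_seq; apply: eq_bigr => z zB.
by rewrite sQ IH// mulrC.
Qed.

Lemma green_sym Q B x y : (forall x y, Q x y = Q y x) ->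
  x \in B -> y \in B -> green Q B x y = green Q B y x.
Proof.
move=> sQ xB yB; congr (limn (series _)); apply/funext => k.
exact: walk_weight_sym.
Qed.

(** Conjugating the weights by signs multiplies every walk by the signs of its
    two endpoints. *)
Lemma walk_weight_gauge Q Q' (eps : T -> R) B k x y :
  (forall x, eps x * eps x = 1) ->
  (forall x y, x \in B -> y \in B -> Q' x y = eps x * Q x y * eps y) ->
  x \in B -> y \in B ->
  walk_weight Q' B k x y = eps x * walk_weight Q B k x y * eps y.
Proof.
move=> ee HQ + yB; elim: k x => [|k IH] x xB /=.
  by case: eqP => [->|_]; rewrite ?mulr1 ?ee// mulr0 mul0r.
rewrite mulr_sumr mulr_suml; apply: eq_big_seq => z zB; rewrite HQ// IH//.
transitivity (eps x * Q x z * (eps z * eps z) * walk_weight Q B k z y * eps y); first by ring.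
by rewrite ee; ring.
Qed.

Lemma green_gauge Q Q' (eps : T -> R) B x y :
  contracting Q B -> contracting Q' B ->
  (forall x, eps x * eps x = 1) ->
  (forall x y, x \in B -> y \in B -> Q' x y = eps x * Q x y * eps y) ->
  x \in B -> y \in B -> green Q' B x y = eps x * green Q B x y * eps y.
Proof.
move=> cQ cQ' ee HQ xB yB.
rewrite {1}/green; apply: cvg_lim => //.
have -> : series (fun k => walk_weight Q' B k x y) =
   (fun n => eps x * series (fun k => walk_weight Q B k x y) n * eps y).
  apply/funext => n; rewrite /series/= mulr_sumr mulr_suml; apply: eq_bigr => k _.
  exact: walk_weight_gauge.
apply: cvgM; last exact: cvg_cst.
by apply: cvgM; [exact: cvg_cst|exact: green_cvg].
Qed.

Lemma big_fset_involution (B : {fset T}) (sg : T -> T) (F : T -> R) :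
  involutive sg -> (forall x, x \in B -> sg x \in B) ->
  \sum_(x <- B) F x = \sum_(x <- B) F (sg x).
Proof.
move=> sgK sgB.
have BE : perm_eq B (map sg B).
  apply: uniq_perm; rewrite ?fset_uniq ?(map_inj_uniq (can_inj sgK)) ?fset_uniq//.
  move=> x; apply/idP/mapP => [xB|[y yB ->]]; last exact: sgB.
  by exists (sg x); rewrite ?sgK//; exact: sgB.
by rewrite (perm_big _ BE) big_map.
Qed.

Lemma walk_weight_involution Q B (sg : T -> T) k x y :
  involutive sg -> (forall x, x \in B -> sg x \in B) ->
  (forall x y, Q (sg x) (sg y) = Q x y) ->
  walk_weight Q B k (sg x) (sg y) = walk_weight Q B k x y.
Proof.
move=> sgK sgB sgQ; elim: k x => [|k IH] x /=; first by rewrite (can_eq sgK).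
rewrite (big_fset_involution _ sgK sgB); apply: eq_bigr => z _.
by rewrite sgQ IH.
Qed.

Lemma green_involution Q B (sg : T -> T) x y :
  involutive sg -> (forall x, x \in B -> sg x \in B) ->
  (forall x y, Q (sg x) (sg y) = Q x y) ->
  green Q B (sg x) (sg y) = green Q B x y.
Proof.
move=> sgK sgB sgQ; congr (limn (series _)); apply/funext => k.
exact: walk_weight_involution.
Qed.

Lemma excursion_involution Q B (sg : T -> T) s b :
  involutive sg -> (forall x, x \in B -> sg x \in B) ->
  (forall x y, Q (sg x) (sg y) = Q x y) ->
  excursion Q B (sg s) (sg b) = excursion Q B s b.
Proof.
move=> sgK sgB sgQ; rewrite /excursion sgQ; congr (_ + _).
rewrite (big_fset_involution _ sgK sgB); apply: eq_bigr => y _; rewrite sgQ.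
congr (_ * _); rewrite (big_fset_involution _ sgK sgB).
by apply: eq_bigr => z _; rewrite sgQ green_involution.
Qed.

Lemma excursion_gauge Q Q' (eps : T -> R) B s b :
  contracting Q B -> contracting Q' B ->
  (forall x, eps x * eps x = 1) ->
  (forall x y, x \in s |` B -> y \in b |` B -> Q' x y = eps x * Q x y * eps y)%fset ->
  excursion Q' B s b = eps s * excursion Q B s b * eps b.
Proof.
move=> cQ cQ' ee HQ; rewrite /excursion mulrDr mulrDl; congr (_ + _).
  by rewrite HQ// !inE eqxx.
rewrite mulr_sumr mulr_suml; apply: eq_big_seq => y yB.
rewrite HQ ?inE ?eqxx ?yB ?orbT//.
rewrite (_ : \sum_(z <- B) green Q' B y z * Q' z b =
             eps y * (\sum_(z <- B) green Q B y z * Q z b) * eps b).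
  rewrite -[RHS]mulr1 -(ee y); ring.
rewrite mulr_sumr mulr_suml; apply: eq_big_seq => z zB.
rewrite HQ ?inE ?eqxx ?zB ?orbT// (green_gauge cQ cQ' ee)//; last first.
  by move=> w w' wB w'B; rewrite HQ// inE ?wB ?w'B orbT.
rewrite -[RHS]mulr1 -(ee z); ring.
Qed.

(** A determinant of excursion kernels from two points [a], [b] of [B] factors
    through the walks that avoid both. *)
Lemma excursion_det Q B a b z1 z2 : contracting Q B -> a \in B -> b \in B -> a != b ->
  excursion Q B a z1 * excursion Q B b z2 - excursion Q B b z1 * excursion Q B a z2 =
  green Q B a a * green Q (B `\ a)%fset b b *
  (excursion Q (B `\ a `\ b)%fset a z1 * excursion Q (B `\ a `\ b)%fset b z2
   - excursion Q (B `\ a `\ b)%fset b z1 * excursion Q (B `\ a `\ b)%fset a z2).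
Proof.
move=> cQ aB bB ab; have cQ' := contracting_sub (fsubD1set B a) cQ.
have bB' : b \in (B `\ a)%fset by rewrite !inE eq_sym ab.
rewrite !(excursionD1 b _ cQ aB) !(excursion_green_diag _ cQ aB).
rewrite !(excursionD1 a _ cQ' bB') !(excursion_green_diag _ cQ' bB').
ring.
Qed.

End Green.

(** * The logarithm of a Green's function is a loop sum *)

Section LoopSum.
Variables (R : realType) (T : choiceType).
Implicit Types (Q : T -> T -> R) (B : {fset T}) (c : nat -> R).

Definition geo_bounded c (rho : R) :=
  exists2 C, 0 <= C & forall k, `|c k| <= C * rho ^+ k.

(** By Bernoulli's inequality the factor [k + 1] costs an arbitrarily small
    increase of the rate. *)
Lemma geo_bounded_diffs c rho mu : 0 < rho -> rho < mu -> geo_bounded c rho ->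
  geo_bounded (pseries_diffs c) mu.
Proof.
move=> r0 rm [C C0 H]; have m0 := lt_trans r0 rm.
pose del := mu / rho - 1.
have del0 : 0 < del by rewrite subr_gt0 ltr_pdivlMr// mul1r.
have bern k : 1 + k%:R * del <= (mu / rho) ^+ k.
  elim: k => [|k IH]; first by rewrite mul0r addr0 expr0.
  rewrite exprS; have -> : mu / rho = 1 + del by rewrite /del addrC subrK.
  have {}IH : 1 + k%:R * del <= (1 + del) ^+ k by rewrite [1 + del]addrC subrK.
  apply: le_trans (_ : (1 + del) * (1 + k%:R * del) <= _); last first.
    by rewrite ler_pM2l// addr_gt0.
  rewrite -natr1; have : 0 <= k%:R * (del * del) by rewrite mulr_ge0 ?ler0n// mulr_ge0// ltW.
  nra.
exists (C * rho * (1 + del^-1)).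
  by rewrite !mulr_ge0 ?addr_ge0 ?invr_ge0 ?(ltW r0) ?(ltW del0).
move=> k; rewrite /pseries_diffs normrM ger0_norm//.
apply: le_trans (_ : k.+1%:R * (C * rho ^+ k.+1) <= _); first by rewrite ler_wpM2l.
have -> : C * rho * (1 + del^-1) * mu ^+ k = (C * rho ^+ k.+1) * ((1 + del^-1) * (mu / rho) ^+ k).
  rewrite expr_div_n exprS; have rk : rho ^+ k != 0 by rewrite expf_neq0 ?gt_eqF.
  by field; rewrite rk gt_eqF.
rewrite mulrC ler_wpM2l ?mulr_ge0 ?exprn_ge0 ?(ltW r0)//.
apply: le_trans (_ : (1 + del^-1) * (1 + k%:R * del) <= _); last first.
  by rewrite ler_pM2l ?bern// addr_gt0// invr_gt0.
rewrite mulrDr mulr1 mulrDl mul1r mulrCA mulVf ?gt_eqF// mulr1 -natr1.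
have : 0 < del^-1 by rewrite invr_gt0.
have : 0 <= k%:R * del by rewrite mulr_ge0// ltW.
lra.
Qed.

Lemma pseries1 c : pseries c 1 = series c.
Proof.
by apply/funext => n; rewrite /pseries /series/=; apply: eq_bigr => k _; rewrite expr1n mulr1.
Qed.

Lemma geo_bounded_cvg c rho x : 0 < rho -> rho * `|x| < 1 -> geo_bounded c rho ->
  cvgn (pseries c x).
Proof.
move=> r0 rx [C C0 H]; apply: normed_cvg.
apply: (@series_le_cvg _ _ (geometric C (rho * `|x|))) => //= [n|n|].
- by rewrite mulr_ge0// exprn_ge0// mulr_ge0// ltW.
- by rewrite normrM normrX exprMn mulrA ler_wpM2r// exprn_ge0.
- by apply: is_cvg_geometric_series; rewrite ger0_norm// mulr_ge0// ltW.
Qed.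

Lemma geo_bounded_derive c rho x : 0 < rho -> rho < 1 -> `|x| <= 1 -> geo_bounded c rho ->
  is_derive x (1 : R) (fun x => limn (pseries c x)) (limn (pseries (pseries_diffs c) x)).
Proof.
move=> r0 r1 x1 H.
(* Two intermediate rates for the first two derivatives, and a radius [K > 1]
   at which all three series still converge. *)
pose m1 := (2 * rho + 1) / 3; pose m2 := (rho + 2) / 3; pose K : R := 2 / (1 + m2).
have h1 : geo_bounded (pseries_diffs c) m1.
  by apply: (geo_bounded_diffs r0) H; rewrite /m1; lra.
have h2 : geo_bounded (pseries_diffs (pseries_diffs c)) m2.
  by apply: (geo_bounded_diffs _ _ h1); rewrite /m1 /m2; lra.
have K1 : 1 < K by rewrite /K ltr_pdivlMr ?mul1r /m2; lra.
have mK mu : mu <= m2 -> mu * `|K| < 1.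
  move=> mm; rewrite ger0_norm; last by rewrite ltW// (lt_trans _ K1).
  apply: le_lt_trans (_ : m2 * K < 1); first by rewrite ler_wpM2r// ltW// (lt_trans _ K1).
  by rewrite /K mulrA ltr_pdivrMr /m2; lra.
apply: (@pseries_snd_diffs _ _ K).
- by apply: (geo_bounded_cvg r0) H; apply: mK; rewrite /m2; lra.
- by apply: (geo_bounded_cvg _ _ h1); [|apply: mK]; rewrite /m1 /m2; lra.
- by apply: (geo_bounded_cvg _ _ h2); [|apply: mK]; rewrite /m2; lra.
- by apply: (le_lt_trans x1); rewrite ger0_norm// ltW// (lt_trans _ K1).
Qed.

Lemma geo_bounded_sum (I : choiceType) (s : seq I) (f : I -> nat -> R) rho : 0 < rho ->
  (forall i, i \in s -> geo_bounded (f i) rho) ->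
  geo_bounded (fun k => \sum_(i <- s) f i k) rho.
Proof.
move=> r0; elim: s => [|i s IH] H.
  by exists 0 => // k; rewrite big_nil normr0 mul0r.
have [C C0 hC] := H i (mem_head _ _).
have [|D D0 hD] := IH; first by move=> j js; apply: H; rewrite inE js orbT.
exists (C + D); first exact: addr_ge0.
by move=> k; rewrite big_cons mulrDl; apply: le_trans (ler_normD _ _) (lerD (hC k) (hD k)).
Qed.

Definition trace_weight Q B (k : nat) : R := \sum_(x <- B) walk_weight Q B k x x.

(** The loop measure of the rooted loops in [B]: a loop of [k] steps is counted
    with its weight divided by [k].  The term [k = 0] vanishes as [0^-1 = 0]. *)
Definition loop_sum Q B : R := limn (series (fun k => trace_weight Q B k / k%:R)).

Lemma trace_weight_bound Q B : contracting Q B -> exists2 rho : R,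
  0 < rho < 1 & geo_bounded (trace_weight Q B) rho.
Proof.
move=> /walk_weight_bound[C [lam [C0 l0 l1 H]]]; exists lam; first by rewrite l0.
apply: geo_bounded_sum => // x xB; exists C => // k; exact: H.
Qed.

Lemma geo_bounded_le c c' rho rho' : 0 <= rho -> rho <= rho' ->
  (forall k, `|c' k| <= `|c k|) -> geo_bounded c rho -> geo_bounded c' rho'.
Proof.
move=> r0 rr cc [C C0 H]; exists C => // k; apply: le_trans (cc k) _.
apply: le_trans (H k) _; rewrite ler_wpM2l// lerXn2r// nnegrE//.
exact: le_trans rr.
Qed.

Lemma ler_div_nat (a : R) k : `|a / k%:R| <= `|a|.
Proof.
case: k => [|k]; first by rewrite invr0 mulr0 normr0.
rewrite normrM ler_piMr// ger0_norm ?invr_ge0// invf_le1// ler1n//.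
Qed.

Lemma loop_sum_cvg Q B : contracting Q B ->
  series (fun k => trace_weight Q B k / k%:R) n @[n --> \oo] --> loop_sum Q B.
Proof.
move=> /trace_weight_bound[rho /andP[r0 r1] H].
rewrite -pseries1 /loop_sum -pseries1.
apply: (@geo_bounded_cvg _ rho) => //; first by rewrite normr1 mulr1.
apply: (geo_bounded_le (ltW r0) (lexx _)) H => k; exact: ler_div_nat.
Qed.

Definition scaled (t : R) Q x y := t * Q x y.

Lemma walk_weight_scaled t Q B k x y :
  walk_weight (scaled t Q) B k x y = walk_weight Q B k x y * t ^+ k.
Proof.
elim: k x => [|k IH] x /=; first by rewrite expr0 mulr1.
rewrite mulr_suml; apply: eq_bigr => z _; rewrite IH /scaled exprS; ring.
Qed.

Lemma green_scaled t Q B x y :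
  green (scaled t Q) B x y = limn (pseries (fun k => walk_weight Q B k x y) t).
Proof.
congr (limn _); apply/funext => n; apply: eq_bigr => k _.
exact: walk_weight_scaled.
Qed.

Lemma contracting_scaled t Q B : `|t| <= 1 -> contracting Q B -> contracting (scaled t Q) B.
Proof.
move=> t1; apply: contracting_le => // x y; by rewrite normrM ler_piMl.
Qed.

(** [sum_k (k + 1) Q^k] is the square of the Green's function: it solves
    [D = G + Q D]. *)
Lemma green_square Q B x y : contracting Q B -> x \in B -> y \in B ->
  series (fun k => k.+1%:R * walk_weight Q B k x y) n @[n --> \oo] -->
  \sum_(z <- B) green Q B x z * green Q B z y.
Proof.
move=> cQ xB yB.
pose D x := limn (series (fun k => k.+1%:R * walk_weight Q B k x y)).
have Dcvg z : z \in B ->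
    series (fun k => k.+1%:R * walk_weight Q B k z y) n @[n --> \oo] --> D z.
  move=> zB; have [C [lam [C0 l0 l1 H]]] := walk_weight_bound cQ.
  pose c k := if k is k'.+1 then walk_weight Q B k' z y else 0.
  have hc : geo_bounded c lam.
    exists (C / lam); first by rewrite divr_ge0// ltW.
    case=> [|k] /=; first by rewrite normr0 mulr_ge0 ?expr0 ?divr_ge0// ltW.
    by rewrite exprS mulrA divfK ?gt_eqF//; exact: H.
  have h2 : geo_bounded (pseries_diffs c) ((1 + lam) / 2).
    by apply: (geo_bounded_diffs l0) hc; lra.
  rewrite /D -(pseries1 (pseries_diffs c)).
  by apply: (geo_bounded_cvg _ _ h2); rewrite ?normr1; lra.
suff -> : \sum_(z <- B) green Q B x z * green Q B z y = D x by exact: Dcvg.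
apply/esym; apply: (green_solve (u := D) (f := fun z => green Q B z y)) => // z zB.
rewrite {1}/D; apply: cvg_lim => //; rewrite -cvg_shiftS.
have -> : [sequence series (fun k => k.+1%:R * walk_weight Q B k z y) n.+1]_n =
  (fun n => [sequence series (fun k => walk_weight Q B k z y) n.+1]_n n +
   \sum_(w <- B) Q z w * series (fun k => k.+1%:R * walk_weight Q B k w y) n).
  apply/funext => n; rewrite /series/= !big_nat_recl//= mul1r -addrA; congr (_ + _).
  under [X in _ = _ + X]eq_bigr do rewrite mulr_sumr.
  rewrite [X in _ = _ + X]exchange_big/= -big_split/=; apply: eq_bigr => k _.
  rewrite -[k.+2%:R]natr1 mulrDl mul1r addrC mulr_sumr; congr (_ + _).
  by apply: eq_bigr => w _; rewrite mulrCA.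
apply: cvgD; first by rewrite cvg_shiftS; exact: green_cvg.
apply: cvg_sum_seq => w wB; apply: cvgM; first exact: cvg_cst.
exact: Dcvg.
Qed.

Lemma cvg_pseries_diffs_mul c t : cvgn (pseries (pseries_diffs c) t) ->
  series (fun k => k%:R * (c k * t ^+ k)) n @[n --> \oo] -->
  t * limn (pseries (pseries_diffs c) t).
Proof.
move=> ct; rewrite -cvg_shiftS.
have -> : [sequence series (fun k => k%:R * (c k * t ^+ k)) n.+1]_n =
   (fun n => t * pseries (pseries_diffs c) t n).
  apply/funext => n; rewrite /series/= big_nat_recl//= mul0r add0r mulr_sumr.
  apply: eq_bigr => k _; rewrite /pseries_diffs/= exprS; ring.
by apply: cvgM; [exact: cvg_cst|exact: ct].
Qed.

Lemma walk_weight_geo Q B : contracting Q B -> exists2 rho : R, 0 < rho < 1 &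
  forall x y, x \in B -> y \in B -> geo_bounded (fun k => walk_weight Q B k x y) rho.
Proof.
move=> /walk_weight_bound[C [lam [C0 l0 l1 H]]]; exists lam; first by rewrite l0.
by move=> x y xB yB; exists C => // k; exact: H.
Qed.

(** Multiply the weights by a parameter [t].  Both sides then solve [g' = g L'],
    where [L] is the difference of the two loop sums: by [greenD1] the diagonal
    entries of the two Green's functions differ by [G(x, v) G(v, x) / G(v, v)],
    and these numerators sum to the entry at [v] of the square of the Green's
    function, that is to [(t g)']. *)
Theorem expR_loop_sum Q B v : contracting Q B -> v \in B ->
  expR (loop_sum Q B - loop_sum Q (B `\ v)%fset) = green Q B v v.
Proof.
move=> cQ vB; have cQ' := contracting_sub (fsubD1set B v) cQ.
set B' := (B `\ v)%fset in cQ' *.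
have [rho /andP[r0 r1] hw] := walk_weight_geo cQ.
have [rho1 /andP[s0 s1] ht] := trace_weight_bound cQ.
have [rho2 /andP[t0 t1] ht'] := trace_weight_bound cQ'.
pose w k := walk_weight Q B k v v.
pose d k := trace_weight Q B k - trace_weight Q B' k.
pose e k := d k / k%:R.
pose sg : R := Num.max rho1 rho2.
have sg0 : 0 < sg by rewrite /sg lt_max s0.
have sg1 : sg < 1 by rewrite /sg gt_max s1 t1.
have he : geo_bounded e sg.
  apply: (@geo_bounded_le d _ sg); rewrite ?(ltW sg0)//; first by move=> k; exact: ler_div_nat.
  have l1 : rho1 <= sg by rewrite /sg le_max lexx.
  have l2 : rho2 <= sg by rewrite /sg le_max lexx orbT.
  have [C C0 hC] := geo_bounded_le (ltW s0) l1 (fun k => lexx _) ht.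
  have [D D0 hD] := geo_bounded_le (ltW t0) l2 (fun k => lexx _) ht'.
  exists (C + D); first exact: addr_ge0.
  by move=> k; rewrite mulrDl; apply: le_trans (ler_normB _ _) (lerD (hC k) (hD k)).
pose g (t : R) : R := limn (pseries w t); pose L (t : R) : R := limn (pseries e t).
pose g' (t : R) : R := limn (pseries (pseries_diffs w) t).
pose L' (t : R) : R := limn (pseries (pseries_diffs e) t).
have dg t : `|t| <= 1 -> is_derive t (1 : R) g (g' t).
  by move=> t1'; apply: (geo_bounded_derive r0 r1 t1'); exact: hw.
have dL t : `|t| <= 1 -> is_derive t (1 : R) L (L' t).
  by move=> t1'; apply: (geo_bounded_derive sg0 sg1 t1' he).
have cdiffs c rh t : 0 < rh -> rh < 1 -> `|t| <= 1 -> geo_bounded c rh ->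
    cvgn (pseries (pseries_diffs c) t).
  move=> rh0 rh1 t1' hc.
  have h2 : geo_bounded (pseries_diffs c) ((1 + rh) / 2).
    by apply: (geo_bounded_diffs rh0) hc; lra.
  apply: (geo_bounded_cvg _ _ h2); first lra.
  by apply: (@le_lt_trans _ _ ((1 + rh) / 2)); [rewrite ler_piMr//; lra|lra].
have ode t : 0 < t <= 1 -> g' t = g t * L' t.
  move=> /andP[tp tle]; have tt : `|t| <= 1 by rewrite ger0_norm// ltW.
  have cS := contracting_scaled tt cQ; have cS' := contracting_scaled tt cQ'.
  set S := scaled t Q in cS cS'.
  have gE : g t = green S B v v by rewrite green_scaled.
  have tg : t * g' t = \sum_(z <- B) green S B v z * green S B z v - g t.
    have c1 := cvg_pseries_diffs_mul (cdiffs w rho t r0 r1 tt (hw v v vB vB)).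
    rewrite -(cvg_lim (@Rhausdorff R) c1); apply: cvg_lim => //.
    have -> : series (fun k => k%:R * (w k * t ^+ k)) =
      (fun n => series (fun k => k.+1%:R * walk_weight S B k v v) n -
                series (fun k => walk_weight S B k v v) n).
      apply/funext => n; rewrite /series/= -sumrB; apply: eq_bigr => k _.
      by rewrite walk_weight_scaled -natr1 /w; ring.
    by apply: cvgB; [exact: green_square|rewrite gE; exact: green_cvg].
  have tL : t * L' t = \sum_(x <- B) green S B x x - \sum_(x <- B') green S B' x x - 1.
    have c1 := cvg_pseries_diffs_mul (cdiffs e sg t sg0 sg1 tt he).
    rewrite -(cvg_lim (@Rhausdorff R) c1); apply: cvg_lim => //; rewrite -cvg_shiftS.
    have -> : [sequence series (fun k => k%:R * (e k * t ^+ k)) n.+1]_n =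
      (fun n => \sum_(x <- B) [sequence series (fun k => walk_weight S B k x x) n.+1]_n n
        - \sum_(x <- B') [sequence series (fun k => walk_weight S B' k x x) n.+1]_n n - 1).
      apply/funext => n; rewrite /series/=.
      rewrite [X in _ = X - _ - _]exchange_big [X in _ = _ - X - _]exchange_big/=.
      rewrite -sumrB !big_nat_recl//= mul0r add0r.
      rewrite (big_fsetD1 v vB)/= eqxx -/B' addrK [in RHS]addrC [in RHS]addrA.
      rewrite [X in _ = X + _](_ : _ = 0) ?add0r; last by rewrite addrC subrr.
      apply: eq_bigr => k _; rewrite /e mulrAC mulrA [k.+1%:R * _]mulrC.
      rewrite mulfK ?pnatr_eq0// /d /trace_weight mulrBl !mulr_suml.
      by congr (_ - _); apply: eq_bigr => x _; rewrite -walk_weight_scaled.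
    apply: cvgB; last exact: cvg_cst.
    by apply: cvgB; apply: cvg_sum_seq => x xB; rewrite cvg_shiftS; exact: green_cvg.
  have tn0 : t != 0 by rewrite gt_eqF.
  apply: (mulfI tn0); rewrite mulrCA tg tL gE !(big_fsetD1 v vB)/= -/B'.
  have hx x : x \in B' -> green S B v x * green S B x v =
     green S B v v * green S B x x - green S B v v * green S B' x x.
    by move=> xB'; rewrite greenD1//; ring.
  rewrite (eq_big_seq _ hx) sumrB -!mulr_sumr; ring.
(* [g exp(-L)] has derivative zero on the open interval; it is 1 at 0. *)
pose phi (t : R) : R := g t * expR (- L t).
pose phi' (t : R) : R := g t * (expR (- L t) * - L' t) + expR (- L t) * g' t.
have dphi t : `|t| <= 1 -> is_derive t (1 : R) phi (phi' t).
  move=> tt; have Dg := dg t tt; have DL := dL t tt.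
  have DN : is_derive t (1 : R) (fun t => - L t) (- L' t) by exact: is_deriveN.
  have DE := is_derive1_comp (f := expR) (g := fun t => - L t) (is_derive_expR (- L t)) DN.
  exact: (is_deriveM Dg DE).
have [c c01 /eqP] : exists2 c : R, c \in `]0, 1[%R & phi 1 - phi 0 = phi' c * (1 - 0).
  apply: MVT.
  - exact: ltr01.
  - by move=> x; rewrite in_itv/= => /andP[x0 x1]; apply: dphi; rewrite ger0_norm ltW.
  - apply: derivable_within_continuous => x; rewrite in_itv/= => /andP[x0 x1].
    by have [] := dphi x; rewrite ?ger0_norm.
move: c01; rewrite in_itv/= => /andP[c0 c1].
rewrite /phi' ode; last by rewrite c0 ltW.
rewrite (_ : _ * _ + _ = 0) ?mul0r ?subr_eq0; last by ring.
have p0 (c0' : nat -> R) : limn (pseries c0' 0) = c0' 0%N.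
  apply: lim_near_cst => //; near=> n.
  have n1 : (0 < n)%N by near: n; exact: nbhs_infty_gt.
  rewrite /pseries/series/=; rewrite -(prednK n1) big_nat_recl//= expr0 mulr1 big1 ?addr0//.
  by move=> i _; rewrite expr0n mulr0.
have g1 : g 1 = green Q B v v by rewrite /g pseries1.
have L1 : L 1 = loop_sum Q B - loop_sum Q B'.
  rewrite /L pseries1; apply: cvg_lim => //.
  have -> : series e = (fun n => series (fun k => trace_weight Q B k / k%:R) n -
                                 series (fun k => trace_weight Q B' k / k%:R) n).
    by apply/funext => n; rewrite /series/= -sumrB; apply: eq_bigr => k _; rewrite -mulrBl.
  by apply: cvgB; exact: loop_sum_cvg.
rewrite /phi g1 L1 /g /L !p0 /e /w/= eqxx invr0 mulr0 oppr0 expR0 mulr1 => /eqP H.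
rewrite -[true%:R]/(1 : R) in H.
by rewrite -[LHS]mul1r -H -mulrA -expRD addNr expR0 mulr1.
Unshelve. all: by end_near.
Qed.

End LoopSum.

(** * Sums over self-avoiding paths *)

Section SelfAvoiding.
Variables (R : realType) (T : choiceType).
Implicit Types (Q e : T -> T -> R) (B : {fset T}) (x y z a b : T) (s t : seq T).

Fixpoint path_weight Q x s : R :=
  if s is y :: s' then Q x y * path_weight Q y s' else 1.

Fixpoint path_sum e x s : R :=
  if s is y :: s' then e x y + path_sum e y s' else 0.

Definition fset_remove B s : {fset T} := foldl (fun B x => B `\ x)%fset B s.

Lemma in_fset_remove B s x : (x \in fset_remove B s) = (x \in B) && (x \notin s).
Proof.
elim: s B => [|y s IH] B /=; first by rewrite andbT.
by rewrite IH !inE negb_or; case: (x == y); case: (x \in B).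
Qed.

Lemma fset_remove_sub B s : (fset_remove B s `<=` B)%fset.
Proof. by apply/fsubsetP => x; rewrite in_fset_remove => /andP[]. Qed.

(** The factor to apply to the weight of a self-avoiding path with vertices [s] to
    get the total weight of the walks with that loop erasure: a loop in [B] at the
    first vertex, then a loop at the second one avoiding the first, and so on. *)
Fixpoint erasure_weight Q B s : R :=
  if s is x :: s' then green Q B x x * erasure_weight Q (B `\ x)%fset s' else 1.

(** The factor at [x] is the exponential of the loop sum lost by removing [x]
    ([expR_loop_sum]), and these losses telescope. *)
Lemma erasure_weightE Q B s : contracting Q B -> uniq s -> {subset s <= B} ->
  erasure_weight Q B s = expR (loop_sum Q B - loop_sum Q (fset_remove B s)).
Proof.
elim: s B => [|x s IH] B cQ /=; first by rewrite subrr expR0.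
move=> /andP[xs us] sB; have xB : x \in B by apply: sB; rewrite inE eqxx.
rewrite IH//; first last.
- move=> y ys; rewrite !inE sB ?inE ?ys ?orbT// andbT.
  by apply: contraNneq xs => <-.
- exact: contracting_sub (fsubD1set B x) cQ.
by rewrite -(expR_loop_sum cQ xB) -expRD; congr expR; ring.
Qed.

(** The lists [t] such that [x :: t] is a self-avoiding sequence in [B], when
    the fuel [m] is at least the cardinal of [B]. *)
Fixpoint saw_tails (m : nat) B x : seq (seq T) :=
  if m is m'.+1 then
    [::] :: flatten [seq [seq y :: t | t <- saw_tails m' (B `\ x)%fset y]
                    | y <- enum_fset (B `\ x)%fset]
  else [::].

Lemma mem_saw_tails m B x t : x \in B -> (#|` B| <= m)%N ->
  (t \in saw_tails m B x) = uniq (x :: t) && all (mem B) t.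
Proof.
elim: m B x t => [|m IH] B x t xB.
  by rewrite leqn0 cardfs_eq0 => /eqP B0; rewrite B0 inE in xB.
move=> Bm; have B'm : (#|` (B `\ x)%fset| <= m)%N.
  by have := cardfsD1 x B; rewrite xB => E; rewrite E add1n ltnS in Bm.
rewrite [saw_tails _ _ _]/= in_cons; case: t => [|y t]; first by rewrite eqxx.
rewrite [_ == _]/= orFb.
apply/flattenP/idP.
  move=> [l /mapP[z zB' ->] /mapP[t' + [-> ->]]]; rewrite IH// => /andP[/= /andP[zt ut] tB].
  move: (zB'); rewrite !inE => /andP[zx zB]; rewrite zB ut zt /= !andbT.
  apply/andP; split; last by apply/allP => w /(allP tB); rewrite /= !inE => /andP[].
  rewrite negb_or eq_sym zx /=; apply/negP => xt.
  by have := allP tB _ xt; rewrite /= !inE eqxx.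
move=> /andP[/= /andP[xyt /andP[yt ut]] /andP[yB tB]].
move: xyt; rewrite inE negb_or => /andP[xy xt].
have yB' : y \in (B `\ x)%fset by rewrite !inE eq_sym xy.
exists [seq y :: t | t <- saw_tails m (B `\ x)%fset y]; first exact: map_f.
apply: map_f; rewrite IH//= yt ut /=; apply/allP => z zt /=.
rewrite !inE; have /= -> := allP tB _ zt; rewrite andbT.
by apply: contraNneq xt => <-.
Qed.

Lemma uniq_saw_tails m B x : uniq (saw_tails m B x).
Proof.
elim: m B x => [//|m IH] B x /=.
apply/andP; split; first by apply/flattenP => -[l /mapP[y _ ->] /mapP[]].
elim: (enum_fset _) (fset_uniq (B `\ x)%fset) => [//|y r IHr] /= /andP[yr ur].
rewrite cat_uniq IHr// andbT map_inj_uniq ?IH//=; last by move=> ? ? [].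
apply/hasPn => l /flattenP[l' /mapP[z zr ->] /mapP[t _ ->]] /=.
by apply/negP => /mapP[t' _ [zy _]]; rewrite -zy zr in yr.
Qed.

Lemma sum_saw_tails m B x (F : seq T -> R) :
  \sum_(t <- saw_tails m.+1 B x) F t = F [::] +
  \sum_(y <- (B `\ x)%fset) \sum_(t <- saw_tails m (B `\ x)%fset y) F (y :: t).
Proof.
rewrite [saw_tails _ _ _]/= big_cons big_flatten big_map/=; congr (_ + _).
by apply: eq_bigr => y _; rewrite big_map.
Qed.

(** Every walk has exactly one loop erasure. *)
Lemma sum_saw_weight Q m B x b : contracting Q B -> x \in B -> (#|` B| <= m)%N ->
  \sum_(t <- saw_tails m B x) path_weight Q x (rcons t b) * erasure_weight Q B (x :: t)
  = excursion Q B x b.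
Proof.
elim: m B x => [|m IH] B x cQ xB.
  by rewrite leqn0 cardfs_eq0 => /eqP B0; rewrite B0 inE in xB.
move=> Bm; have B'm : (#|` (B `\ x)%fset| <= m)%N.
  by have := cardfsD1 x B; rewrite xB => E; rewrite E add1n ltnS in Bm.
have cQ' := contracting_sub (fsubD1set B x) cQ.
rewrite sum_saw_tails excursion_green_diag// (excursion_step x b cQ') mulrDr.
congr (_ + _); first by rewrite /= !mulr1 mulrC.
rewrite mulr_sumr; apply: eq_big_seq => y yB'; rewrite -IH// !mulr_sumr.
by apply: eq_bigr => t _ /=; ring.
Qed.

Lemma sum_antisym (I : choiceType) (r : seq I) (F : I -> I -> R) :
  (forall i j, F i j = - F j i) -> \sum_(i <- r) \sum_(j <- r) F i j = 0.
Proof.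
move=> FN; have : \sum_(i <- r) \sum_(j <- r) F i j = - \sum_(i <- r) \sum_(j <- r) F i j.
  rewrite {1}exchange_big/= -sumrN; apply: eq_bigr => i _.
  by rewrite -sumrN; apply: eq_bigr => j _.
lra.
Qed.

(** Fomin's identity.  For an antisymmetric [e], summing [e] over the steps of the
    loop erasure or over all the steps of the walk gives the same total: as [Q] is
    symmetric, the two orientations of an erased loop cancel.  In the induction,
    peeling off the first vertex [x] of the erasure produces the error term
    [sum k(a) Q(a, c) e(a, c) k(c)], where [k] is the excursion kernel to [x]; it
    vanishes by antisymmetry. *)
Lemma sum_saw_path_sum Q e m B x b : contracting Q B ->
  (forall y z, Q y z = Q z y) -> (forall y z, e y z = - e z y) ->
  (forall y, e y b = 0) -> x \in B -> (#|` B| <= m)%N ->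
  \sum_(t <- saw_tails m B x)
     path_sum e x (rcons t b) * (path_weight Q x (rcons t b) * erasure_weight Q B (x :: t))
  = \sum_(a <- B) \sum_(c <- B) green Q B x a * (Q a c * e a c) * excursion Q B c b.
Proof.
move=> + sQ aE eb; elim: m B x => [|m IH] B x cQ xB.
  by rewrite leqn0 cardfs_eq0 => /eqP B0; rewrite B0 inE in xB.
move=> Bm; have B'm : (#|` (B `\ x)%fset| <= m)%N.
  by have := cardfsD1 x B; rewrite xB => E; rewrite E add1n ltnS in Bm.
have cQ' := contracting_sub (fsubD1set B x) cQ.
pose B' := (B `\ x)%fset; rewrite -/B' in B'm cQ'.
pose E a c := Q a c * e a c; have EN a c : E a c = - E c a by rewrite /E sQ aE mulrN.
pose g := green Q B x x; pose k a := excursion Q B' a x; pose K a := excursion Q B a b.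
have exx : e x x = 0 by have := aE x x; lra.
have gk a : a \in B' -> green Q B x a = k a * g.
  by move=> aB'; rewrite green_sym//; [exact: green_col|move: aB'; rewrite !inE => /andP[]].
have K' c : excursion Q B' c b = K c - k c * K x.
  by rewrite /K (excursionD1 c b cQ xB) -/B' -/(k c); ring.
rewrite sum_saw_tails /= eb addr0 mul0r add0r -/B'.
rewrite (eq_big_seq (fun y => g * (E x y * excursion Q B' y b) +
   g * (Q x y * \sum_(a <- B') \sum_(c <- B') green Q B' y a * E a c * excursion Q B' c b))); last first.
  move=> y yB'; rewrite -IH// -(@sum_saw_weight Q m)//.
  rewrite !mulr_sumr -big_split/=; apply: eq_bigr => t _; rewrite /E -/g; ring.
rewrite big_split/= -!mulr_sumr.
have -> : g * \sum_(y <- B') Q x y *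
   (\sum_(a <- B') \sum_(c <- B') green Q B' y a * E a c * excursion Q B' c b) =
   \sum_(a <- B') \sum_(c <- B') green Q B x a * E a c * K c
   - K x * g * \sum_(a <- B') \sum_(c <- B') k a * E a c * k c.
  rewrite (eq_bigr (fun y => \sum_(a <- B') \sum_(c <- B') Q x y *
     (green Q B' y a * E a c * excursion Q B' c b))); last first.
    by move=> y _; rewrite mulr_sumr; apply: eq_bigr => a _; rewrite mulr_sumr.
  rewrite exchange_big/= !mulr_sumr -sumrB; apply: eq_big_seq => a aB'.
  rewrite exchange_big/= !mulr_sumr -sumrB; apply: eq_bigr => c _.
  transitivity (green Q B x a * E a c * excursion Q B' c b).
    rewrite (green_row cQ xB aB') -/B' -/g mulr_sumr !mulr_suml mulr_sumr.
    by apply: eq_bigr => y _; ring.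
  by rewrite K' gk//; ring.
rewrite [\sum_(a <- B') \sum_(c <- B') k a * E a c * k c]sum_antisym ?mulr0 ?subr0; last first.
  by move=> a c; rewrite (EN a c); ring.
rewrite [RHS](big_fsetD1 x xB)/= [X in _ = X + _](big_fsetD1 x xB)/= exx !mulr0 mul0r add0r -/B'.
rewrite [X in _ = _ + X](eq_big_seq (fun a => green Q B x a * (Q a x * e a x) * K x +
   \sum_(c <- B') green Q B x a * (Q a c * e a c) * K c)); last first.
  by move=> a aB'; rewrite (big_fsetD1 x xB).
rewrite big_split/= !addrA; congr (_ + _).
rewrite mulr_sumr -big_split/=; apply: eq_big_seq => y yB'.
rewrite -/(E y x) -/(E x y) -/g -/(K y) K' gk// (EN y x); ring.
Qed.

(** [path_sum (edge_sign a b)] tells in which direction a path uses the edge. *)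
Definition edge_sign a b : T -> T -> R := fun y z =>
  ((y == a) && (z == b))%:R - ((y == b) && (z == a))%:R.

Lemma edge_signN a b y z : edge_sign a b y z = - edge_sign a b z y.
Proof. by rewrite /edge_sign opprB [_ && (z == a)]andbC [_ && (z == b)]andbC. Qed.

Lemma sum_pair B a b (F : T -> T -> R) : a \in B -> b \in B ->
  \sum_(y <- B) \sum_(z <- B) F y z * ((y == a) && (z == b))%:R = F a b.
Proof.
move=> aB bB; rewrite (big_fsetD1 a aB)/= [X in _ + X]big1_seq ?addr0; last first.
  move=> y /=; rewrite !inE => /andP[/negPf ya _].
  by apply: big1 => z _; rewrite ya mulr0.
rewrite (big_fsetD1 b bB)/= [X in _ + X]big1_seq ?addr0 ?eqxx ?mulr1//.
by move=> z /=; rewrite !inE => /andP[/negPf-> _]; rewrite mulr0.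
Qed.

(** The case of [sum_saw_path_sum] where [e] lives on a single edge. *)
Lemma fomin_edge Q B a b z1 z2 : contracting Q B -> (forall y z, Q y z = Q z y) ->
  a \in B -> b \in B -> a != b -> z2 \notin B ->
  \sum_(x <- B) \sum_(t <- saw_tails #|` B| B x)
     path_sum (edge_sign a b) x (rcons t z2) *
     (Q z1 x * path_weight Q x (rcons t z2) * erasure_weight Q B (x :: t))
  = Q a b * (excursion Q B a z1 * excursion Q B b z2 - excursion Q B b z1 * excursion Q B a z2).
Proof.
move=> cQ sQ aB bB ab z2B.
have ez2 y : edge_sign a b y z2 = 0.
  rewrite /edge_sign; case: (z2 =P b) => [E|_]; first by rewrite E bB in z2B.
  by case: (z2 =P a) => [E|_]; [rewrite E aB in z2B|rewrite !andbF subrr].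
pose e := edge_sign a b.
have D x : x \in B -> \sum_(t <- saw_tails #|` B| B x)
     path_sum e x (rcons t z2) *
     (Q z1 x * path_weight Q x (rcons t z2) * erasure_weight Q B (x :: t))
   = Q a b * (green Q B a x * Q x z1 * excursion Q B b z2
            - green Q B b x * Q x z1 * excursion Q B a z2).
  move=> xB.
  rewrite (eq_bigr (fun t => Q z1 x * (path_sum e x (rcons t z2) *
    (path_weight Q x (rcons t z2) * erasure_weight Q B (x :: t))))); last by move=> *; ring.
  rewrite -mulr_sumr (sum_saw_path_sum cQ sQ (edge_signN a b) ez2)//.
  rewrite (eq_bigr (fun y => \sum_(c <- B)
      (green Q B x y * Q y c * excursion Q B c z2) * ((y == a) && (c == b))%:R -
    \sum_(c <- B) (green Q B x y * Q y c * excursion Q B c z2) * ((y == b) && (c == a))%:R)); last first.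
    by move=> y _; rewrite -sumrB; apply: eq_bigr => c _; rewrite /edge_sign; ring.
  rewrite sumrB !sum_pair//.
  by rewrite (green_sym sQ xB aB) (green_sym sQ xB bB) (sQ z1 x) (sQ b a); ring.
rewrite (eq_big_seq _ D) -mulr_sumr sumrB -!mulr_suml.
by rewrite -!excursion_green//; congr (_ * _); ring.
Qed.

End SelfAvoiding.

(** * Unordered sums over walks *)

Section WalkSums.
Variables (R : realType) (T : choiceType).
Implicit Types (Q : T -> T -> R) (B : {fset T}) (x y z s b : T) (t l r : seq T).

Lemma esum_eq_support (I : choiceType) (C D : set I) (f : I -> \bar R) :
  C `<=` D -> (forall i, D i -> ~ C i -> f i = 0%E) ->
  (\esum_(i in C) f i = \esum_(i in D) f i)%E.
Proof.
move=> CD f0; rewrite esum_mkcond [RHS]esum_mkcond; apply: eq_esum => i _.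
case: (pselect (C i)) => [Ci|nCi]; first by rewrite !mem_set//; exact: CD.
rewrite memNset//; case: ifPn => // /set_mem Di; by rewrite f0.
Qed.

Lemma esum_seq (I : choiceType) (r : seq I) (f : I -> R) : uniq r ->
  (forall i, 0 <= f i) ->
  (\esum_(i in [set` r]) (f i)%:E = (\sum_(i <- r) f i)%:E)%E.
Proof.
move=> ur f0; rewrite esum_fset; first by rewrite -fsbig_seq// sumEFin.
- exact: finite_seq.
- by move=> i _; rewrite lee_fin.
Qed.

Lemma esumZl (I : choiceType) (D : set I) (c : R) (f : I -> \bar R) :
  0 <= c -> (forall i, D i -> 0 <= f i)%E ->
  (\esum_(i in D) (c%:E * f i) = c%:E * \esum_(i in D) f i)%E.
Proof.
move=> c0 f0; rewrite /esum -ereal_supZl//; last first.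
  by apply/set0P; exists (\sum_(x \in set0) f x)%E, set0 => //; exact: fsets_set0.
congr ereal_sup; rewrite image_comp; apply: eq_imagel => A [finA AD] /=.
rewrite !fsbig_finite// [in LHS]big_seq [in RHS]big_seq ge0_sume_distrr// => i.
by rewrite in_fset_set// inE => /AD/f0.
Qed.

Fixpoint words B (k : nat) : seq (seq T) :=
  if k is k'.+1 then flatten [seq [seq z :: t | t <- words B k'] | z <- enum_fset B]
  else [:: [::]].

Lemma mem_words B k t : (t \in words B k) = (size t == k) && all (mem B) t.
Proof.
elim: k t => [|k IH] t /=; first by rewrite inE; case: t.
apply/flattenP/idP.
  by move=> [l /mapP[z zB ->] /mapP[t' + ->]]; rewrite IH /= eqSS zB.
case: t => [//|z t] /=; rewrite eqSS => /andP[kt /andP[zB tB]].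
exists [seq z :: t | t <- words B k]; first exact: map_f.
by apply: map_f; rewrite IH kt.
Qed.

Lemma uniq_words B k : uniq (words B k).
Proof.
elim: k => [//|k IH] /=.
elim: (enum_fset _) (fset_uniq B) => [//|y r IHr] /= /andP[yr ur].
rewrite cat_uniq IHr// andbT map_inj_uniq ?IH//=; last by move=> ? ? [].
apply/hasPn => l /flattenP[l' /mapP[z zr ->] /mapP[t _ ->]] /=.
by apply/negP => /mapP[t' _ [zy _]]; rewrite -zy zr in yr.
Qed.

Lemma sum_words B k (F : seq T -> R) :
  \sum_(t <- words B k.+1) F t = \sum_(y <- B) \sum_(t <- words B k) F (y :: t).
Proof.
by rewrite /= big_flatten big_map/=; apply: eq_bigr => y _; rewrite big_map.
Qed.

Lemma nneseries_cvg (u : nat -> R) (c : R) : (forall k, 0 <= u k) ->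
  series u n @[n --> \oo] --> c -> (\sum_(0 <= k <oo) (u k)%:E = c%:E)%E.
Proof.
move=> u0 uc; apply/cvg_lim => //.
have -> : (fun n => \sum_(0 <= k < n) (u k)%:E)%E = EFin \o series u.
  by apply/funext => n /=; rewrite sumEFin.
by apply: cvg_EFin; [exact: nearW|exact: uc].
Qed.

Lemma esum_words B (f : seq T -> R) (c : R) : (forall t, 0 <= f t) ->
  series (fun k => \sum_(t <- words B k) f t) n @[n --> \oo] --> c ->
  (\esum_(t in [set t | all (mem B) t]) (f t)%:E = c%:E)%E.
Proof.
move=> f0 fc.
have -> : [set t | all (mem B) t] = \bigcup_k [set` words B k].
  apply/seteqP; split => t /= => [tB|[k _ /=]]; last by rewrite mem_words => /andP[].
  by exists (size t) => //=; rewrite mem_words eqxx.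
rewrite nneseries_sum_bigcup; first last.
- by move=> t; rewrite lee_fin.
- apply/trivIsetP => i j _ _ ij; apply/seteqP; split => t //= [].
  by rewrite !mem_words => /andP[/eqP-> _] /andP[ji _]; rewrite ji in ij.
rewrite -(nneseries_cvg _ fc); last by move=> k; exact: sumr_ge0.
by apply: eq_eseriesr => k _; rewrite esum_seq// uniq_words.
Qed.

Lemma path_weight_rcons Q x t b :
  path_weight Q x (rcons t b) = path_weight Q x t * Q (last x t) b.
Proof.
by elim: t x => [|y t IH] x /=; rewrite ?mulr1 ?mul1r// IH mulrA.
Qed.

Lemma path_weight_cat Q x t t' :
  path_weight Q x (t ++ t') = path_weight Q x t * path_weight Q (last x t) t'.
Proof. by elim: t x => [|y t IH] x /=; rewrite ?mul1r// IH mulrA. Qed.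

Lemma path_weight_ge0 Q x t : (forall x y, 0 <= Q x y) -> 0 <= path_weight Q x t.
Proof. by move=> Q0; elim: t x => [//|y t IH] x /=; rewrite mulr_ge0. Qed.

Lemma sum_words_walk Q B k x y :
  \sum_(t <- words B k) (last x t == y)%:R * path_weight Q x t = walk_weight Q B k x y.
Proof.
elim: k x => [|k IH] x; first by rewrite /= big_seq1 mulr1.
rewrite sum_words /=; apply: eq_bigr => z _; rewrite -IH mulr_sumr.
by apply: eq_bigr => t _ /=; rewrite mulrCA.
Qed.

Lemma esum_green Q B x y : (forall x y, 0 <= Q x y) -> contracting Q B ->
  x \in B -> y \in B ->
  (\esum_(t in [set t | all (mem B) t && (last x t == y)]) (path_weight Q x t)%:E
    = (green Q B x y)%:E)%E.
Proof.
move=> Q0 cQ xB yB.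
rewrite -(@esum_words B (fun t => (last x t == y)%:R * path_weight Q x t)); last 2 first.
- by move=> t; rewrite mulr_ge0// path_weight_ge0.
- by under eq_fun do under eq_fun do rewrite sum_words_walk; exact: green_cvg.
rewrite [RHS](_ : _ = \esum_(t in [set t | all (mem B) t])
  if t \in [set t | last x t == y] then (path_weight Q x t)%:E else 0%E).
  by rewrite -esum_mkcondr; congr esum; apply/seteqP; split => t /= /andP.
apply: eq_esum => t _; case: (boolP (last x t == y)) => lt.
  by rewrite mem_set// mul1r.
by rewrite memNset ?mul0r//=; apply/negP.
Qed.

Lemma sum_words_rcons Q B k y b : y \in B ->
  \sum_(t <- words B k) path_weight Q y (rcons t b) =
  \sum_(z <- B) walk_weight Q B k y z * Q z b.
Proof.
elim: k y => [|k IH] y yB.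
  rewrite big_seq1 /= mulr1 (big_fsetD1 y)//= eqxx mul1r big1_seq ?addr0//.
  by move=> z /=; rewrite !inE eq_sym => /andP[/negPf-> _]; rewrite mul0r.
rewrite sum_words/=.
rewrite (eq_big_seq (fun z => \sum_(w <- B) Q y z * walk_weight Q B k z w * Q w b)); last first.
  by move=> z zB; rewrite -mulr_sumr IH// mulr_sumr; apply: eq_bigr => w _; rewrite mulrA.
by rewrite exchange_big/=; apply: eq_bigr => w _; rewrite mulr_suml.
Qed.

Lemma esum_excursion Q B s b : (forall x y, 0 <= Q x y) -> contracting Q B ->
  (\esum_(t in [set t | all (mem B) t]) (path_weight Q s (rcons t b))%:E
    = (excursion Q B s b)%:E)%E.
Proof.
move=> Q0 cQ; apply: esum_words => [t|]; first exact: path_weight_ge0.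
rewrite -cvg_shiftS.
have -> : [sequence series (fun k => \sum_(t <- words B k) path_weight Q s (rcons t b)) n.+1]_n =
  (fun n => Q s b + \sum_(y <- B) Q s y * \sum_(z <- B)
     series (fun k => walk_weight Q B k y z) n * Q z b).
  apply/funext => n; rewrite /series/= big_nat_recl//= big_seq1 /= mulr1; congr (_ + _).
  rewrite (eq_bigr (fun k => \sum_(y <- B) Q s y * \sum_(z <- B) walk_weight Q B k y z * Q z b)).
    rewrite exchange_big/=; apply: eq_bigr => y _; rewrite -mulr_sumr; congr (_ * _).
    by rewrite exchange_big/=; apply: eq_bigr => z _; rewrite mulr_suml.
  move=> k _; rewrite -/(words B k.+1) sum_words; apply: eq_big_seq => y yB /=.
  by rewrite -mulr_sumr sum_words_rcons.
apply: cvgD; first exact: cvg_cst.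
apply: cvg_sum_seq => y yB; apply: cvgM; first exact: cvg_cst.
apply: cvg_sum_seq => z zB; apply: cvgM; last exact: cvg_cst.
exact: green_cvg.
Qed.

End WalkSums.

(** * Loop erasure *)

Section LoopErasure.
Implicit Types (w a : seq site) (z x : site).

Lemma last_visit_ge w z j : (j < size w)%N -> w`_j = z -> (j <= last_visit w z)%N.
Proof.
move=> jw wj; rewrite /last_visit.
exact: (@leq_bigmax_cond _ (fun i : 'I_(size w) => w`_i == z) (fun i => nat_of_ord i) (Ordinal jw) (introT eqP wj)).
Qed.

Lemma last_visitP w z : z \in w -> (last_visit w z < size w)%N /\ w`_(last_visit w z) = z.
Proof.
move=> zw; rewrite /last_visit.
have iw : (index z w < size w)%N by rewrite index_mem.
have : (0 < #|[pred j : 'I_(size w) | (w`_j == z)%R]|)%N.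
  by apply/card_gt0P; exists (Ordinal iw); rewrite inE /= nth_index.
move=> /(eq_bigmax_cond (fun i : 'I_(size w) => nat_of_ord i))[j].
by rewrite inE => /eqP jz ->; split.
Qed.

Lemma last_visit_unique w z j : (j < size w)%N -> w`_j = z ->
  (forall i, (j < i < size w)%N -> w`_i != z) -> last_visit w z = j.
Proof.
move=> jw wj H; have zw : z \in w by rewrite -wj mem_nth.
have [lw wl] := last_visitP zw.
apply/eqP; rewrite eqn_leq last_visit_ge// andbT leqNgt; apply/negP => jl.
by have := H (last_visit w z); rewrite jl lw wl eqxx => /(_ isT).
Qed.

Lemma nth_cat_shift a w i : (a ++ w)`_(size a + i)%N = w`_i.
Proof. by rewrite nth_cat ltnNge leq_addr /= addKn. Qed.

Lemma last_visit_cat a w z : z \in w -> last_visit (a ++ w) z = (size a + last_visit w z)%N.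
Proof.
move=> zw; have [lw wl] := last_visitP zw.
apply: last_visit_unique; first by rewrite size_cat ltn_add2l.
  by rewrite nth_cat_shift.
move=> i /andP[li]; rewrite size_cat => iw.
have ai : (size a <= i)%N by apply: leq_trans (ltnW li); exact: leq_addr.
rewrite -(subnKC ai) nth_cat_shift; apply/eqP => E.
have := last_visit_ge (_ : i - size a < size w)%N E.
by rewrite ltn_subLR// => /(_ iw); rewrite leqNgt ltn_subRL li.
Qed.

Lemma nsteps_cat a w : w != [::] -> nsteps (a ++ w) = (size a + nsteps w)%N.
Proof. by case: w => // x w _; rewrite /nsteps size_cat /= addnS. Qed.

Lemma erasure_times_cat fuel a w s : w != [::] ->
  erasure_times fuel (a ++ w) (size a + s)%N =
  map (addn (size a)) (erasure_times fuel w s).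
Proof.
move=> w0; elim: fuel s => [//|fuel IH] s /=; rewrite nsteps_cat// ltn_add2l.
congr (_ :: _); case: ltnP => // sw.
have sw' : (s.+1 < size w)%N by move: sw; rewrite /nsteps; case: (size w).
by rewrite -addnS nth_cat_shift last_visit_cat ?mem_nth// IH.
Qed.

Lemma erasure_timesS fuel w s : erasure_times fuel.+1 w s =
  s :: (if (s < nsteps w)%N then erasure_times fuel w (last_visit w w`_s.+1) else [::]).
Proof. by []. Qed.

(** The erasure times increase, so that extra fuel is harmless. *)
Lemma erasure_times_fuel w f1 f2 s : (nsteps w < f1 + s)%N -> (nsteps w < f2 + s)%N ->
  (s <= nsteps w)%N -> w != [::] -> erasure_times f1 w s = erasure_times f2 w s.
Proof.
move=> + + + w0; elim: f1 f2 s => [|f1 IH] f2 s.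
  by rewrite add0n => nsw _; rewrite leqNgt nsw.
case: f2 => [|f2]; first by rewrite add0n => _ nsw; rewrite leqNgt nsw.
rewrite /= => h1 h2 sw; congr (_ :: _); case: ltnP => // sw'.
have sw2 : (s.+1 < size w)%N by move: sw'; rewrite /nsteps; case: (size w).
have [lw _] := last_visitP (mem_nth 0 sw2).
have lge := last_visit_ge sw2 (erefl _).
apply: IH.
- by apply: leq_trans h1 _; rewrite addSnnS leq_add2l.
- by apply: leq_trans h2 _; rewrite addSnnS leq_add2l.
- by move: lw; rewrite /nsteps; case: (size w).
Qed.

Lemma last_nth0 x l : last x l = (x :: l)`_(size l).
Proof. by rewrite -nth_last /=; case: l => //= y l; apply: set_nth_default. Qed.

(** Loop erasure as a recursion on the walk rather than on its visiting times. *)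
Lemma loop_erasure_cons x l y r : last x l = x -> x \notin y :: r ->
  loop_erasure (x :: l ++ y :: r) = x :: loop_erasure (y :: r).
Proof.
move=> lx xr; rewrite /loop_erasure [(x :: l ++ _)`_0]/=.
have -> : last_visit (x :: l ++ y :: r) x = size l.
  apply: last_visit_unique; first by rewrite /= size_cat leq_addr.
    by rewrite -cat_cons nth_cat /= ltnS leqnn -last_nth0.
  move=> i /andP[li]; rewrite -cat_cons size_cat nth_cat.
  have -> : (i < size (x :: l))%N = false by rewrite /= ltnS leqNgt li.
  by move=> ir; apply: contraNneq xr => <-; apply: mem_nth; rewrite ltn_subLR.
have -> : size (x :: l ++ y :: r) = (size l + size r).+2.
  by rewrite /= size_cat /= addnS.
rewrite erasure_timesS -cat_cons nsteps_cat// [X in (X + _)%N]/= addSn ltnS leq_addr.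
rewrite -[(size l).+1]addn0 -[(size l).+1]/(size (x :: l)) nth_cat_shift.
rewrite last_visit_cat ?inE ?eqxx// erasure_times_cat// map_cons.
congr (_ :: _); first by rewrite nth_cat /= ltnS leqnn -last_nth0.
rewrite -map_comp.
have [lr _] := @last_visitP (y :: r) y (mem_head _ _).
rewrite (@erasure_times_fuel _ _ (size (y :: r))).
- by apply: eq_map => i; exact: nth_cat_shift.
- by rewrite /nsteps /=; apply: leq_trans (leq_addr _ _); rewrite ltnS leq_addl.
- by rewrite /nsteps /= addSn ltnS leq_addr.
- by rewrite /nsteps.
- by [].
Qed.

Lemma loop_erasure_loop x l : last x l = x -> loop_erasure (x :: l) = [:: x].
Proof.
move=> lx; rewrite /loop_erasure [(x :: l)`_0]/=.
have -> : last_visit (x :: l) x = size l.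
  apply: last_visit_unique; [by [] | by rewrite -last_nth0 |].
  by move=> i /andP[li]; rewrite /= ltnS leqNgt li.
by rewrite /= /nsteps /= ltnn /= -last_nth0 lx.
Qed.

End LoopErasure.

(** * The lattice *)

Section Lattice.
Implicit Types (x y z w : site) (n : nat).

Lemma sqnorm_eq1 z : (sqnorm z == 1) =
  [|| (z.1 == 1) && (z.2 == 0), (z.1 == -1) && (z.2 == 0),
      (z.1 == 0) && (z.2 == 1) | (z.1 == 0) && (z.2 == -1)].
Proof.
rewrite /sqnorm !expr2; case: z => a b /=; apply/idP/idP; last by lia.
move=> /eqP H; have bd : (-1 <= a <= 1) && (-1 <= b <= 1) by nia.
have [E|[E|E]] : a = -1 \/ a = 0 \/ a = 1 by lia.
all: by rewrite {a}E in H bd *; nia.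
Qed.

Lemma adjacentE z w : adjacent z w =
  [|| (w.1 == z.1 + 1) && (w.2 == z.2), (w.1 == z.1 - 1) && (w.2 == z.2),
      (w.1 == z.1) && (w.2 == z.2 + 1) | (w.1 == z.1) && (w.2 == z.2 - 1)].
Proof. rewrite /adjacent sqnorm_eq1; case: z => a b; case: w => c d /=; lia. Qed.

Lemma adjacent_sym z w : adjacent z w = adjacent w z.
Proof. rewrite !adjacentE; lia. Qed.

Definition in_box n z : bool :=
  (- n%:Z < z.1 < n%:Z + 1) && (- n%:Z < z.2 < n%:Z).

Definition nbrs z : seq site :=
  [:: (z.1 + 1, z.2); (z.1 - 1, z.2); (z.1, z.2 + 1); (z.1, z.2 - 1)].

Lemma mem_nbrs z w : (w \in nbrs z) = adjacent z w.
Proof. rewrite adjacentE !inE -!pair_eqE; case: w => c d /=; lia. Qed.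

Lemma uniq_nbrs z : uniq (nbrs z).
Proof. rewrite /= !inE -!pair_eqE /= !andbT; lia. Qed.

Definition box_list n : seq site :=
  [seq (i%:Z - n%:Z, j%:Z - n%:Z) | i <- iota 0 (n + n).+2, j <- iota 0 (n + n).+2].

Definition boxf n : {fset site} := [fset z in box_list n | in_box n z]%fset.

Lemma mem_box_list n z : in_box n z -> z \in box_list n.
Proof.
rewrite /in_box => H; apply/allpairsP; exists (absz (z.1 + n%:Z), absz (z.2 + n%:Z)); split.
- by rewrite mem_iota /=; lia.
- by rewrite mem_iota /=; lia.
- by case: z H => a b /= H; congr (_, _); lia.
Qed.

Lemma in_boxf n z : (z \in boxf n) = in_box n z.
Proof.
apply/idP/idP => [|H]; rewrite !inE; first by move=> /andP[].
by rewrite H andbT; exact: mem_box_list.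
Qed.

Definition bdry n z : bool :=
  [|| (z.1 == - n%:Z) && (- n%:Z < z.2 < n%:Z),
      (z.1 == n%:Z + 1) && (- n%:Z < z.2 < n%:Z),
      (z.2 == - n%:Z) && (- n%:Z < z.1 < n%:Z + 1) |
      (z.2 == n%:Z) && (- n%:Z < z.1 < n%:Z + 1)].

Lemma bdryP n z : reflect (~~ in_box n z /\ exists2 a, in_box n a & adjacent z a) (bdry n z).
Proof.
apply: (iffP idP); rewrite /bdry /in_box.
  case: z => a b /= H; split; first lia.
  exists (Order.max (1 - n%:Z) (Order.min n%:Z a),
          Order.max (1 - n%:Z) (Order.min (n%:Z - 1) b)) => /=; rewrite ?adjacentE/=; lia.
move=> [z1 [a aB]]; rewrite adjacentE; lia.
Qed.

Lemma sqnorm_ge0 z : 0 <= sqnorm z.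
Proof. by rewrite /sqnorm addr_ge0 ?sqr_ge0. Qed.

Lemma sqnorm_eq0 z : (sqnorm z == 0) = (z == 0).
Proof.
rewrite /sqnorm paddr_eq0 ?sqr_ge0// !sqrf_eq0 -pair_eqE; by case: z.
Qed.

Lemma boundaryE (R : realType) n z : (0 < n)%N -> boundary R n z <-> bdry n z.
Proof.
move=> n0; rewrite /boundary /= /dist.
set S := (X in inf X).
have lb : has_lbound S by exists 0 => _ [a _ <-]; exact: sqrtr_ge0.
have ne : S !=set0.
  by exists (Num.sqrt (sqnorm (z - origin))%:~R), origin => //=; rewrite /box/=; lia.
have sq1 a : z != a -> 1 <= Num.sqrt (sqnorm (z - a))%:~R :> R.
  move=> za; rewrite -[leLHS]sqrtr1; apply: ler_wsqrtr.
  rewrite (_ : 1 = 1%:~R)// ler_int; have := sqnorm_ge0 (z - a).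
  by rewrite le_eqVlt eq_sym sqnorm_eq0 subr_eq0 (negPf za).
split=> [S1|/bdryP[zB [a aB za]]].
  have [_ [a aB <-] a2] : exists2 r, S r & r < Num.sqrt 2.
    apply/inf_lt => //; rewrite S1 -[ltLHS]sqrtr1 ltr_sqrt//; lra.
  have zB : ~~ in_box n z.
    apply/negP => zB; have : S 0.
      by exists z => //; rewrite subrr /sqnorm/= expr0n addr0 sqrtr0.
    by move=> /(ge_inf lb); rewrite S1 ler10.
  apply/bdryP; split => //; exists a => //; rewrite adjacent_sym /adjacent.
  have za : z - a != 0 by rewrite subr_eq0; apply: contraNneq zB => ->.
  move: a2; rewrite ltr_sqrt// (_ : 2 = 2%:~R)// ltr_int => a2.
  have := sqnorm_ge0 (z - a); rewrite le_eqVlt eq_sym sqnorm_eq0 (negPf za) /=.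
  by move: a2; lia.
apply/eqP; rewrite eq_le; apply/andP; split.
  apply: ge_inf => //; exists a => //; move: za; rewrite adjacent_sym => /eqP->.
  by rewrite sqrtr1.
apply: lb_le_inf => // _ [b bB <-]; apply: sq1.
by apply: contraNneq zB => ->.
Qed.

Definition crossb z w : bool :=
  [&& z.2 == w.2, z.2 < 0 & (z.1 == 0) && (w.1 == 1) || (z.1 == 1) && (w.1 == 0)].

Lemma crossingE z w : `[< crossing z w >] = crossb z w.
Proof.
apply/asboolP/idP => [[k k0 [] [-> ->]]|]; rewrite /crossb /=; [lia|lia|].
case: z w => a b [c d] /= H; exists `|b|%N; first lia.
by case: (a =P 0) H => [->|a0] H; [left|right]; split; congr (_, _); lia.
Qed.

Lemma crossb_sym z w : crossb z w = crossb w z.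
Proof. by rewrite /crossb; lia. Qed.

End Lattice.

Section LatticeWeights.
Variable R : realType.
Implicit Types (x y z w : site) (n : nat) (B : {fset site}).

Definition srw x y : R := if adjacent x y then 4^-1 else 0.

(** The random walk weights with a minus sign on the edges of the zipper: a
    path with [J] crossings has weight [(-1)^J 4^-k]. *)
Definition zipped x y : R := (-1) ^+ crossb x y * srw x y.

Lemma srw_ge0 x y : 0 <= srw x y.
Proof. by rewrite /srw; case: ifP => // _; rewrite invr_ge0. Qed.

Lemma srw_sym x y : srw x y = srw y x.
Proof. by rewrite /srw adjacent_sym. Qed.

Lemma zipped_sym x y : zipped x y = zipped y x.
Proof. by rewrite /zipped crossb_sym srw_sym. Qed.

Lemma sum_srw B x (f : site -> R) :
  \sum_(z <- B) srw x z * f z = 4^-1 * \sum_(z <- nbrs x | z \in B) f z.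
Proof.
rewrite mulr_sumr (eq_bigr (fun z => if z \in nbrs x then 4^-1 * f z else 0)); last first.
  by move=> z _; rewrite /srw mem_nbrs; case: ifP => //; rewrite mul0r.
rewrite -big_mkcond/= -[LHS]big_filter -[RHS]big_filter; apply: perm_big.
apply: uniq_perm; rewrite ?filter_uniq ?fset_uniq ?uniq_nbrs// => z.
by rewrite !mem_filter andbC.
Qed.

(** The average of [|z|^2] over the four neighbors of [x] is [|x|^2 + 1], so that
    one step of the walk lowers [C - |z|^2] by one. *)
Lemma contracting_srw n : contracting srw (boxf n).
Proof.
pose C : int := (n%:Z + n%:Z + n%:Z + 9) ^+ 2.
pose phi z : R := (C - sqnorm z)%:~R.
have C0 : 0 < C by rewrite /C exprn_gt0//; lia.
have CR : 0 < C%:~R :> R by rewrite ltr0z.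
exists phi, (1 - C%:~R^-1); split.
- rewrite subr_ge0 invf_le1// (_ : 1 = 1%:~R)// ler_int; lia.
- by rewrite gtrBl invr_gt0.
- move=> x; rewrite in_boxf /in_box => xB; rewrite /phi ltr0z /C /sqnorm !expr2.
  by case: x xB => a b /= xB; nia.
move=> x; rewrite in_boxf /in_box => xB.
rewrite (eq_bigr (fun z => srw x z * phi z)); last first.
  by move=> z _; rewrite ger0_norm// srw_ge0.
rewrite sum_srw.
apply: le_trans (_ : 4^-1 * \sum_(z <- nbrs x) phi z <= _).
  rewrite ler_pM2l ?invr_gt0// big_mkcond/= big_seq [leRHS]big_seq.
  apply: ler_sum => z; rewrite mem_nbrs adjacentE => xz; case: ifP => // _.
  rewrite /phi ler0z /C /sqnorm !expr2.
  by case: x z xB xz => a b [c d] /= xB xz; nia.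
have -> : \sum_(z <- nbrs x) phi z = 4 * (phi x - 1).
  transitivity ((4 * (C - sqnorm x - 1))%:~R : R).
    rewrite /nbrs !big_cons big_nil addr0 /phi -!intrD; congr (_%:~R).
    rewrite /sqnorm !expr2 /=; ring.
  by rewrite intrM intrB.
rewrite mulKf ?pnatr_eq0// mulrBl mul1r lerD2l lerN2 ler_pdivrMl// mulr1 /phi ler_int.
by rewrite gerBl sqnorm_ge0.
Qed.

Lemma zipped_norm x y : `|zipped x y| = srw x y.
Proof. by rewrite /zipped normrM normrX normrN1 expr1n mul1r ger0_norm ?srw_ge0. Qed.

Lemma contracting_srw_sub n B : (B `<=` boxf n)%fset -> contracting srw B.
Proof. by move=> /contracting_sub; apply; exact: contracting_srw. Qed.

Lemma contracting_zipped n B : (B `<=` boxf n)%fset -> contracting zipped B.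
Proof.
move=> sB; apply: contracting_le sB _ (contracting_srw n) => x y.
by rewrite zipped_norm ger0_norm// srw_ge0.
Qed.

End LatticeWeights.

(** * Hitting probabilities of the random walk *)

Section HittingProbability.
Variables (R : realType) (d : measure_display) (Omega : measurableType d).
Variables (P : probability Omega R) (S : nat -> Omega -> site).
Hypothesis hS : simple_random_walk P S.
Implicit Types (x y z w e : site) (n : nat) (s t : seq site).

Lemma probability_bigcup_esum (I : countType) (D : set I) (F : I -> set Omega) :
  (forall i, measurable (F i)) -> trivIset D F ->
  (P (\bigcup_(i in D) F i) = \esum_(i in D) P (F i))%E.
Proof.
move=> mF tF.
pose G k : set Omega := oapp F set0 (choice.unpickle k).
have GE i : G (choice.pickle i) = F i by rewrite /G choice.pickleK.
have -> : \bigcup_(i in D) F i = \bigcup_(k in [set choice.pickle i | i in D]) G k.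
  by rewrite bigcup_image; apply: eq_bigcupr => i _; rewrite GE.
rewrite measure_bigcup; first last.
- move=> _ _ [i Di <-] [j Dj <-]; rewrite !GE => ij; congr choice.pickle; exact: tF.
- by move=> k _; rewrite /G; case: choice.unpickle => [i|]/=; [exact: mF|exact: measurable0].
rewrite nneseries_esum// set_mem_set esum_image; last by move=> i j _ _; exact: (pcan_inj choice.pickleK).
by apply: eq_esum => i _; rewrite GE.
Qed.

Lemma measurable_increment j e : measurable (increment S j @^-1` [set e]).
Proof.
case: hS => _ mS _ _.
have -> : increment S j @^-1` [set e] =
    \bigcup_a (S j @^-1` [set a] `&` S j.+1 @^-1` [set a + e]).
  apply/seteqP; split => x /= => [E|[a _ [/= ja jb]]].
    by exists (S j x) => //; split => //=; rewrite -E /increment addrC subrK.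
  by rewrite /increment ja jb addrC addKr.
apply: countable_bigcupT_measurable; first exact: countableP.
by move=> a; apply: measurableI; exact: mS.
Qed.

(** The four unit increments exhaust the probability, so that any other one is
    negligible. *)
Lemma increment_probability j x y :
  P (increment S j @^-1` [set y - x]) = (srw R x y)%:E.
Proof.
case: hS => _ mS unif _; rewrite /srw /adjacent; case: eqP => [|/eqP e1]; first exact: unif.
set e := y - x in e1 *.
have PU : P (\bigcup_(f in [set` nbrs 0]) (increment S j @^-1` [set f])) = 1%E.
  rewrite probability_bigcup_esum; first last.
  - by move=> f g _ _ [x' [/= <- <-]].
  - by move=> f; exact: measurable_increment.
  rewrite (eq_esum (b := fun=> (4^-1)%:E)); last first.
    move=> f /=; rewrite mem_nbrs /adjacent subr0 => /eqP; exact: unif.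
  rewrite (@esum_seq R _ _ (fun=> 4^-1)) ?uniq_nbrs//.
  by rewrite /nbrs !big_cons big_nil; congr EFin; lra.
apply/eqP; rewrite eq_le measure_ge0 andbT.
rewrite (_ : 0%:E = P (~` \bigcup_(f in [set` nbrs 0]) (increment S j @^-1` [set f]))); last first.
  rewrite probability_setC ?PU ?subee//.
  apply: fin_bigcup_measurable => [|f _]; [exact: finite_seq|exact: measurable_increment].
apply: le_measure; rewrite ?inE.
- exact: measurable_increment.
- apply: measurableC; apply: fin_bigcup_measurable => [|f _]; [exact: finite_seq|exact: measurable_increment].
move=> x' /= xe [f /= fN xf]; move: e1; rewrite -xe xf.
by move: fN; rewrite mem_nbrs /adjacent subr0 => ->.
Qed.

Definition cylinder s : set Omega := [set x | forall i, (i < size s)%N -> S i.+1 x = s`_i].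

Lemma path_weight_prod (Q : site -> site -> R) x s :
  path_weight Q x s = \prod_(0 <= j < size s) Q (x :: s)`_j (x :: s)`_j.+1.
Proof.
elim: s x => [|y s IH] x; first by rewrite big_geq.
by rewrite [size _]/= big_nat_recl// [LHS]/= IH.
Qed.

Lemma cylinder_increments s : cylinder s =
  \bigcap_(j in [set` index_iota 0 (size s)])
     (increment S j @^-1` [set (origin :: s)`_j.+1 - (origin :: s)`_j]).
Proof.
case: hS => S0 _ _ _; apply/seteqP; split => x /= H.
  move=> j /=; rewrite mem_index_iota => /andP[_ js].
  rewrite /increment H//; congr (_ - _); case: j js => [|j] js /=; first exact: S0.
  by apply: H; exact: ltnW.
elim=> [|i IH] si.
  by have := H 0%N; rewrite /= mem_index_iota si /increment S0 subr0 => /(_ isT); rewrite subr0.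
have := H i.+1; rewrite /= mem_index_iota si /increment IH; last exact: ltnW.
by move=> /(_ isT)/addIr.
Qed.

Lemma cylinder_probability s : P (cylinder s) = (path_weight (srw R) origin s)%:E.
Proof.
case: hS => _ _ _ ind; rewrite cylinder_increments.
rewrite (ind _ (fun j => [set (origin :: s)`_j.+1 - (origin :: s)`_j])) ?iota_uniq//.
by rewrite path_weight_prod -prodEFin; apply: eq_bigr => j _; exact: increment_probability.
Qed.

Lemma measurable_cylinder s : measurable (cylinder s).
Proof.
rewrite cylinder_increments; apply: fin_bigcap_measurable; first exact: finite_seq.
by move=> j _; exact: measurable_increment.
Qed.

Definition slit_box n : {fset site} :=
  [fset x in boxf n | ~~ ((x.2 == 0) && (0 <= x.1))]%fset.

Lemma targetE n z : (0 < n)%N -> target R n z <-> ((z.2 == 0) && (0 <= z.1)) || bdry n z.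
Proof.
move=> n0; split => [[[/= -> ->]//|/(boundaryE _ _ n0)->]|/orP[/andP[/eqP ? ?]|]]; rewrite ?orbT//.
  by left.
by move=> /(boundaryE R _ n0); right.
Qed.

Lemma hits_at_cylinders n z : target R n z -> hits_at R n S z =
  \bigcup_(t in [set t : seq site | forall x, x \in t -> ~ target R n x]) cylinder (rcons t z).
Proof.
move=> tz; apply/seteqP; split => x /=.
  move=> [k [k1 tk nk] Sk]; exists (mkseq (fun i => S i.+1 x) k.-1) => /=.
    move=> y /mapP[i]; rewrite mem_iota add0n => /andP[_ ik] ->; apply: nk.
    by rewrite /= -ltnS -(prednK k1) in ik *.
  move=> i; rewrite size_rcons size_mkseq nth_rcons size_mkseq ltnS leq_eqVlt.
  case: ltnP => [ik _|ki]; first by rewrite nth_mkseq.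
  by rewrite orbF => /eqP ->; rewrite eqxx prednK.
move=> [t /= tt xt]; exists (size t).+1; last first.
  by rewrite xt ?size_rcons// nth_rcons ltnn eqxx.
split => //; first by rewrite xt ?size_rcons// nth_rcons ltnn eqxx.
move=> [//|j] /=; rewrite ltnS => jt; rewrite xt ?size_rcons ?ltnS ?(ltnW jt)//.
by rewrite nth_rcons jt; apply: tt; exact: mem_nth.
Qed.

Lemma cylinders_disjoint n z : target R n z ->
  trivIset [set t : seq site | forall x, x \in t -> ~ target R n x] (fun t => cylinder (rcons t z)).
Proof.
move=> tz.
have key t t' (om : Omega) : (forall x, x \in t' -> ~ target R n x) ->
    cylinder (rcons t z) om -> cylinder (rcons t' z) om -> (size t' <= size t)%N.
  move=> H c c'; rewrite leqNgt; apply/negP => tt'.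
  have := c (size t); rewrite size_rcons => /(_ (ltnSn _)); rewrite nth_rcons ltnn eqxx.
  have := c' (size t); rewrite size_rcons ltnS => /(_ (ltnW tt')) ->; rewrite nth_rcons tt' => E.
  by apply: (H t'`_(size t)); [exact: mem_nth|rewrite E].
move=> t t' /= H H' [x [c c']].
have st : size t = size t' by apply/eqP; rewrite eqn_leq (key t' t x)// (key t t' x).
apply: (@eq_from_nth _ 0) => // i it.
have := c i; rewrite size_rcons ltnS => /(_ (ltnW it)); rewrite nth_rcons it => <-.
by have := c' i; rewrite size_rcons ltnS -st => /(_ (ltnW it)); rewrite nth_rcons -st it => <-.
Qed.

Lemma slit_box_sub n : (slit_box n `<=` boxf n)%fset.
Proof. by apply/fsubsetP => x; rewrite !inE => /andP[]. Qed.

Lemma in_slit_box n x : (x \in slit_box n) = in_box n x && ~~ ((x.2 == 0) && (0 <= x.1)).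
Proof. by rewrite -in_boxf !inE. Qed.

(** The trajectories up to the hitting time form disjoint cylinders; those with
    positive probability stay in the slit box before that time. *)
Lemma hit_probability n z : (0 < n)%N -> bdry n z ->
  P (hits_at R n S z) = (excursion (srw R) (slit_box n) origin z)%:E.
Proof.
move=> n0 zb; have tz : target R n z by apply/targetE => //; rewrite zb orbT.
rewrite hits_at_cylinders// probability_bigcup_esum; last exact: cylinders_disjoint.
  rewrite -esum_excursion; [|exact: srw_ge0|exact/contracting_srw_sub/slit_box_sub].
  apply/esym; rewrite (eq_esum (b := fun t => P (cylinder (rcons t z)))); last first.
    by move=> t _; rewrite cylinder_probability.
  apply: esum_eq_support => t /= => [/allP tB x /tB /=|tT].
    by rewrite in_slit_box => /andP[xB x0] /(targetE _ n0); rewrite (negPf x0) /= => /bdryP[] /negP.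
  move=> tB; rewrite cylinder_probability; congr EFin.
  suff: forall x, in_box n x -> ~~ all (mem (slit_box n)) t -> path_weight (srw R) x (rcons t z) = 0.
    by apply; [rewrite /in_box/=; lia|exact/negP].
  elim: t tT {tB} => [//|y t IH] tT x xB /=.
  rewrite negb_and /srw; case: ifP => [xy|]; last by rewrite mul0r.
  have ny : ~ target R n y by apply: tT; rewrite inE eqxx.
  have yB : in_box n y.
    apply/negPn/negP => yB; apply: ny; apply/targetE => //; apply/orP; right.
    by apply/bdryP; split => //; exists x => //; rewrite adjacent_sym.
  have ys : y \in slit_box n.
    by rewrite in_slit_box yB; apply/negP => y0; apply: ny; apply/targetE => //; rewrite y0.
  by rewrite ys /= => tn; rewrite IH ?mulr0// => w wt; apply: tT; rewrite inE wt orbT.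
by move=> t; exact: measurable_cylinder.
Qed.

End HittingProbability.

(** * From the slit box to the box without the two marked points *)

Section Slit.
Variable R : realType.
Implicit Types (x y z w b : site) (n : nat).

Definition punctured_box n : {fset site} := (boxf n `\ origin `\ site1)%fset.

Lemma in_punctured_box n x :
  (x \in punctured_box n) = [&& x != site1, x != origin & in_box n x].
Proof. by rewrite -in_boxf !inE. Qed.

Lemma site_eqE x y : (x == y) = (x.1 == y.1) && (x.2 == y.2).
Proof. by rewrite -pair_eqE. Qed.

Lemma punctured_box_sub n : (punctured_box n `<=` boxf n)%fset.
Proof. by apply/fsubsetP => x; rewrite in_punctured_box in_boxf => /and3P[]. Qed.

Lemma slit_box_punctured n : (slit_box n `<=` punctured_box n)%fset.
Proof.
apply/fsubsetP => x; rewrite in_slit_box in_punctured_box !site_eqE /=; lia.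
Qed.

Definition quadrant x : bool := (0 < x.1) && (x.2 < 0).

Lemma sign_IE x : sign_I R x = (-1) ^+ quadrant x.
Proof. by rewrite /sign_I /quadrant; case: ifP. Qed.

Lemma sign_I_sq x : sign_I R x * sign_I R x = 1.
Proof. by rewrite sign_IE -expr2 sqrr_sign. Qed.

(** Off the slit the zipper cuts exactly the edges entering or leaving the
    lower right quadrant. *)
Lemma zipped_quadrant x y : crossb x y = quadrant x (+) quadrant y \/ srw R x y = 0 ->
  zipped R x y = sign_I R x * srw R x y * sign_I R y.
Proof.
rewrite !sign_IE /zipped => -[->|->]; last by rewrite !mulr0 mul0r.
by rewrite signr_addb mulrAC.
Qed.

Lemma srw_eq0 x y : (srw R x y == 0) = ~~ adjacent x y.
Proof. by rewrite /srw; case: ifP => _; rewrite ?eqxx// invr_eq0 pnatr_eq0. Qed.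

Lemma zipped_slit n x y : (0 < n)%N -> (x == origin) || (x \in slit_box n) ->
  bdry n y || (y \in slit_box n) ->
  zipped R x y = sign_I R x * srw R x y * sign_I R y.
Proof.
move=> n0 xS yS; apply: zipped_quadrant.
case: (boolP (adjacent x y)) => [xy|nxy]; last by right; apply/eqP; rewrite srw_eq0.
left; move: xy xS yS; rewrite /crossb /quadrant !in_slit_box /in_box /bdry site_eqE adjacentE /=.
case: x y => a b [c e] /=; lia.
Qed.

Lemma excursion_slit n z : (0 < n)%N -> bdry n z ->
  excursion (zipped R) (slit_box n) origin z
  = sign_I R z * excursion (srw R) (slit_box n) origin z.
Proof.
move=> n0 zb; rewrite (@excursion_gauge _ _ (srw R) _ (sign_I R)).
- by rewrite {1}/sign_I /= mul1r mulrC.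
- exact/contracting_srw_sub/slit_box_sub.
- exact/contracting_zipped/slit_box_sub.
- exact: sign_I_sq.
move=> x y; rewrite !in_fset1U => xs ys; apply: (zipped_slit n0 xs).
by case/orP: ys => [/eqP->|->]; rewrite ?zb// orbT.
Qed.

Definition conj_site x : site := (x.1, - x.2).

Lemma conj_siteK : involutive conj_site.
Proof. by case=> a b; rewrite /conj_site /= opprK. Qed.

Lemma srw_conj x y : srw R (conj_site x) (conj_site y) = srw R x y.
Proof. rewrite /srw !adjacentE /=; congr (if _ then _ else _); lia. Qed.

Lemma slit_box_conj n x : x \in slit_box n -> conj_site x \in slit_box n.
Proof. rewrite !in_slit_box /in_box /=; lia. Qed.

(** By conjugation the walks that reach the slit from above and from below
    cancel. *)
Lemma excursion_slit_point n w : (0 < n)%N -> w.2 = 0 -> 2 <= w.1 ->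
  excursion (zipped R) (slit_box n) origin w = 0.
Proof.
move=> n0 w2 w1; pose B := slit_box n.
have cp : contracting (srw R) B by exact/contracting_srw_sub/slit_box_sub.
have cq : contracting (zipped R) B by exact/contracting_zipped/slit_box_sub.
pose h z := sign_I R z * zipped R z w.
have hN z : z \in B -> h (conj_site z) = - h z.
  rewrite in_slit_box /in_box /h /zipped => zB.
  have sE : srw R (conj_site z) w = srw R z w.
    by rewrite -[RHS]srw_conj; congr srw; rewrite /conj_site w2 oppr0 -w2; case: (w).
  rewrite sE; case: (boolP (adjacent z w)) => [|]; last first.
    by rewrite -srw_eq0 => /eqP->; rewrite !mulr0 oppr0.
  rewrite adjacentE => zw.
  have -> : crossb (conj_site z) w = false by rewrite /crossb /=; lia.
  have -> : crossb z w = false by rewrite /crossb; lia.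
  rewrite !sign_IE.
  have -> : quadrant (conj_site z) = ~~ quadrant z by rewrite /quadrant /=; lia.
  by rewrite -addTb signr_addb expr1 mulN1r mulNr.
have -> : excursion (zipped R) B origin w =
   \sum_(y <- B) \sum_(z <- B) srw R origin y * green (srw R) B y z * h z.
  rewrite /excursion {1}/zipped [srw R origin w](_ : _ = 0).
    rewrite mulr0 add0r; apply: eq_big_seq => y yB; rewrite mulr_sumr.
    apply: eq_big_seq => z zB.
    rewrite (green_gauge cp cq sign_I_sq)//; last first.
      by move=> u v uB vB; apply: (zipped_slit n0); apply/orP; right.
    rewrite (@zipped_slit n origin y) ?yB ?orbT// {1}/sign_I /= mul1r.
    transitivity ((sign_I R y * sign_I R y) * (srw R origin y * green (srw R) B y z * h z)).
      by rewrite /h; ring.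
    by rewrite sign_I_sq mul1r.
  by apply/eqP; rewrite srw_eq0 adjacentE /=; lia.
apply/eqP; rewrite -[_ == 0](@mulrn_eq0 _ _ 2) mulr2n.
rewrite {1}(big_fset_involution _ conj_siteK (@slit_box_conj n)) -big_split/=.
apply/eqP; apply: big1_seq => y /= yB.
rewrite (big_fset_involution _ conj_siteK (@slit_box_conj n)) -big_split/=.
apply: big1_seq => z /= zB; rewrite hN//.
rewrite (green_involution _ _ conj_siteK (@slit_box_conj n) srw_conj).
by rewrite (srw_conj origin y); ring.
Qed.

(** The points of the slit are added one at a time: by [excursionD1] the kernel
    changes by a multiple of the kernel to the new point, which vanishes. *)
Lemma excursion_add_slit n (C : {fset site}) b : (0 < n)%N ->
  (slit_box n `<=` C)%fset -> (C `<=` punctured_box n)%fset ->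
  excursion (zipped R) C origin b = excursion (zipped R) (slit_box n) origin b.
Proof.
move=> n0; have [m] := ubnP #|` C|; elim: m C b => // m IH C b Cm sC Cs.
have [/eqP CE|CN] := boolP (C == slit_box n); first by rewrite CE.
have [w wC wS] : exists2 w, w \in C & w \notin slit_box n.
  have := fproperE (slit_box n) C; rewrite sC /=.
  case: (boolP (C `<=` slit_box n)%fset) => [Cs'|/fsubsetPn[w wC wS] _]; last by exists w.
  by rewrite eqEfsubset Cs' sC in CN.
have cC : contracting (zipped R) C.
  exact: contracting_zipped (fsubset_trans Cs (punctured_box_sub n)).
have sC' : (slit_box n `<=` C `\ w)%fset.
  apply/fsubsetP => x xS; rewrite !inE (fsubsetP sC)// andbT.
  by apply: contraNneq wS => <-.
have Cs' : (C `\ w `<=` punctured_box n)%fset.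
  exact: fsubset_trans (fsubD1set _ _) Cs.
have C'm : (#|` (C `\ w)%fset| < m)%N by have := cardfsD1 w C; rewrite wC; lia.
have [w2 w1] : w.2 = 0 /\ 2 <= w.1.
  by move: wS (fsubsetP Cs _ wC); rewrite in_punctured_box in_slit_box !site_eqE /=; lia.
by rewrite (excursionD1 origin b cC wC) !IH// (excursion_slit_point n0 w2 w1) mul0r addr0.
Qed.

Lemma reflectionK : involutive reflection.
Proof. by case=> a b; rewrite /reflection /= opprB addrC subrK. Qed.

Lemma zipped_reflection x y : zipped R (reflection x) (reflection y) = zipped R x y.
Proof.
have -> : zipped R x y = (-1) ^+ crossb x y * srw R x y by [].
rewrite /zipped; congr (_ ^+ _ * _); first by rewrite /crossb /=; congr nat_of_bool; lia.
rewrite /srw !adjacentE /=; congr (if _ then _ else _); lia.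
Qed.

Lemma punctured_box_reflection n x :
  x \in punctured_box n -> reflection x \in punctured_box n.
Proof. rewrite !in_punctured_box !site_eqE /in_box /=; lia. Qed.

Lemma bdry_reflection n z : bdry n z -> bdry n (reflection z).
Proof. rewrite /bdry /=; lia. Qed.

Lemma excursion_site1 n z :
  excursion (zipped R) (punctured_box n) site1 z =
  excursion (zipped R) (punctured_box n) origin (reflection z).
Proof.
rewrite -(excursion_involution _ _ reflectionK (@punctured_box_reflection n) zipped_reflection).
by [].
Qed.

Lemma Rn_excursion d (Omega : measurableType d) (P : probability Omega R)
    (S : nat -> Omega -> site) n z : simple_random_walk P S -> (0 < n)%N -> bdry n z ->
  Rn P S n z = excursion (zipped R) (punctured_box n) origin z.
Proof.
move=> hS n0 zb; rewrite /Rn hit_probability//= -excursion_slit//.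
by rewrite -(@excursion_add_slit n (punctured_box n))// slit_box_punctured.
Qed.

End Slit.

(** * Parity of the zipper crossings *)

Section Parity.
Implicit Types (x y z u v w : site) (n : nat) (s t : seq site) (c h : int).

Fixpoint path_parity (e : rel site) x s : bool :=
  if s is y :: s' then e x y (+) path_parity e y s' else false.

Lemma path_parity_cut (V : pred site) x s :
  path_parity (fun y z => V y (+) V z) x s = V x (+) V (last x s).
Proof.
elim: s x => [|y s IH] x /=; first by rewrite addbb.
by rewrite IH -addbA (addbA (V y)) addbb addFb.
Qed.

Lemma path_parity_add (e e' : rel site) x s :
  path_parity (fun y z => e y z (+) e' y z) x s = path_parity e x s (+) path_parity e' x s.
Proof. by elim: s x => [//|y s IH] x /=; rewrite IH -!addbA; congr (_ (+) _); rewrite addbCA. Qed.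

Lemma eq_path_parity (e e' : rel site) x s : path adjacent x s ->
  (forall y z, y \in x :: s -> z \in s -> adjacent y z -> e y z = e' y z) ->
  path_parity e x s = path_parity e' x s.
Proof.
elim: s x => [//|y s IH] x /= /andP[xy ys] H; rewrite H ?inE ?eqxx//; congr (_ (+) _).
apply: IH => // u v us vs uv; apply: H => //; first by rewrite inE us orbT.
by rewrite inE vs orbT.
Qed.

Lemma path_parity_false (e : rel site) x s : path adjacent x s ->
  (forall y z, y \in x :: s -> z \in s -> adjacent y z -> e y z = false) ->
  path_parity e x s = false.
Proof.
move=> xs H; rewrite (eq_path_parity (e' := fun _ _ => false) xs H).
by elim: s x {xs H} => //= y s IH x; exact: IH.
Qed.

Lemma path_parity_cat (e : rel site) x s t :
  path_parity e x (s ++ t) = path_parity e x s (+) path_parity e (last x s) t.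
Proof. by elim: s x => [//|y s IH] x /=; rewrite IH addbA. Qed.

Lemma path_parity_rev (e : rel site) x s : symmetric e ->
  path_parity e (last x s) (rev (belast x s)) = path_parity e x s.
Proof.
move=> es; elim: s x => [//|y s IH] x /=.
rewrite rev_cons -cats1 path_parity_cat IH /= addbF addbC es; congr (e _ _ (+) _).
by case: s {IH} => //= z s; rewrite rev_cons last_rcons.
Qed.

(** The horizontal edges between the columns [c] and [c + 1] below height [h];
    the zipper is [below 0 0]. *)
Definition below c h : rel site := fun y z =>
  [&& y.2 == z.2, y.2 < h & (y.1 == c) && (z.1 == c + 1) || (y.1 == c + 1) && (z.1 == c)].

Definition column c h : pred site := fun y => (y.1 == c) && (y.2 < h).

Lemma crossb_below y z : crossb y z = below 0 0 y z.
Proof. by rewrite /crossb /below add0r. Qed.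

Lemma below_sym c h y z : below c h y z = below c h z y.
Proof.
by rewrite /below eq_sym [_ && (z.1 == c + 1)]andbC [(y.1 == c + 1) && _]andbC orbC; case: eqP => //= ->.
Qed.

Lemma below_horizontal c h a b : below c h (a, b) (a + 1, b) = (a == c) && (b < h).
Proof. rewrite /below /= eqxx; lia. Qed.

Lemma below_vertical c h a b b' : below c h (a, b) (a, b') = false.
Proof. rewrite /below /=; lia. Qed.

(** Up to symmetry, an edge goes one step to the right or one step up. *)
Lemma adjacent_ind (K : site -> site -> Prop) : (forall u v, K u v -> K v u) ->
  (forall a b, K (a, b) (a + 1, b)) -> (forall a b, K (a, b) (a, b + 1)) ->
  forall u v, adjacent u v -> K u v.
Proof.
move=> sK hK vK [a b] [a' b']; rewrite adjacentE /= => /or4P[] /andP[/eqP-> /eqP->].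
- exact: hK.
- by apply: sK; rewrite -{2}(subrK 1 a); exact: hK.
- exact: vK.
- by apply: sK; rewrite -{2}(subrK 1 b); exact: vK.
Qed.

(** The edges leaving a vertical half-line are those on its two sides, and the
    one above its end. *)
Lemma below_shift c h x s : path adjacent x s -> (c, h) \notin x :: s ->
  path_parity (below (c - 1) h) x s (+) path_parity (below c h) x s =
  column c h x (+) column c h (last x s).
Proof.
move=> xs ch; rewrite -path_parity_add -path_parity_cut.
apply: eq_path_parity => // y z ys zs yz.
have : y != (c, h) by apply: contraNneq ch => <-.
have : z != (c, h) by apply: contraNneq ch => <-; rewrite inE zs orbT.
move: y z yz {ys zs}; apply: adjacent_ind => [y z IH zc yc|a b _ _|a b].
- by rewrite below_sym [below c _ _ _]below_sym IH// addbC.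
- rewrite !below_horizontal /column /= addbC.
  by rewrite (_ : (a == c - 1) = (a + 1 == c)) 1?addbC//; lia.
- rewrite site_eqE /column !below_vertical /=; case: eqP => //= _ bh _.
  by rewrite (_ : (b + 1 < h) = (b < h)) ?addbb//; lia.
Qed.

Lemma below_up c h x s : path adjacent x s -> (c, h) \notin x :: s ->
  path_parity (below c (h + 1)) x s = path_parity (below c h) x s.
Proof.
move=> xs ch; apply: eq_path_parity => // y z ys zs yz.
have : y != (c, h) by apply: contraNneq ch => <-.
have : z != (c, h) by apply: contraNneq ch => <-; rewrite inE zs orbT.
move: y z yz {ys zs}; apply: adjacent_ind => [y z IH zc yc|a b _|a b _ _].
- by rewrite below_sym [RHS]below_sym IH.
- by rewrite !below_horizontal site_eqE /=; lia.
- by rewrite !below_vertical.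
Qed.

Definition bottom n z c : bool := (z.2 == - n%:Z) && (z.1 <= c).

Variant bdry_spec n : site -> Prop :=
  | BdryLeft b of - n%:Z < b < n%:Z : bdry_spec n (- n%:Z, b)
  | BdryRight b of - n%:Z < b < n%:Z : bdry_spec n (n%:Z + 1, b)
  | BdryBottom a of - n%:Z < a < n%:Z + 1 : bdry_spec n (a, - n%:Z)
  | BdryTop a of - n%:Z < a < n%:Z + 1 : bdry_spec n (a, n%:Z).

Lemma bdry_specP n z : bdry n z -> bdry_spec n z.
Proof. by case: z => a b /or4P[] /= /andP[/eqP-> ?]; constructor. Qed.

(** A two-coloring of the complement of a path [z :: s] from the boundary to the
    origin.  The parity of the number of edges of the path below a point is
    locally constant off the path, except at the columns of its two endpoints.
    The other terms correct these jumps and move the one at the origin to the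
    zipper. *)
Definition side n z s u : bool :=
  path_parity (below u.1 u.2) z s (+) bottom n z u.1 (+) (0 <= u.1)
    (+) ((u.1 == 0) && (u.2 < 0)).

Section Side.
Variables (n : nat) (z : site) (s : seq site).
Hypotheses (zb : bdry n z) (zs : path adjacent z s) (s0 : last z s = origin).

Lemma origin_on_path : origin \in z :: s.
Proof. by rewrite -s0 mem_last. Qed.

Lemma side_vertical u : in_box n u -> u \notin z :: s -> (u.1, u.2 + 1) \notin z :: s ->
  side n z s u = side n z s (u.1, u.2 + 1).
Proof.
move=> uB us vs; rewrite /side /= below_up//; last by case: (u) us.
congr (_ (+) _); have : (u.1, u.2 + 1) != origin.
  by apply: contraNneq vs => ->; exact: origin_on_path.
by rewrite site_eqE /=; lia.
Qed.

Lemma bottomS c h : - n%:Z < c < n%:Z -> - n%:Z < h < n%:Z ->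
  bottom n z (c + 1) = column (c + 1) h z (+) bottom n z c.
Proof.
rewrite /column /bottom; case/bdry_specP: zb => a ha hc hh /=; [lia|lia| |lia].
by rewrite eqxx (_ : - n%:Z < h) ?andbT/=; lia.
Qed.

Lemma side_horizontal u : in_box n u -> in_box n (u.1 + 1, u.2) ->
  u \notin z :: s -> (u.1 + 1, u.2) \notin z :: s ->
  side n z s u (+) side n z s (u.1 + 1, u.2) = crossb u (u.1 + 1, u.2).
Proof.
move=> uB vB us vs; have := below_shift zs vs; rewrite addrK s0 /side /=.
have : (u.1 + 1, u.2) != origin.
  by apply: contraNneq vs => ->; exact: origin_on_path.
move: uB vB {us vs}; case: u => a b; rewrite site_eqE /in_box /= crossb_below below_horizontal.
move=> uB vB v0; rewrite (@bottomS a b); [|lia|lia].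
have e0 : column (a + 1) b origin (+) (0 <= a) =
    (0 <= a + 1) (+) ((a + 1 == 0) && (b < 0)).
  have -> : (0 <= a + 1) = (0 <= a) (+) (a + 1 == 0) by lia.
  rewrite /column /= eq_sym; case: (a + 1 == 0) v0 => /= v0; last by rewrite !addbF.
  have -> : (0 < b) = ~~ (b < 0) by lia.
  by case: (0 <= a); case: (b < 0).
move: e0; case: path_parity; case: path_parity; case: column; case: column; case: bottom;
  by case: (0 <= a); case: (0 <= a + 1); case: (_ && _); case: (_ && _).
Qed.

Lemma side_step u v : in_box n u -> in_box n v -> adjacent u v ->
  u \notin z :: s -> v \notin z :: s -> side n z s u (+) side n z s v = crossb u v.
Proof.
move=> uB vB uv us vs.
move: u v uv uB vB us vs; apply: adjacent_ind => [u v IH uB vB us vs|a b|a b] .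
- by rewrite addbC crossb_sym IH.
- exact: (@side_horizontal (a, b)).
- move=> uB _ us vs; rewrite -[(a, b + 1)]/((a, b).1, (a, b).2 + 1) -side_vertical// addbb.
  by rewrite crossb_below below_vertical.
Qed.

(** By [side_step], the parities of the crossings along the path telescope. *)
Lemma side_path u t : in_box n u -> all (in_box n) t -> path adjacent u t ->
  (forall v, v \in u :: t -> v \notin z :: s) ->
  path_parity crossb u t = side n z s u (+) side n z s (last u t).
Proof.
elim: t u => [|v t IH] u uB /=; first by rewrite addbb.
move=> /andP[vB tB] /andP[uv vt] H.
have us := H u (mem_head _ _); have vs : v \notin z :: s by apply: H; rewrite !inE eqxx orbT.
rewrite IH//; last by move=> w wt; apply: H; rewrite inE wt orbT.
by rewrite -side_step// -addbA (addbA (side n z s v)) addbb addFb.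
Qed.

End Side.

(** The parity of the zipper crossings of a self-avoiding path from [z1] to
    [z2] that uses the edge from [origin] to [site1]. *)
Definition crossing_parity n z1 z2 : bool :=
  if z2.2 == - n%:Z then
    ~~ (bottom n z1 0 (+) bottom n z1 z2.1 (+) (1 <= z2.1))
  else if z2.2 == n%:Z then
    ~~ (bottom n z1 0 (+) (z1.1 <= z2.1) (+) bottom n z1 z2.1)
  else if z2.1 == - n%:Z then
    ~~ (bottom n z1 0 (+) ((z1.1 == - n%:Z) && (z1.2 < z2.2)))
  else bottom n z1 0 (+) ((z1.1 == n%:Z + 1) && (z1.2 < z2.2)) (+) (z1.2 == - n%:Z).

Lemma crossing_parityN n z1 z2 : (0 < n)%N -> bdry n z1 -> bdry n z2 -> z1 != z2 ->
  crossing_parity n z2 z1 = ~~ crossing_parity n z1 z2.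
Proof.
move=> n0; have nn : (- n%:Z == n%:Z) = false by lia.
have nn' : (n%:Z == - n%:Z) = false by lia.
have n1 : (n%:Z + 1 == - n%:Z) = false by lia.
have n2 : (- n%:Z == n%:Z + 1) = false by lia.
have inF (x : int) : - n%:Z < x < n%:Z -> ((x == - n%:Z) = false) * ((x == n%:Z) = false) by split; lia.
have inG (x : int) : - n%:Z < x < n%:Z + 1 -> ((x == - n%:Z) = false) * ((x == n%:Z + 1) = false) by split; lia.
have leN (x y : int) : x != y -> (y <= x) = ~~ (x <= y) by lia.
have ltN (x y : int) : x != y -> (y < x) = ~~ (x < y) by lia.
have le0 (x : int) : (1 <= x) = ~~ (x <= 0 :> int) by lia.
have leR (x : int) : - n%:Z < x < n%:Z + 1 -> ((n%:Z + 1 <= x) = false) * ((- n%:Z <= x) = true) by split; lia.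
move=> /bdry_specP[] x hx /bdry_specP[] y hy; rewrite -pair_eqE /= /crossing_parity /bottom /=;
rewrite ?eqxx ?nn ?nn' ?n1 ?n2 ?(inF _ hx) ?(inF _ hy) ?(inG _ hx) ?(inG _ hy)
  ?(leR _ hx) ?(leR _ hy) ?andbT ?le0 /= => // xy;
rewrite ?(ltN _ _ xy) ?(leN _ _ xy).
all: do ?[case: (_ <= _)%R | case: (_ < _)%R] => //=.
Qed.

Lemma below_far n c h z s : path adjacent z s -> all (in_box n) s ->
  [|| c < - n%:Z, n%:Z + 1 <= c | h <= 1 - n%:Z] -> path_parity (below c h) z s = false.
Proof.
move=> zs /allP sB ch; apply: path_parity_false => // u v _ /sB.
rewrite /in_box => vB _; apply/negP => /and3P[/eqP e l /orP[] /andP[/eqP e1 /eqP e2]]; lia.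
Qed.

Lemma below_all n c z s : path adjacent z s -> all (in_box n) s ->
  path_parity (below c n%:Z) z s = (z.1 <= c) (+) ((last z s).1 <= c).
Proof.
move=> zs /allP sB; rewrite -(path_parity_cut (fun y : site => y.1 <= c)).
apply: eq_path_parity => // u v _ /sB vB uv.
have {vB} : (u.2 == v.2) ==> (v.2 < n%:Z).
  by move: vB; rewrite /in_box => /andP[_ /andP[_ ->]]; rewrite implybT.
move: u v uv; apply: adjacent_ind => [u v IH uv|a b|a b _].
- by rewrite below_sym addbC IH// eq_sym; apply/implyP => /eqP E; move: uv; rewrite E eqxx.
- by rewrite eqxx /= below_horizontal => ->; rewrite andbT; lia.
- by rewrite below_vertical addbb.
Qed.

(** A boundary point with its unique neighbor in the box. *)
Variant inner_spec n : site -> site -> Prop :=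
  | InnerLeft b of - n%:Z < b < n%:Z : inner_spec n (- n%:Z, b) (1 - n%:Z, b)
  | InnerRight b of - n%:Z < b < n%:Z : inner_spec n (n%:Z + 1, b) (n%:Z, b)
  | InnerBottom a of - n%:Z < a < n%:Z + 1 : inner_spec n (a, - n%:Z) (a, 1 - n%:Z)
  | InnerTop a of - n%:Z < a < n%:Z + 1 : inner_spec n (a, n%:Z) (a, n%:Z - 1).

Lemma inner_specP n z w : bdry n z -> in_box n w -> adjacent w z -> inner_spec n z w.
Proof.
move=> /bdry_specP zb; case: w => c h; rewrite adjacentE /in_box /=.
case: zb => a ha /= wB /or4P[] /andP[/eqP e1 /eqP e2]; try (exfalso; lia).
- have -> : c = 1 - n%:Z by lia.
  by rewrite -e2; exact: InnerLeft.
- have -> : c = n%:Z by lia.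
  by rewrite -e2; exact: InnerRight.
- have -> : h = 1 - n%:Z by lia.
  by rewrite -e1; exact: InnerBottom.
- have -> : h = n%:Z - 1 by lia.
  by rewrite -e1; exact: InnerTop.
Qed.

Lemma crossb_inner n z w : (0 < n)%N -> inner_spec n z w -> crossb w z = false.
Proof. by move=> n0; case=> a ha; rewrite /crossb /=; lia. Qed.

Lemma column_bottom n z : (0 < n)%N -> bdry n z ->
  column 1 0 z (+) bottom n z 1 = bottom n z 0.
Proof.
move=> n0 /bdry_specP[] a ha; rewrite /column /bottom /=; [lia|lia| |lia].
rewrite eqxx (_ : - n%:Z < 0) ?andbT/=; last lia.
rewrite (_ : (a <= 1) = (a == 1) (+) (a <= 0)); last lia.
by case: (a == 1); case: (a <= 0).
Qed.

(** The side of the last point in the box, case by case over the side of the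
    box where the path ends. *)
Lemma side_inner n z1 z2 w s : (0 < n)%N -> bdry n z1 -> path adjacent z1 s ->
  last z1 s = origin -> all (in_box n) s -> inner_spec n z2 w ->
  z2 \notin z1 :: s -> w \notin z1 :: s ->
  side n z1 s w = bottom n z1 0 (+) ~~ crossing_parity n z1 z2.
Proof.
move=> n0 zb zs s0 sB zi z2s ws.
have w0 : w != origin by apply: contraNneq ws => ->; rewrite -s0 mem_last.
have nn : (- n%:Z == n%:Z) = false by lia.
have nn' : (n%:Z == - n%:Z) = false by lia.
have n1 : (n%:Z + 1 == - n%:Z) = false by lia.
have inF (x : int) : - n%:Z < x < n%:Z -> ((x == - n%:Z) = false) * ((x == n%:Z) = false).
  by split; lia.
case: zi z2s ws w0 => a ha z2s ws; rewrite /side /crossing_parity site_eqE /= => w0.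
- have := below_shift zs ws; have := below_shift zs z2s; rewrite s0.
  rewrite (below_far zs sB); last by apply/orP; left; lia.
  rewrite (_ : 1 - n%:Z - 1 = - n%:Z) ?addFb; last lia.
  move=> ->.
  have -> : column (- n%:Z) a origin = false by rewrite /column /=; lia.
  have -> : column (1 - n%:Z) a origin = false by rewrite /column /=; lia.
  have -> : column (1 - n%:Z) a z1 = bottom n z1 (1 - n%:Z).
    by rewrite /column /bottom; case/bdry_specP: zb => b hb /=; lia.
  have -> : (0 <= 1 - n%:Z) = false by lia.
  have -> : (1 - n%:Z == 0) && (a < 0) = false by lia.
  rewrite (inF _ ha) (inF _ ha) eqxx -/(column (- n%:Z) a z1).
  rewrite !addbF; case: (path_parity _ _ _); case: (column _ _ _); case: (bottom _ _ (1 - _)); case: (bottom _ _ 0) => //.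
- have := below_shift zs z2s; rewrite s0 addrK.
  rewrite (below_far zs sB (c := n%:Z + 1)) ?addbF; last by apply/orP; right; rewrite lexx.
  move=> ->.
  have -> : column (n%:Z + 1) a origin = false by rewrite /column /=; lia.
  have -> : bottom n z1 n%:Z = (z1.2 == - n%:Z).
    by rewrite /bottom; case/bdry_specP: zb => b hb /=; lia.
  have -> : (0 <= n%:Z) = true by lia.
  have -> : (n%:Z == 0) && (a < 0) = false by lia.
  rewrite (inF _ ha) (inF _ ha) n1 -/(column (n%:Z + 1) a z1).
  by case: (column _ _ _); case: (bottom _ _ _); case: (_ == _).
- rewrite (below_far zs sB); last by rewrite lexx !orbT.
  rewrite eqxx.
  have -> : (1 <= a) = (0 <= a) (+) ((a == 0) && (1 - n%:Z < 0)) by lia.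
  by case: (bottom _ _ a); case: (bottom _ _ 0); case: (0 <= a); case: (_ && _).
- have := below_up zs ws; rewrite subrK (below_all _ zs sB) s0 => <-.
  rewrite nn' eqxx.
  have -> : (a == 0) && (n%:Z - 1 < 0) = false by lia.
  by rewrite -[origin.1]/0; case: (bottom _ _ a); case: (bottom _ _ 0); case: (0 <= a); case: (_ <= _).
Qed.

(** After the edge, the path runs off its first part [z1 :: s], where crossing the
    zipper means changing sides ([side_path]).  The crossings of [z1 :: s] itself
    are counted together with the side of [site1] by [below_shift]. *)
Lemma path_crossing_parity n z1 z2 s t : (0 < n)%N -> bdry n z1 -> bdry n z2 ->
  path adjacent z1 (s ++ site1 :: rcons t z2) -> uniq (z1 :: s ++ site1 :: rcons t z2) ->
  last z1 s = origin -> all (in_box n) s -> all (in_box n) t ->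
  path_parity crossb z1 (s ++ site1 :: rcons t z2) = crossing_parity n z1 z2.
Proof.
move=> n0 zb1 zb2; rewrite cat_path -cat_cons cat_uniq => /andP[zs st] /and3P[us disj ut] s0 sB tB.
have nin v : v \in site1 :: rcons t z2 -> v \notin z1 :: s.
  by move=> vt; apply/negP => vs; move/hasPn: disj => /(_ v vt); rewrite /= vs.
have z2s : z2 \notin z1 :: s by apply: nin; rewrite inE mem_rcons mem_head orbT.
have z2B : ~~ in_box n z2 by case/bdryP: zb2.
have s1B : in_box n site1 by rewrite /in_box /=; lia.
move: st; rewrite s0 /= rcons_path => /andP[t1 tz2].
pose z' := last site1 t.
have z'B : in_box n z'.
  by rewrite /z'; case: (lastP t) tB => //= t' y; rewrite last_rcons all_rcons => /andP[].
have z's : z' \notin z1 :: s.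
  apply: nin; rewrite -rcons_cons mem_rcons inE; apply/orP; right; exact: mem_last.
rewrite path_parity_cat s0 /= -cats1 path_parity_cat -/z' /= addbF.
rewrite (side_path zb1 zs s0 s1B tB t1); last first.
  move=> v vt; apply: nin; rewrite -rcons_cons mem_rcons inE; apply/orP; right; exact: vt.
have zi := inner_specP zb2 z'B tz2.
rewrite (crossb_inner n0 zi) addbF.
have -> : path_parity crossb z1 s = path_parity (below 0 0) z1 s.
  by apply: eq_path_parity => // y z _ _ _; exact: crossb_below.
have s1s : ((1 : int), (0 : int)) \notin z1 :: s by apply: nin; exact: mem_head.
have := below_shift zs s1s; rewrite s0 subrr addbF => E0.
have -> : side n z1 s site1 =
  path_parity (below 1 0) z1 s (+) bottom n z1 1 (+) true (+) false by [].
rewrite (side_inner n0 zb1 zs s0 sB zi z2s z's) -(column_bottom n0 zb1) -E0 addbF.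
by case: (path_parity (below 0 0) _ _); case: (path_parity (below 1 0) _ _);
  case: (bottom _ _ _); case: (crossing_parity _ _ _).
Qed.

End Parity.

(** * Unrooted and rooted loops *)

Section Loops.
Implicit Types (l s t : seq site) (x y z : site) (L : uloop).

(** A rooted loop is determined by the list of its vertices after the root; on
    such lists, changing the root is a rotation. *)
Definition close_loop s : seq site := last origin s :: s.

Lemma rooted_loopP l : rooted_loop l /\ (0 < nsteps l)%N <->
  exists s, [/\ s != [::], path adjacent (last origin s) s & l = close_loop s].
Proof.
split=> [[[]]|[s [s0 sp ->]]].
  case: l => //= x s xs ls; rewrite /nsteps /= => s0; exists s.
  have sN : s != [::] by case: (s) s0.
  have lx : last origin s = x.
    by rewrite ls /nsteps /= -last_nth0; case: (s) sN.
  by split; rewrite // /close_loop lx.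
have sz : (0 < size s)%N by case: (s) s0.
split; last by [].
split; first by [].
by rewrite /nsteps /close_loop -last_nth0; case: (s) sz.
Qed.

Lemma path_cycle s : path adjacent (last origin s) s = cycle adjacent s.
Proof.
case: s => [//|x s] /=; rewrite rcons_path; case: (lastP s) => [|s' y] /=.
  by rewrite andbT.
by rewrite last_rcons andbC.
Qed.

Lemma reroot_close j s : (j <= size s)%N -> reroot j (close_loop s) = close_loop (rot j s).
Proof.
rewrite /reroot /close_loop /= /rot; case: j => [|j] js; first by rewrite !drop0 !take0 !cats0.
rewrite -[drop j.+1 (_ :: _)]/(drop j s) (drop_nth origin js) cat_cons; congr (_ :: _).
rewrite last_cat (take_nth origin)//.
by rewrite last_rcons.
Qed.

Lemma loop_class_close s : loop_class (close_loop s) =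
  [set close_loop (rot j s) | j in [set j | (j <= size s)%N]].
Proof.
rewrite /loop_class; apply/seteqP; split => l /= [j js <-].
  by exists j => //; rewrite reroot_close.
by exists j => //; rewrite reroot_close.
Qed.

Lemma loop_class_rot j s : (j <= size s)%N ->
  loop_class (close_loop (rot j s)) = loop_class (close_loop s).
Proof.
have sub i t : (i <= size t)%N -> loop_class (close_loop (rot i t)) `<=` loop_class (close_loop t).
  rewrite !loop_class_close => it l /= [k kt <-]; rewrite size_rot in kt.
  rewrite rot_add_mod// ; exists (if k + i <= size t then k + i else k + i - size t)%N => //=.
  by case: ifP => //; lia.
move=> js; apply/seteqP; split; first exact: sub.
have := @sub (size s - j)%N (rot j s); rewrite size_rot leq_subr => /(_ isT).
by have := rotK j s; rewrite /rotr size_rot => ->.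
Qed.

Lemma unrooted_loop_class L l : unrooted_loop L -> L l -> L = loop_class l.
Proof.
move=> [l0 [r0 n0 ->]]; have [s [s0 sp ->]] := (rooted_loopP l0).1 (conj r0 n0).
by rewrite loop_class_close => -[j js <-]; rewrite -loop_class_close loop_class_rot.
Qed.

Lemma unrooted_loop_rooted L l : unrooted_loop L -> L l -> rooted_loop l /\ (0 < nsteps l)%N.
Proof.
move=> [l0 [r0 n0 ->]]; have [s [s0 sp ->]] := (rooted_loopP l0).1 (conj r0 n0).
rewrite loop_class_close => -[j js <-]; apply/rooted_loopP; exists (rot j s); split => //.
  by rewrite -size_eq0 size_rot size_eq0.
by rewrite path_cycle rot_cycle -path_cycle.
Qed.

Lemma loop_class_refl l : rooted_loop l -> loop_class l l.
Proof. by move=> _; exists 0%N => //; rewrite /reroot drop0 take0 cats0. Qed.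

Lemma representativeP L : unrooted_loop L -> L (representative L).
Proof.
move=> [l [r n0 LE]]; apply: (xgetPex [::] (P := L)); exists l; rewrite LE; exact: loop_class_refl.
Qed.

Lemma finite_loop_class l : finite_set (loop_class l).
Proof.
apply: finite_image; apply: sub_finite_set (finite_II (nsteps l).+1) => j /=.
by rewrite ltnS.
Qed.

(** Two rooted loops of the same class differ by a rotation. *)
Lemma loop_class_ind (K : seq site -> seq site -> Prop) L l l' :
  (forall s j, (j <= size s)%N -> path adjacent (last origin s) s -> s != [::] ->
     K (close_loop s) (close_loop (rot j s))) ->
  unrooted_loop L -> L l -> L l' -> K l l'.
Proof.
move=> H uL Ll Ll'; have [r n0] := unrooted_loop_rooted uL Ll.
have LE := unrooted_loop_class uL Ll; move: Ll'; rewrite LE.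
have [s [s0 sp ->]] := (rooted_loopP l).1 (conj r n0).
by rewrite loop_class_close => -[j js <-]; exact: H.
Qed.

Lemma nsteps_root L l l' : unrooted_loop L -> L l -> L l' -> nsteps l = nsteps l'.
Proof.
apply: (loop_class_ind (K := fun l l' => nsteps l = nsteps l')) => s j _ _ _.
by rewrite /nsteps /= size_rot.
Qed.

Lemma mem_close_loop s z : s != [::] -> (z \in close_loop s) = (z \in s).
Proof.
case: s => // x s _; rewrite /close_loop in_cons; case: eqP => // ->.
by rewrite (mem_last x s).
Qed.

Lemma mem_root L l l' z : unrooted_loop L -> L l -> L l' -> (z \in l) = (z \in l').
Proof.
apply: (loop_class_ind (K := fun l l' => (z \in l) = (z \in l'))) => s j _ _ s0.
by rewrite !mem_close_loop ?mem_rot// -size_eq0 size_rot size_eq0.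
Qed.

Lemma odd_crossings x s : odd (crossings (x :: s)) = path_parity crossb x s.
Proof.
elim: s x => [|y s IH] x; first by rewrite /crossings big_ord0.
rewrite /crossings /nsteps /= big_ord_recl oddD -/(nsteps (y :: s)); congr (_ (+) _).
  by rewrite crossingE /= oddb.
rewrite -IH /crossings; congr odd; apply: eq_bigr => i _; by [].
Qed.

Lemma path_parity_rot j s : (j <= size s)%N ->
  path_parity crossb (last origin (rot j s)) (rot j s) = path_parity crossb (last origin s) s.
Proof.
move=> js; rewrite -{3 4}(cat_take_drop j s) /rot !path_parity_cat addbC !last_cat.
case: (posnP j) => [->|j0]; first by rewrite take0 drop0 /=.
have tN : take j s != [::] by rewrite -size_eq0 size_takel// -lt0n.
have lt a b : last a (take j s) = last b (take j s) by case: (take j s) tN.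
case: (ltnP j (size s)) => [js'|sj]; last first.
  by rewrite drop_oversize//= (lt origin (last origin [::])).
have dN : drop j s != [::] by rewrite -size_eq0 size_drop -lt0n subn_gt0.
have ld a b : last a (drop j s) = last b (drop j s) by case: (drop j s) dN.
by congr (path_parity _ _ _ (+) path_parity _ _ _); [exact: ld|exact: lt].
Qed.

Lemma odd_crossings_root L l l' : unrooted_loop L -> L l -> L l' ->
  odd (crossings l) = odd (crossings l').
Proof.
apply: (loop_class_ind (K := fun l l' => odd (crossings l) = odd (crossings l'))).
by move=> s j js _ _; rewrite !odd_crossings path_parity_rot.
Qed.

Lemma Jcount_odd L l : unrooted_loop L -> L l -> odd (Jcount L) = odd (crossings l).
Proof. by move=> uL Ll; apply: (odd_crossings_root uL) => //; exact: representativeP. Qed.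

End Loops.

Section LoopMass.
Variable R : realType.
Implicit Types (l s t : seq site) (x y z : site) (L : uloop) (B : {fset site}).

(** The share of each rooted loop of a class in its loop measure. *)
Definition rooted_measure l : R := 4 ^- nsteps l / (nsteps l)%:R.

Lemma rooted_measure_ge0 l : 0 <= rooted_measure l.
Proof. by rewrite mulr_ge0// ?invr_ge0// exprn_ge0. Qed.

Lemma loop_measure_class L : unrooted_loop L ->
  ((loop_measure R L)%:E = \esum_(l in L) (rooted_measure l)%:E)%E.
Proof.
move=> uL; have fL : finite_set L by have [l [_ _ ->]] := uL; exact: finite_loop_class.
rewrite (eq_esum (b := fun=> (rooted_measure (representative L))%:E)); last first.
  move=> l Ll; rewrite /rooted_measure.
  by rewrite (nsteps_root uL Ll (representativeP uL)).
rewrite -{2}(fset_setK fL) esum_seq//; last by move=> _; exact: rooted_measure_ge0.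
congr EFin; rewrite big_const_seq count_predT iter_addr addr0.
by rewrite /loop_measure /rooted_measure /loop_length -[RHS]mulr_natr mulrAC.
Qed.

Lemma loop_mass_rooted (D : set uloop) : D `<=` unrooted_loop ->
  (loop_mass R D = \esum_(l in \bigcup_(L in D) L) (rooted_measure l)%:E)%E.
Proof.
move=> DU; rewrite /loop_mass.
rewrite (@reindex_esum R _ _ (D `*`` (fun L : uloop => L)) _ snd); last first.
  split.
  - by move=> [L l] [/= DL Ll]; exists L.
  - move=> [L l] [L' l']; rewrite !inE => -[/= DL Ll] [/= DL' L'l'] E.
    rewrite -E in L'l' *; congr pair.
    by rewrite (unrooted_loop_class (DU _ DL) Ll) (unrooted_loop_class (DU _ DL') L'l').
  - by move=> l [L DL Ll]; exists (L, l).
rewrite -(@esum_esum R _ _ D (fun L : uloop => L) (fun _ l => (rooted_measure l)%:E)); last first.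
  by move=> L l _ _; rewrite lee_fin rooted_measure_ge0.
by apply: eq_esum => L DL; rewrite loop_measure_class//; exact: DU.
Qed.

Definition rooted_loops B (b : bool) : set (seq site) :=
  [set l | [/\ rooted_loop l, (0 < nsteps l)%N, all (mem B) l & odd (crossings l) = b]].

Lemma path_weight_zipped x s : path_weight (zipped R) x s =
  (-1) ^+ path_parity crossb x s * path_weight (srw R) x s.
Proof.
elim: s x => [|y s IH] x /=; first by rewrite mulr1.
by rewrite IH /zipped signr_addb; ring.
Qed.

Lemma path_weight_srw x s : path_weight (srw R) x s =
  if path adjacent x s then 4 ^- size s else 0.
Proof.
elim: s x => [|y s IH] x /=; first by rewrite expr0 invr1.
rewrite IH /srw; case: adjacent => /=; last by rewrite mul0r.
by case: path; rewrite ?mulr0// exprS invfM.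
Qed.

Lemma sum_words_trace (Q : site -> site -> R) B k :
  \sum_(t <- words B k.+1) path_weight Q (last origin t) t = trace_weight Q B k.+1.
Proof.
rewrite /trace_weight; under [RHS]eq_bigr do rewrite -sum_words_walk.
rewrite exchange_big; apply: eq_big_seq => t; rewrite mem_words.
case: t => [//|y t] /andP[_ /= /andP[yB tB]].
have lB : last y t \in B by case: (lastP t) tB => //= t' z; rewrite last_rcons all_rcons => /andP[].
rewrite (big_fsetD1 _ lB)/= eqxx mul1r big1_seq ?addr0// => z /=.
by rewrite !inE eq_sym => /andP[/negPf-> _]; rewrite mul0r.
Qed.

(** Adding or subtracting the two families of weights selects a parity. *)
Lemma esum_rooted_loops n B b : (B `<=` boxf n)%fset ->
  (\esum_(l in rooted_loops B b) (rooted_measure l)%:E =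
   ((loop_sum (srw R) B + (-1) ^+ b * loop_sum (zipped R) B) / 2)%:E)%E.
Proof.
move=> sB; have cp := contracting_srw_sub R sB; have cq := contracting_zipped R sB.
pose f s : R := (path_weight (srw R) (last origin s) s
  + (-1) ^+ b * path_weight (zipped R) (last origin s) s) / 2 / (size s)%:R.
have fE s : f s = if path_parity crossb (last origin s) s == b then
    path_weight (srw R) (last origin s) s / (size s)%:R else 0.
  rewrite /f path_weight_zipped mulrA -signr_addb; case: eqP => [->|/eqP ne].
    by rewrite addbb mul1r; congr (_ / _); lra.
  by rewrite (_ : b (+) _ = true) ?expr1 ?mulN1r ?subrr ?mul0r//; case: b ne {f}; case: path_parity.
rewrite -(@esum_words R _ B f); first last.
- have -> : series (fun k => \sum_(t <- words B k) f t) = (fun n =>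
      (series (fun k => trace_weight (srw R) B k / k%:R) n +
      (-1) ^+ b * series (fun k => trace_weight (zipped R) B k / k%:R) n) / 2).
    apply/funext => m; rewrite /series/= mulr_sumr -big_split/= mulr_suml.
    apply: eq_bigr => -[|k] _; first by rewrite big_seq1 /f /= invr0 !mulr0 addr0 mul0r.
    rewrite -!sum_words_trace !mulr_suml mulr_sumr -big_split mulr_suml.
    apply: eq_big_seq => t; rewrite mem_words => /andP[/eqP st _]; rewrite /f st.
    by rewrite /= -mulrA [2^-1 * _]mulrC mulrA mulrDl mulrA.
  apply: cvgM; last exact: cvg_cst.
  apply: cvgD; first exact: loop_sum_cvg.
  by apply: cvgM; [exact: cvg_cst|exact: loop_sum_cvg].
- move=> s; rewrite fE; case: ifP => // _; rewrite mulr_ge0 ?invr_ge0//.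
  by apply: path_weight_ge0 => *; exact: srw_ge0.
have -> : rooted_loops B b = close_loop @` [set s | [/\ s != [::],
    path adjacent (last origin s) s, all (mem B) s & path_parity crossb (last origin s) s = b]].
  apply/seteqP; split => l /=.
    move=> [r n0 lB lb]; have [s [s0 sp lE]] := (rooted_loopP l).1 (conj r n0).
    exists s; last by []; split => //; first by move: lB; rewrite lE /= => /andP[].
    by rewrite -odd_crossings -lb lE.
  move=> [s [s0 sp sB' sb] <-].
  have [r n0] := (rooted_loopP _).2 (ex_intro _ s (And3 s0 sp (erefl _))).
  split => //; last by rewrite odd_crossings.
  apply/allP => z; rewrite mem_close_loop//; exact: (allP sB').
rewrite esum_image; last by move=> s t _ _ [].
rewrite (eq_esum (b := fun s => (f s)%:E)).
  apply: esum_eq_support => s /= [] // sB' ns; rewrite fE; case: eqP => // pb.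
  rewrite path_weight_srw; case: ifP => sp; last by rewrite mul0r.
  by case: s sB' ns pb sp => [|y s] sB' ns pb sp; [rewrite invr0 mulr0|case: ns; split].
move=> s [s0 sp sB' sb]; rewrite fE sb eqxx path_weight_srw sp.
by rewrite /rooted_measure /nsteps.
Qed.

(** The odd loops are those whose weight changes sign with the zipper. *)
Lemma loop_mass_odd n : loop_mass R (odd_loops (box n)) =
  ((loop_sum (srw R) (boxf n) - loop_sum (zipped R) (boxf n)) / 2)%:E.
Proof.
rewrite loop_mass_rooted; last by move=> L [[]].
transitivity (\esum_(l in rooted_loops (boxf n) true) (rooted_measure l)%:E)%E; last first.
  by rewrite (@esum_rooted_loops n)// expr1 mulN1r.
congr esum; apply/seteqP; split => l /=.
  move=> [L [[uL LB] oL] Ll]; have [r n0] := unrooted_loop_rooted uL Ll.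
  split => //; last by rewrite -(Jcount_odd uL Ll).
  by apply/allP => z zl; rewrite /= in_boxf; apply: LB; exists l.
move=> [r n0 lB lo]; have uL : unrooted_loop (loop_class l) by exists l.
have Ll := loop_class_refl r; exists (loop_class l) => //; split; last by rewrite /= (Jcount_odd uL Ll).
split => // z [l' l'L zl']; have := allP lB z; rewrite /= in_boxf; apply.
by rewrite (mem_root z uL Ll l'L).
Qed.

Definition loops_through n (V : seq site) : set uloop :=
  [set L | loops_in (box n) L /\ loop_vertices L `&` [set` V] !=set0].

Lemma esum_rooted_through n V b :
  (\esum_(l in \bigcup_(L in loops_through n V `&` [set L | odd (Jcount L) = b]) L)
     (rooted_measure l)%:E =
   ((loop_sum (srw R) (boxf n) + (-1) ^+ b * loop_sum (zipped R) (boxf n)) / 2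
  - (loop_sum (srw R) (fset_remove (boxf n) V)
     + (-1) ^+ b * loop_sum (zipped R) (fset_remove (boxf n) V)) / 2)%:E)%E.
Proof.
pose C := fset_remove (boxf n) V.
have E := @esum_rooted_loops n (boxf n) b (fsubset_refl _).
have E' := @esum_rooted_loops n C b (fset_remove_sub _ _).
rewrite (esumID (rooted_loops C b)) in E; last by move=> *; rewrite lee_fin rooted_measure_ge0.
have sub : rooted_loops C b `<=` rooted_loops (boxf n) b.
  move=> l [r n0 lC lb]; split => //; apply/allP => z /(allP lC) /=.
  by rewrite in_fset_remove => /andP[].
rewrite setIC (setIidl sub) E' in E.
rewrite EFinB -E addeAC subee// add0e; congr esum; apply/seteqP; split => l /=.
  move=> [L [[[uL LB] [v [[l' Ll' vl'] vV]]] oL] Ll]; have [r n0] := unrooted_loop_rooted uL Ll.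
  split; first split => //.
  - by apply/allP => z zl; rewrite /= in_boxf; apply: LB; exists l.
  - by rewrite -(Jcount_odd uL Ll).
  - move=> [_ _ /allP/(_ v) + _]; rewrite (mem_root v uL Ll Ll') => /(_ vl') /=.
    by rewrite in_fset_remove; move: vV => /= ->; rewrite andbF.
move=> [[r n0 lB lo] nC]; have uL : unrooted_loop (loop_class l) by exists l.
have Ll := loop_class_refl r; exists (loop_class l) => //; split; last by rewrite /= (Jcount_odd uL Ll).
split; first split => //.
  move=> z [l' l'L zl']; have := allP lB z; rewrite /= in_boxf; apply.
  by rewrite (mem_root z uL Ll l'L).
have [/hasP[v vl vV]|/hasPn H] := boolP (has (mem V) l).
  by exists v; split; [exists l|].
exfalso; apply: nC; split => //; apply/allP => z zl /=; rewrite in_fset_remove.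
by have /= -> := allP lB z zl; exact: H.
Qed.

(** The positive and negative parts of the signed measure are the even and the
    odd loops; for each parity, the loops that meet [V] are those of the box
    minus those of the box without [V]. *)
Lemma signed_sum_loops n V : signed_sum (loops_through n V)
    (fun L => loop_measure R L * (-1) ^+ Jcount L) =
  (loop_sum (zipped R) (boxf n) - loop_sum (zipped R) (fset_remove (boxf n) V))%:E.
Proof.
have lm0 L : 0 <= loop_measure R L by rewrite !mulr_ge0 ?invr_ge0 ?exprn_ge0.
have part (b : bool) : (\esum_(L in loops_through n V)
    (Num.max ((-1) ^+ b * (loop_measure R L * (-1) ^+ Jcount L)) 0)%:E =
    \esum_(l in \bigcup_(L in loops_through n V `&` [set L | odd (Jcount L) = b]) L)
     (rooted_measure l)%:E)%E.
  rewrite -loop_mass_rooted; last by move=> L [[[]]].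
  rewrite /loop_mass [RHS]esum_mkcondr; apply: eq_esum => L _.
  rewrite mulrCA -[(-1) ^+ Jcount L]signr_odd -signr_addb.
  have [E|E] := pselect (odd (Jcount L) = b).
    by rewrite mem_set// E addbb mulr1; congr EFin; apply/max_idPl.
  rewrite memNset// (_ : b (+) _ = true); last by case: b E; case: odd.
  by rewrite expr1 mulrN1; congr EFin; apply/max_idPr; rewrite oppr_le0.
have := part false; have := part true; rewrite /signed_sum.
under eq_esum do rewrite expr1 mulN1r.
under [in X in _ -> X -> _]eq_esum do rewrite mul1r.
move=> -> ->; rewrite !esum_rooted_through -EFinB; congr EFin.
by rewrite expr0 expr1; field.
Qed.

End LoopMass.

(** * Walks with a given loop erasure *)

Section ErasedWalks.
Variable R : realType.
Implicit Types (Q : site -> site -> R) (B : {fset site}) (x y z b : site) (l r s t u w : seq site).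

Lemma split_last_visit x u : exists l r, [/\ u = l ++ r, last x l = x & x \notin r].
Proof.
elim/last_ind: u => [|u y [l [r [-> lx xr]]]]; first by exists [::], [::].
have [->|yx] := eqVneq y x.
  by exists (rcons (l ++ r) x), [::]; rewrite cats0 last_rcons.
exists l, (rcons r y); rewrite rcons_cat; split => //.
by rewrite mem_rcons inE negb_or eq_sym yx.
Qed.

Lemma split_last_visit_inj x l l' r r' : last x l = x -> last x l' = x ->
  x \notin r -> x \notin r' -> l ++ r = l' ++ r' -> l = l' /\ r = r'.
Proof.
wlog le : l l' r r' / (size l <= size l')%N.
  move=> H lx l'x xr xr' E; case/orP: (leq_total (size l) (size l')) => le.
    exact: H.
  by have [-> ->] := H l' l r' r le l'x lx xr' xr (esym E).
move=> lx l'x xr xr' E.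
have El : l' = l ++ drop (size l) l'.
  rewrite -{1}(cat_take_drop (size l) l'); congr (_ ++ _).
  have := congr1 (take (size l)) E; rewrite take_size_cat// takel_cat// => {1}->.
move: E l'x; rewrite El last_cat lx -catA => /eqP; rewrite eqseq_cat// eqxx /= => /eqP Er.
case: (drop _ _) Er => [|y m] Er; first by rewrite cats0 Er.
by move=> /= ym; move: xr; rewrite Er mem_cat -ym mem_last.
Qed.

Lemma loop_erasure_head y s : exists s', loop_erasure (y :: s) = y :: s'.
Proof.
have [l [[|z r] [-> ly yr]]] := split_last_visit y s.
  by rewrite cats0 loop_erasure_loop//; exists [::].
by rewrite loop_erasure_cons//; exists (loop_erasure (z :: r)).
Qed.

(** A walk from [x] whose erasure continues with [y] is a loop at [x] in [B], up to
    the last visit to [x], then a step to [y] and a walk in [B] without [x]. *)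
Lemma esum_loop_erasure Q B x t b : (forall x y, 0 <= Q x y) -> contracting Q B ->
  b \notin B -> uniq (x :: t) -> all (mem B) (x :: t) ->
  (\esum_(u in [set u | all (mem B) u /\ loop_erasure (x :: rcons u b) = x :: rcons t b])
     (path_weight Q x (rcons u b))%:E =
   (path_weight Q x (rcons t b) * erasure_weight Q B (x :: t))%:E)%E.
Proof.
move=> Q0; elim: t B x => [|y t IH] B x cQ bB.
  move=> _ /= /andP[xB _]; rewrite !mulr1.
  have xb : x \notin [:: b] by rewrite inE; apply: contraNneq bB => <-.
  have -> : [set u | all (mem B) u /\ loop_erasure (x :: rcons u b) = [:: x; b]] =
      [set u | all (mem B) u && (last x u == x)].
    apply/seteqP; split => u /=; last first.
      move=> /andP[uB /eqP lu]; split => //.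
      by rewrite -cats1 loop_erasure_cons// (loop_erasure_loop (l := [::])).
    move=> [uB]; have [l [r [uE lx xr]]] := split_last_visit x u.
    rewrite uB; case: r uE xr => [|z r] uE xr; first by rewrite uE cats0 lx eqxx.
    rewrite uE rcons_cat rcons_cons loop_erasure_cons//; last first.
      by move: xr xb; rewrite !inE mem_rcons inE !negb_or => /andP[-> ->] ->.
    have [s' ->] := loop_erasure_head z (rcons r b) => -[zb _].
    by move: uB; rewrite uE all_cat /= zb (negPf bB) andbF.
  rewrite (eq_esum (b := fun u => ((Q x b)%:E * (path_weight Q x u)%:E)%E)); last first.
    by move=> u /= /andP[_ /eqP lu]; rewrite path_weight_rcons lu -EFinM mulrC.
  rewrite esumZl//; last by move=> u _; rewrite lee_fin path_weight_ge0.
  by rewrite esum_green// -EFinM.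
move=> /= /andP[xyt uyt] /and3P[xB yB tB].
have cQ' := contracting_sub (fsubD1set B x) cQ; set B' := (B `\ x)%fset in cQ' *.
have bB' : b \notin B' by rewrite !inE (negPf bB) andbF.
have ytB' : all (mem B') (y :: t).
  apply/allP => z zt; rewrite /= !inE; apply/andP; split; first by apply: contraNneq xyt => <-.
  by move: zt; rewrite inE => /orP[/eqP->//|/(allP tB)].
have xb : x != b by apply: contraNneq bB => <-.
pose W := [set l | all (mem B) l && (last x l == x)].
pose E' := [set u | all (mem B') u /\ loop_erasure (y :: rcons u b) = y :: rcons t b].
have nx u : all (mem B') u -> x \notin y :: u.
  move=> uB'; rewrite inE negb_or; apply/andP; split.
    by move: xyt; rewrite inE negb_or => /andP[].
  by apply/negP => /(allP uB'); rewrite /= !inE eqxx.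
have nxb u : all (mem B') u -> x \notin y :: rcons u b.
  by move=> /nx; rewrite -rcons_cons mem_rcons !inE (negPf xb).
have -> : [set u | all (mem B) u /\ loop_erasure (x :: rcons u b) = [:: x, y & rcons t b]] =
    (fun p => p.1 ++ y :: p.2) @` (W `*`` (fun=> E')).
  apply/seteqP; split => u /=.
    move=> [uB]; have [l [r [uE lx xr]]] := split_last_visit x u.
    move: (uB); rewrite uE all_cat => /andP[lB rB]; case: r uE xr rB => [|z r] uE xr rB.
      rewrite cats0 -cats1 loop_erasure_cons ?inE//.
      by rewrite (loop_erasure_loop (l := [::]))//; case: (t).
    rewrite rcons_cat rcons_cons loop_erasure_cons//; last first.
      by move: xr; rewrite !inE mem_rcons inE !negb_or => /andP[-> ->]; rewrite xb.
    have [s' E] := loop_erasure_head z (rcons r b).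
    move=> /eqP; rewrite eqseq_cons eqxx andTb => /eqP E2; have zy : z = y by move: E2; rewrite E => -[].
    rewrite zy in uE xr rB E2 *; exists (l, r) => //; split; first by rewrite /W /= lB lx eqxx.
    split => //; apply/allP => v vr; rewrite /= !inE; apply/andP; split.
      by apply: contraNneq xr => <-; rewrite inE vr orbT.
    by move: rB => /= /andP[_ /allP]; apply.
  move=> [[l r] [/= /andP[lB /eqP lx] [rB' rE]] <-]; split.
    rewrite all_cat lB /= yB; apply/allP => v /(allP rB') /=.
    by rewrite !inE => /andP[].
  by rewrite rcons_cat rcons_cons loop_erasure_cons ?rE//; exact: nxb.
rewrite esum_image; last first.
  move=> [l r] [l' r']; rewrite !inE => -[/= /andP[_ /eqP lx] [rB _]] [/= /andP[_ /eqP l'x] [r'B _]] E.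
  by have [-> [->]] := split_last_visit_inj lx l'x (nx _ rB) (nx _ r'B) E.
rewrite -(@esum_esum R _ _ W (fun=> E') (fun l r => (path_weight Q x (rcons (l ++ y :: r) b))%:E)); last first.
  by move=> l r _ _; rewrite lee_fin path_weight_ge0.
rewrite (eq_esum (b := fun l => ((Q x y * (path_weight Q y (rcons t b) * erasure_weight Q B' (y :: t)))%:E
    * (path_weight Q x l)%:E)%E)).
  rewrite esumZl; first by rewrite esum_green// -EFinM; congr EFin; rewrite /= -/B'; ring.
  - rewrite mulr_ge0// -lee_fin -IH//; apply: esum_ge0 => u _.
    by rewrite lee_fin path_weight_ge0.
  - by move=> l _; rewrite lee_fin path_weight_ge0.
move=> l /= /andP[_ /eqP lx].
rewrite EFinM -IH// -muleA [(_ * (path_weight _ _ _)%:E)%E]muleC muleA -EFinM -esumZl.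
- apply: eq_esum => r _; rewrite -EFinM; congr EFin.
  by rewrite rcons_cat rcons_cons path_weight_cat lx /=; ring.
- by rewrite mulr_ge0// path_weight_ge0.
- by move=> r _; rewrite lee_fin path_weight_ge0.
Qed.

Lemma KpathsP n z1 z2 w : z1 != z2 -> Kpaths n z1 z2 w <->
  exists v, [/\ w = z1 :: rcons v z2, path adjacent z1 (rcons v z2) & all (in_box n) v].
Proof.
move=> z12; split => [[]|[v [-> vp vB]]].
  case: w => // a s + /= az; rewrite {}az => sp + H; rewrite /nsteps /= -last_nth0.
  case/lastP: s sp H => [|v b] sp H; first by move=> /= E; rewrite E eqxx in z12.
  rewrite last_rcons => E; exists v; split => //; rewrite -?E//.
  apply/(all_nthP 0) => i iv.
  have := H i.+1; rewrite /nsteps /= size_rcons !ltnS iv => /(_ isT).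
  by rewrite nth_rcons iv.
split => //.
- by rewrite /nsteps /= -last_nth0 last_rcons.
- move=> [//|j]; rewrite /nsteps /= size_rcons ltnS => jv.
  by rewrite nth_rcons jv; exact: (all_nthP 0 vB).
Qed.

Lemma phat_erasure_weight n z1 z2 x t : z1 != z2 -> bdry n z1 -> bdry n z2 ->
  uniq (x :: t) -> all (in_box n) (x :: t) ->
  phat R n z1 z2 (z1 :: x :: rcons t z2) =
  (srw R z1 x * path_weight (srw R) x (rcons t z2) * erasure_weight (srw R) (boxf n) (x :: t))%:E.
Proof.
move=> z12 /bdryP[z1B _] /bdryP[z2B _] uxt xtB.
have boxE u : all (mem (boxf n)) u = all (in_box n) u.
  by apply: eq_all => v /=; rewrite in_boxf.
rewrite -mulrA EFinM -esum_loop_erasure; first last.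
- by rewrite boxE.
- by [].
- by rewrite in_boxf.
- exact: contracting_srw.
- exact: srw_ge0.
rewrite -esumZl ?srw_ge0//; last by move=> *; rewrite lee_fin path_weight_ge0//; exact: srw_ge0.
pose g u := z1 :: x :: rcons u z2.
pose f w := (path_weight (srw R) z1 (behead w))%:E.
rewrite (eq_esum (b := fun u => f (g u))); last by move=> u _; rewrite -EFinM.
rewrite -(@esum_image R _ _ _ g f); last first.
  by move=> u v _ _ [/eqP]; rewrite eqseq_rcons eqxx andbT => /eqP.
rewrite /phat (eq_esum (b := f)).
  apply: esum_eq_support => w /=.
    move=> [/(KpathsP _ _ z12)[[|x' u] [-> vp vB]] LE].
      move: LE; rewrite /= (loop_erasure_cons (l := [::])) ?inE//.
      by rewrite (loop_erasure_loop (l := [::]))//; case: (t).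
    move: LE; rewrite rcons_cons (loop_erasure_cons (l := [::]))//; last first.
      rewrite -rcons_cons mem_rcons inE negb_or z12 /=.
      by apply/negP => /(allP vB); exact/negP.
    have [s' E] := loop_erasure_head x' (rcons u z2).
    move=> /eqP; rewrite eqseq_cons eqxx andTb => /eqP LE; have xx : x' = x by move: LE; rewrite E => -[].
    rewrite xx in vB LE *; exists u => //; split; last by [].
    by rewrite boxE; move: vB => /= /andP[].
  move=> [u [uB LE] <-] nS; rewrite /f /g /=; congr EFin.
  rewrite -[LHS]/(path_weight (srw R) z1 (x :: rcons u z2)) path_weight_srw; case: ifP => // vp.
  exfalso; apply: nS; split.
    apply/KpathsP => //; exists (x :: u); split => //=.
    by rewrite -boxE uB andbT; move: xtB => /= /andP[].
  rewrite /g (loop_erasure_cons (l := [::])) ?LE//.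
  rewrite -rcons_cons mem_rcons inE negb_or z12 /= inE negb_or; apply/andP; split.
    by apply: contraNneq z1B => ->; move: xtB => /= /andP[].
  by apply/negP => /(allP uB); rewrite /= in_boxf; exact/negP.
move=> w [/(KpathsP _ _ z12)[v [-> vp vB]] _].
by rewrite /f /= path_weight_srw vp /weight /nsteps.
Qed.

End ErasedWalks.

(** * The marked edge *)

Section MarkedEdge.
Variable R : realType.
Implicit Types (a b x y z u v : site) (s t w : seq site).

Lemma origin_in_box n : (0 < n)%N -> in_box n origin.
Proof. by rewrite /in_box /=; lia. Qed.

Lemma site1_in_box n : (0 < n)%N -> in_box n site1.
Proof. by rewrite /in_box /=; lia. Qed.

Lemma infix2_index a b w : uniq w -> infix [:: a; b] w -> index b w = (index a w).+1.
Proof.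
move=> + /infixP[p [q wE]]; rewrite wE cat_uniq /= => /and3P[_ ap /and3P[ab _ _]].
move: ab; rewrite inE negb_or => /andP[ab _]; move: ap; rewrite !negb_or => /and3P[ap bp _].
by rewrite !index_cat (negPf ap) (negPf bp) /= !eqxx (negPf ab) addn0 addn1.
Qed.

Lemma infix2_asym a b w : uniq w -> infix [:: a; b] w -> ~~ infix [:: b; a] w.
Proof.
move=> uw ab; apply/negP => ba.
by have := infix2_index uw ab; rewrite (infix2_index uw ba); lia.
Qed.

Lemma path_sum_edge_sign a b x s : uniq (x :: s) ->
  path_sum (edge_sign R a b) x s =
  (infix [:: a; b] (x :: s))%:R - (infix [:: b; a] (x :: s))%:R.
Proof.
elim: s x => [|y s IH] x; first by move=> _; rewrite !infixs1 /= !eqseq_cons !andbF subrr.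
move=> /andP[xs us]; rewrite [LHS]/= IH//.
have step c d : (infix [:: c; d] [:: x, y & s])%:R =
    ((x == c) && (y == d))%:R + (infix [:: c; d] (y :: s))%:R :> R.
  rewrite infix_consl [prefix _ _]/= prefix0s andbT [c == x]eq_sym [d == y]eq_sym.
  case: (x =P c) => [E|_]; last by rewrite add0r.
  have -> : infix [:: c; d] (y :: s) = false.
    apply: contraNF xs => /infixP[p [q ->]]; rewrite -E.
    by rewrite mem_cat inE eqxx orbT.
  by rewrite orbF addr0.
by rewrite !step /edge_sign; ring.
Qed.

Lemma infix2_split a b z1 z2 w : z1 != a -> z2 != b ->
  infix [:: a; b] (z1 :: rcons w z2) ->
  exists p q, w = rcons p a ++ b :: q.
Proof.
move=> z1a z2b /infixP[[|z p] [q]] [E]; first by rewrite E eqxx in z1a.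
move=> {z E}; case/lastP: q => [|q y].
  rewrite -[[:: a; b]]/(rcons [:: a] b) -rcons_cat => /eqP.
  by rewrite eqseq_rcons (negPf z2b) andbF.
rewrite -[[:: a, b & rcons q y]]/(rcons [:: a, b & q] y) -rcons_cat => /eqP.
rewrite eqseq_rcons => /andP[/eqP -> _].
by exists p, q; rewrite cat_rcons.
Qed.

(** A loop avoiding a path from the boundary to the origin crosses the zipper
    an even number of times: off the path, the signs of the zipped weights can
    be removed by a change of signs at the vertices. *)
Lemma loop_sum_zipped n z1 w : bdry n z1 -> path adjacent z1 w ->
  origin \in w ->
  loop_sum (zipped R) (fset_remove (boxf n) w) = loop_sum (srw R) (fset_remove (boxf n) w).
Proof.
move=> zb wp ow; pose B := fset_remove (boxf n) w.
have [p [q [wE pp]]] : exists p q, w = rcons p origin ++ q /\ path adjacent z1 (rcons p origin).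
  case/splitPr: ow wp => p q; rewrite -cat_rcons cat_path => /andP[pp _].
  by exists p, q.
have z1B : ~~ in_box n z1 by case/bdryP: zb.
have inB u : u \in B -> in_box n u /\ u \notin z1 :: rcons p origin.
  rewrite in_fset_remove in_boxf => /andP[uB uw]; split => //.
  rewrite inE negb_or; apply/andP; split; first by apply: contraNneq z1B => <-.
  by apply: contraNN uw; rewrite wE mem_cat => ->.
pose eps u : R := (-1) ^+ side n z1 (rcons p origin) u.
have ee u : eps u * eps u = 1 by rewrite -expr2 sqrr_sign.
have gauge u v : u \in B -> v \in B -> zipped R u v = eps u * srw R u v * eps v.
  move=> /inB[uB us] /inB[vB vs]; rewrite /zipped /srw; case: ifP => uv; last by rewrite !mulr0 mul0r.
  have lp : last z1 (rcons p origin) = origin by rewrite last_rcons.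
  by rewrite -(side_step zb pp lp uB vB uv us vs) signr_addb mulrAC.
congr (limn (series _)); apply/funext => k; congr (_ / _).
apply: eq_big_seq => u uB; rewrite (walk_weight_gauge k ee gauge)//.
by rewrite mulrAC ee mul1r.
Qed.

(** A path that uses the edge backwards is reversed, which exchanges its
    endpoints. *)
Lemma crossing_parity_path n z1 z2 w : (0 < n)%N -> z1 != z2 -> bdry n z1 -> bdry n z2 ->
  path adjacent z1 (rcons w z2) -> uniq (z1 :: rcons w z2) -> all (in_box n) w ->
  (infix [:: origin; site1] (z1 :: rcons w z2) ->
     path_parity crossb z1 (rcons w z2) = crossing_parity n z1 z2) /\
  (infix [:: site1; origin] (z1 :: rcons w z2) ->
     path_parity crossb z1 (rcons w z2) = crossing_parity n z2 z1).
Proof.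
move=> n0 z12 zb1 zb2 wp uw wB.
have nb z u : bdry n z -> in_box n u -> z != u.
  by move=> /bdryP[zB _] uB; apply: contraNneq zB => ->.
have oB := origin_in_box n0.
have sB := site1_in_box n0.
split=> [|] /infix2_split.
  move=> /(_ (nb _ _ zb1 oB) (nb _ _ zb2 sB))[p [q wE]].
  move: wp uw wB; rewrite {}wE rcons_cat rcons_cons all_cat => wp uw /andP[pB /= /andP[_ qB]].
  by apply: path_crossing_parity => //; rewrite last_rcons.
move=> /(_ (nb _ _ zb1 sB) (nb _ _ zb2 oB))[p [q wE]].
rewrite -(path_parity_rev z1 (rcons w z2) crossb_sym) last_rcons.
have rE : rev (belast z1 (rcons w z2)) = rcons (rev q) origin ++ site1 :: rcons (rev p) z1.
  have : rev (z1 :: rcons w z2) = z2 :: rev (belast z1 (rcons w z2)).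
    by rewrite lastI last_rcons rev_rcons.
  rewrite wE -rcons_cons rev_rcons => -[<-].
  by rewrite -cat_cons rev_cat rev_cons -[z1 :: rcons p _]rcons_cons rev_rcons rev_cons.
rewrite rE; move: wB; rewrite wE all_cat all_rcons => /andP[/andP[_ pB] /= /andP[_ qB]].
have up : uniq (z2 :: rcons (rev q) origin ++ site1 :: rcons (rev p) z1).
  by rewrite -rE -rev_rcons -{2}(last_rcons z1 w z2) -lastI rev_uniq.
have pr : path adjacent z2 (rcons (rev q) origin ++ site1 :: rcons (rev p) z1).
  rewrite -rE -{1}(last_rcons z1 w z2) rev_path.
  by rewrite (eq_path (e' := adjacent))// => u v; rewrite /= adjacent_sym.
apply: path_crossing_parity => //; first by rewrite last_rcons.
  by rewrite all_rcons oB all_rev.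
by rewrite all_rev.
Qed.

End MarkedEdge.

Section Assembly.
Variables (R : realType) (n : nat) (z1 z2 : site).
Hypotheses (n0 : (0 < n)%N) (zb1 : bdry n z1) (zb2 : bdry n z2) (z12 : z1 != z2).
Local Notation A := (boxf n).
Local Notation p := (srw R).
Local Notation q := (zipped R).

Definition self_avoiding_paths : seq (seq site) :=
  [seq z1 :: x :: rcons t z2 | x <- enum_fset A, t <- saw_tails #|` A| A x].

Lemma uniq_self_avoiding_paths : uniq self_avoiding_paths.
Proof.
apply: allpairs_uniq_dep => [|x _|]; first exact: fset_uniq.
  exact: uniq_saw_tails.
move=> [x t] [x' t'] _ _ /= [-> /eqP]; rewrite eqseq_rcons eqxx andbT => /eqP ->.
by [].
Qed.

Definition phat_weight x t : R :=
  p z1 x * path_weight p x (rcons t z2) * erasure_weight p A (x :: t).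

Lemma phat_weight_ge0 x t : uniq (x :: t) -> all (in_box n) (x :: t) -> 0 <= phat_weight x t.
Proof.
move=> uxt xtB; rewrite /phat_weight erasure_weightE//.
- by rewrite !mulr_ge0 ?expR_ge0 ?srw_ge0 ?path_weight_ge0// => *; exact: srw_ge0.
- exact: contracting_srw.
- by move=> y /(allP xtB); rewrite in_boxf.
Qed.

Lemma esum_Wstar : (\esum_(eta in Wstar n z1 z2) phat R n z1 z2 eta =
  (\sum_(x <- A) \sum_(t <- saw_tails #|` A| A x)
     (if `[< Wstar n z1 z2 (z1 :: x :: rcons t z2) >] then phat_weight x t else 0))%:E)%E.
Proof.
have WE eta : Wstar n z1 z2 eta -> exists x t, [/\ eta = z1 :: x :: rcons t z2,
    uniq (x :: t), all (in_box n) (x :: t) & eta \in self_avoiding_paths].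
  move=> [/(KpathsP _ _ z12)[[|x t] [-> wp wB]] ue hi].
    exfalso; case/bdryP: zb1 => z1B _.
    have no a b : in_box n a -> infix [:: a; b] [:: z1; z2] = false.
      move=> aB; rewrite infix_consl infix_consl /= (_ : (a == z1) = false) ?andbF//=.
      by apply: contraNF z1B => /eqP <-.
    have oB := origin_in_box n0.
    have sB := site1_in_box n0.
    by move: hi; rewrite -[z1 :: rcons _ _]/[:: z1; z2] !no.
  exists x, t; have uxt : uniq (x :: t).
    by move: ue => /= /andP[_]; rewrite rcons_uniq mem_rcons inE => /andP[]; rewrite !negb_or => /andP[_ ->] /andP[].
  split => //; apply/allpairsPdep; exists x, t; split => //.
    by rewrite in_boxf; move: wB => /= /andP[].
  rewrite mem_saw_tails ?uxt//=.
    by apply/allP => y yt /=; rewrite in_boxf (allP wB)// inE yt orbT.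
  by rewrite in_boxf; move: wB => /= /andP[].
pose F eta : R := if `[< Wstar n z1 z2 eta >] then fine (phat R n z1 z2 eta) else 0.
have FE x t : uniq (x :: t) -> all (in_box n) (x :: t) -> F (z1 :: x :: rcons t z2) =
    if `[< Wstar n z1 z2 (z1 :: x :: rcons t z2) >] then phat_weight x t else 0.
  by move=> uxt xtB; rewrite /F phat_erasure_weight.
have F0 eta : 0 <= F eta.
  rewrite /F; case: asboolP => // /WE[x [t [-> uxt xtB _]]].
  by rewrite phat_erasure_weight//=; exact: phat_weight_ge0.
rewrite (eq_esum (b := fun eta => (F eta)%:E)); last first.
  move=> eta We; have [x [t [E uxt xtB _]]] := WE _ We; move: We; rewrite E => We.
  by rewrite FE// phat_erasure_weight//; case: asboolP.
rewrite (@esum_eq_support R _ _ [set` self_avoiding_paths]); first last.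
- by move=> eta _ nW; rewrite /F; case: asboolP.
- by move=> eta /WE[x [t [_ _ _ H]]].
rewrite esum_seq//; last exact: uniq_self_avoiding_paths.
congr EFin; rewrite big_allpairs_dep; apply: eq_big_seq => x xA; apply: eq_big_seq => t.
rewrite mem_saw_tails// => /andP[uxt tB]; apply: FE => //=.
rewrite -in_boxf xA; apply/allP => y /(allP tB) /=; by rewrite in_boxf.
Qed.

Definition parity_sign : R := (-1) ^+ crossing_parity n z1 z2.

(** Passing to the zipped weights: the loops that meet the path gain the factor
    [exp(L_A(p) - L_A(q))] by [loop_sum_zipped], and the sign of the path is the
    product of [parity_sign] and of the direction of the edge. *)
Lemma phat_weight_zipped x t : x \in A -> t \in saw_tails #|` A| A x ->
  (if `[< Wstar n z1 z2 (z1 :: x :: rcons t z2) >] then phat_weight x t else 0) =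
  expR (loop_sum p A - loop_sum q A) * parity_sign *
  (path_sum (edge_sign R origin site1) x (rcons t z2) *
   (q z1 x * path_weight q x (rcons t z2) * erasure_weight q A (x :: t))).
Proof.
move=> xA; rewrite mem_saw_tails// => /andP[uxt tA].
have xtA : all (mem A) (x :: t) by rewrite /= xA.
have xtB : all (in_box n) (x :: t).
  by apply/allP => y /(allP xtA) /=; rewrite in_boxf.
have [z1B _] := bdryP _ _ zb1; have [z2B _] := bdryP _ _ zb2.
have nz1 : z1 \notin x :: t by apply: contraNN z1B => /(allP xtB).
have nz2 : z2 \notin x :: t by apply: contraNN z2B => /(allP xtB).
have uw : uniq (z1 :: rcons (x :: t) z2).
  by rewrite cons_uniq mem_rcons inE negb_or z12 nz1 rcons_uniq nz2.
have oB := origin_in_box n0.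
have sB := site1_in_box n0.
have infixE a b : in_box n a -> infix [:: a; b] (z1 :: rcons (x :: t) z2) =
    infix [:: a; b] (x :: rcons t z2).
  move=> aB; rewrite infix_consl rcons_cons /= (_ : (a == z1) = false)//.
  by apply: contraNF z1B => /eqP <-.
have uw' : uniq (x :: rcons t z2) by move: uw; rewrite /= => /andP[].
rewrite (path_sum_edge_sign R _ _ uw') -!infixE//.
have -> : q z1 x * path_weight q x (rcons t z2) = path_weight q z1 (rcons (x :: t) z2) by [].
rewrite path_weight_zipped path_weight_srw.
have pE : p z1 x * path_weight p x (rcons t z2) =
    if path adjacent z1 (rcons (x :: t) z2) then 4 ^- size (rcons (x :: t) z2) else 0.
  by rewrite -path_weight_srw.
case: asboolP => [[/(KpathsP _ _ z12)[v [[vE] vp _]] _ hi]|nW]; last first.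
  case: ifP => wp; last by rewrite !(mulr0, mul0r).
  have Kw : Kpaths n z1 z2 (z1 :: rcons (x :: t) z2) by apply/KpathsP => //; exists (x :: t).
  have -> : infix [:: origin; site1] (z1 :: rcons (x :: t) z2) = false.
    by apply: contra_notF nW => i1; split => //; rewrite i1.
  have -> : infix [:: site1; origin] (z1 :: rcons (x :: t) z2) = false.
    by apply: contra_notF nW => i1; split => //; rewrite i1 orbT.
  by rewrite subrr mul0r mulr0.
have wp : path adjacent z1 (rcons (x :: t) z2) by rewrite rcons_cons vE.
have xtp : path adjacent z1 (x :: t) by move: wp; rewrite rcons_path => /andP[].
have oxt : origin \in x :: t.
  have : origin \in z1 :: rcons (x :: t) z2.
    by case/orP: hi => /infixP[l [l' ->]]; rewrite mem_cat !inE eqxx ?orbT.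
  rewrite inE mem_rcons inE; case/or3P => // /eqP E; first by rewrite -E oB in z1B.
  by rewrite -E oB in z2B.
rewrite /phat_weight pE wp.
have sxA : {subset x :: t <= A} by move=> y /(allP xtA).
rewrite (erasure_weightE (contracting_srw R n) uxt sxA).
rewrite (erasure_weightE (contracting_zipped R (fsubset_refl A)) uxt sxA).
rewrite (loop_sum_zipped R zb1 xtp oxt).
set C := loop_sum p (fset_remove _ _); set c := (4 ^- _).
have -> : expR (loop_sum p A - C) = expR (loop_sum p A - loop_sum q A) * expR (loop_sum q A - C).
  by rewrite -expRD; congr expR; ring.
set e1 := expR (_ - loop_sum q A); set e2 := expR (_ - C).
suff : parity_sign * ((infix [:: origin; site1] (z1 :: rcons (x :: t) z2))%:R -
   (infix [:: site1; origin] (z1 :: rcons (x :: t) z2))%:R) *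
   (-1) ^+ path_parity crossb z1 (rcons (x :: t) z2) = 1.
  set i1 := (infix _ _)%:R; set i2 := (infix _ _)%:R; set j := (-1) ^+ path_parity _ _ _ => H.
  by transitivity ((parity_sign * (i1 - i2) * j) * (c * (e1 * e2))); [rewrite H mul1r|ring].
have [par1 par2] := crossing_parity_path n0 z12 zb1 zb2 wp uw xtB.
case/orP: hi => hi.
  by rewrite par1// hi (negPf (infix2_asym uw hi)) subr0 mulr1 -expr2 sqrr_sign.
rewrite par2// hi (negPf (infix2_asym uw hi)) sub0r.
rewrite (crossing_parityN n0 zb1 zb2 z12) /parity_sign -addTb signr_addb expr1.
by rewrite mulrN1 mulN1r mulrNN -expr2 sqrr_sign.
Qed.

Lemma erasure_pair : erasure_weight q A [:: origin; site1] =
  expR (loop_sum q A - loop_sum q (fset_remove A [:: origin; site1])).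
Proof.
rewrite erasure_weightE//; first exact: contracting_zipped (fsubset_refl _).
move=> y; rewrite in_cons mem_seq1 in_boxf => /orP[/eqP->|/eqP->].
  exact: origin_in_box.
exact: site1_in_box.
Qed.

Lemma Q01_erasure_weight :
  Q01 R (box n) = (green q A origin origin * green q (A `\ origin)%fset site1 site1)%:E.
Proof.
rewrite /Q01 (_ : [set L | _] = loops_through n [:: origin; site1]); last first.
  rewrite /loops_through; congr mkset; apply/funext => L.
  congr (_ /\ (_ `&` _) !=set0); apply/seteqP; split => v /=; rewrite !inE.
    by move=> [->|->]; rewrite eqxx ?orbT.
  by move=> /orP[/eqP->|/eqP->]; [left|right].
rewrite signed_sum_loops; transitivity (erasure_weight q A [:: origin; site1])%:E.
  by rewrite erasure_pair.
by rewrite /= mulr1.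
Qed.

Lemma esum_phat d (Omega : measurableType d) (P : probability Omega R)
    (S : nat -> Omega -> site) : simple_random_walk P S ->
  (\esum_(eta in Wstar n z1 z2) phat R n z1 z2 eta =
   (4^-1)%:E * Q01 R (box n) * expeR (2%:E * loop_mass R (odd_loops (box n)))
     * (Phi P S n z1 z2)%:E)%E.
Proof.
move=> hS.
have oA : origin \in A by rewrite in_boxf origin_in_box.
have sA : site1 \in A by rewrite in_boxf site1_in_box.
have z2A : z2 \notin A by rewrite in_boxf; case/bdryP: zb2.
have cq : contracting q A := contracting_zipped R (fsubset_refl _).
have L0 : (0 <= \esum_(eta in Wstar n z1 z2) phat R n z1 z2 eta)%E.
  apply: esum_ge0 => eta _; apply: esum_ge0 => w _.
  by rewrite lee_fin /weight invr_ge0 exprn_ge0.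
rewrite esum_Wstar Q01_erasure_weight loop_mass_odd -!EFinM /= -?EFinM; congr EFin.
move: L0; rewrite esum_Wstar lee_fin.
rewrite (eq_big_seq (fun x => expR (loop_sum p A - loop_sum q A) * parity_sign *
   \sum_(t <- saw_tails #|` A| A x) path_sum (edge_sign R origin site1) x (rcons t z2) *
   (q z1 x * path_weight q x (rcons t z2) * erasure_weight q A (x :: t)))); last first.
  move=> x xA; rewrite mulr_sumr; apply: eq_big_seq => t tA; exact: phat_weight_zipped.
rewrite -mulr_sumr fomin_edge//; last exact: zipped_sym.
rewrite excursion_det// -/(punctured_box n) !excursion_site1 -!(Rn_excursion hS)//;
  try exact: bdry_reflection.
rewrite -/(Phi _ _ _ _ _).
have -> : q origin site1 = 4^-1 by rewrite /zipped /srw /= mul1r.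
rewrite [2 * _]mulrC divfK//.
have g0 : 0 < green q A origin origin * green q (A `\ origin)%fset site1 site1.
  by rewrite -[X in _ * X]mulr1 -/(erasure_weight q A [:: origin; site1]) erasure_pair expR_gt0.
(* The sum is nonnegative, so that its unknown sign is that of the determinant. *)
rewrite /Phi; set X := expR _; set g := _ * green _ _ _ _ in g0 *; set D := Rn P S n z1 * _ - _ * _ .
move=> H.
have -> : X * parity_sign * (4^-1 * (g * D)) = (4^-1 * g * X) * (parity_sign * D) by ring.
have X0 : 0 < X by exact: expR_gt0.
clearbody X g D; have pos : 0 < 4^-1 * g * X by rewrite !mulr_gt0.
congr (_ * _); move: H.
have -> : X * parity_sign * (4^-1 * (g * D)) = (4^-1 * g * X) * (parity_sign * D) by ring.
rewrite pmulr_rge0// => sD; rewrite -[LHS]ger0_norm// normrM /parity_sign normrX normrN1 expr1n mul1r.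
by [].
Qed.

End Assembly.

Theorem theorem5p1 (R : realType) (d : measure_display)
    (Omega : measurableType d) (P : probability Omega R)
    (S : nat -> Omega -> site) (hS : simple_random_walk P S)
    (n : nat) (hn : (0 < n)%N) (z1 z2 : site)
    (hz1 : boundary R n z1) (hz2 : boundary R n z2) :
  (\esum_(eta in Wstar n z1 z2) phat R n z1 z2 eta =
   (4^-1)%:E * Q01 R (box n) * expeR (2%:E * loop_mass R (odd_loops (box n)))
     * (Phi P S n z1 z2)%:E)%E.
Proof.
have zb1 := (boundaryE R z1 hn).1 hz1; have zb2 := (boundaryE R z2 hn).1 hz2.
have [z12|z12] := eqVneq z1 z2; last exact: esum_phat.
(* A self-avoiding path from [z1] to itself is a single point. *)
rewrite -z12 /Phi [X in `|_ - X|]mulrC subrr normr0 mule0.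
rewrite (_ : Wstar n z1 z1 = set0) ?esum_set0//; apply/seteqP; split => // w [[wp w0 wl _] uw hi].
case: w wp w0 wl uw hi => // a s _ /= -> + + hi; rewrite /nsteps /= -last_nth0.
case: s hi => [|b s hi ls]; first by rewrite /= !andbF.
by rewrite -[X in X \notin _]ls; have /= := mem_last b s => ->.
Qed.
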